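(* Let $\bar a\in L_\infty(D)$ with $\operatorname{ess\,inf}\bar a>0$. Assume that there exists an increasing sequence $(\rho_j)_{j\in\mathbb N}$ of numbers strictly larger than $1$ such that $(\rho_j^{-1})_{j\in\mathbb N}\in\ell_q(\mathbb N)$ for some $q$ with $0<q<2$, and $$\left\|\frac{\sum_{j\in\mathbb N}\rho_j|\psi_j|}{\bar a}\right\|_{L_\infty(D)}<1 .$$ Let $u(\boldsymbol y)$, $\boldsymbol y\in\mathbb I^\infty$, be the solution of the parametric elliptic problem $-\operatorname{div}(A(\boldsymbol y)\nabla u(\boldsymbol y))=f$ in $D$, $u(\boldsymbol y)|_{\partial D}=0$, with the affine coefficient $A(\boldsymbol y)=\bar a+\sum_{j=1}^\infty y_j\psi_j$. Then for every integer $n\ge4$ there is a number $\xi_n>0$ such that we can construct a deep ReLU neural network $\boldsymbol\phi_{\Lambda(\xi_n)}:=(\phi_{\boldsymbol s})_{\boldsymbol s\in\Lambda(\xi_n)}$ on $\mathbb R^m$, with $m:=\left\lfloor K\frac n{\log n}\right\rfloor$ for some positive constant $K$, having the following properties. (i) The deep ReLU neural network $\boldsymbol\phi_{\Lambda(\xi_n)}$ is independent of $u$. (ii) The input and output dimensions of $\boldsymbol\phi_{\Lambda(\xi_n)}$ are at most $m$. (iii) $W(\boldsymbol\phi_{\Lambda(\xi_n)})\le n$. (iv) $L(\boldsymbol\phi_{\Lambda(\xi_n)})\le C\,\log n\,\log\log n$. (v) The components $\phi_{\boldsymbol s}$, $\boldsymbol s\in\Lambda(\xi_n)$, of $\boldsymbol\phi_{\Lambda(\xi_n)}$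 are deep ReLU neural networks on $\mathbb R^{|\nu_{\boldsymbol s}|}$. Extending $\phi_{\boldsymbol s}$ to $\mathbb I^\infty$ by $\phi_{\boldsymbol s}(\boldsymbol y):=\phi_{\boldsymbol s}((y_j)_{j\in\nu_{\boldsymbol s}})$, the approximation of $u$ by $\Phi_{\Lambda(\xi_n)}u(\boldsymbol y):=\sum_{\boldsymbol s\in\Lambda(\xi_n)}t_{\boldsymbol s}\,\phi_{\boldsymbol s}(\boldsymbol y)$ gives the error estimates $$\|u-\Phi_{\Lambda(\xi_n)}u\|_{L_\infty(\mathbb I^\infty,V)}\le C\,m^{-(1/q-1/2)}\le C\left(\frac n{\log n}\right)^{-(1/q-1/2)} .$$ Here the positive constants $C$ (which may take different values at different places) are independent of $u$ and $n$.
   Context: Setting: $D\subset\mathbb R^d$ is a bounded Lipschitz domain, $V:=H_0^1(D)$, $f\in H^{-1}(D)$ (the dual of $V$) is fixed, $\psi_j\in L_\infty(D)$ for $j\in\mathbb N$, $\mathbb I^\infty:=[-1,1]^{\mathbb N}$. $u(\boldsymbol y)\in V$ is the unique weak solution: $\int_DA(\boldsymbol y)\nabla u(\boldsymbol y)\cdot\nabla w\,dx=\langle f,w\rangle$ for all $w\in V$. $L_\infty(\mathbb I^\infty,V)$ is the space of functions $\mathbb I^\infty\to V$ with the uniform norm (the essential supremum of $\|\cdot\|_V$ with respect to the uniform probability measure on $\mathbb I^\infty$). $\mathbb F$ is the set of sequences $\boldsymbol s=(s_j)_{j\in\mathbb N}$ of non-negative integers with finite support $\nu_{\boldsymbol s}:=\{j:s_j>0\}$;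 $\boldsymbol s!=\prod_js_j!$. The Taylor coefficients of $u$ are $t_{\boldsymbol s}:=\frac1{\boldsymbol s!}\partial^{\boldsymbol s}u(\boldsymbol 0)\in V$, where $\partial^{\boldsymbol s}$ is the mixed partial derivative in the variables $(y_j)$. Put $\sigma_{\boldsymbol s}:=\prod_{j\in\mathbb N}\rho_j^{s_j}$ and $\Lambda(\xi):=\{\boldsymbol s\in\mathbb F:\sigma_{\boldsymbol s}^q\le\xi\}$ for $\xi>0$. ReLU networks: let $\mathrm{relu}(t)=\max\{t,0\}$, applied componentwise. For $d,L\in\mathbb N$, $L\ge2$, $N_0=d$, $N_1,\dots,N_L\in\mathbb N$, a ReLU neural network $\Phi$ with input dimension $d$, output dimension $N_L$ and $L$ layers is a sequence $((W^1,b^1),\dots,(W^L,b^L))$ with $W^\ell\in\mathbb R^{N_\ell\times(N_0+\dots+N_{\ell-1})}$, $b^\ell\in\mathbb R^{N_\ell}$. Its output is $\Phi(x):=z^L$, where $z^0:=x\in\mathbb R^d$, $z^\ell:=\mathrm{relu}(W^\ell(z^0,\dots,z^{\ell-1})^{T}+b^\ell)$ for $1\le\ell\le L-1$, and $z^L:=W^L(z^0,\dots,z^{L-1})^{T}+b^L$. The depth is $L(\Phi)=L$; the size $W(\Phi)$ is the number of nonzero entries of all $W^\ell$ and $b^\ell$; $\Phi$ is called deep if $L(\Phi)\ge3$. A network is identified with its output function. $(\phi_{\boldsymbol s})_{\boldsymbol s\in\Lambda}$ denotes a network whose output vector has the components $\phi_{\boldsymbol s}$; the component $\phi_{\boldsymbol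 s}$ on $\mathbb R^{|\nu_{\boldsymbol s}|}$ reads only the input coordinates $y_j$, $j\in\nu_{\boldsymbol s}$. *)

(* Defs.v *)
From HB Require Import structures.
From mathcomp Require Import all_boot all_order all_algebra.
From mathcomp Require Import finmap.
From mathcomp Require Import all_classical all_reals all_analysis.
From mathcomp Require Import ess_sup_inf.

Set Implicit Arguments.
Unset Strict Implicit.
Unset Printing Implicit Defensive.

Import Order.TTheory GRing.Theory Num.Theory.
Import numFieldNormedType.Exports.

Local Open Scope classical_set_scope.
Local Open Scope ring_scope.

Definition measure_rV_display : measure_display. Proof. exact. Qed.

(* The product sigma-algebra, i.e. the Borel sets of R^d. *)
Section measurable_rV.
Context {R : realType} (d : nat).

Let coor : 'I_d -> 'rV[R]_d -> R := fun i x => x 0 i.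

Let rV_set0 : g_sigma_preimage coor set0.
Proof. exact: sigma_algebra0. Qed.

Let rV_setC A : g_sigma_preimage coor A -> g_sigma_preimage coor (~` A).
Proof. exact: sigma_algebraC. Qed.

Let rV_bigcup (F : (set 'rV[R]_d)^nat) :
  (forall i, g_sigma_preimage coor (F i)) ->
  g_sigma_preimage coor (\bigcup_i (F i)).
Proof. exact: sigma_algebra_bigcup. Qed.

HB.instance Definition _ := @isMeasurable.Build measure_rV_display
  'rV[R]_d (g_sigma_preimage coor) rV_set0 rV_setC rV_bigcup.

End measurable_rV.

Lemma measurable_coor (R : realType) d (i : 'I_d) :
  measurable_fun [set: 'rV[R]_d] (fun x => x 0 i).
Proof.
move=> _ Y mY; rewrite setTI; apply: sub_sigma_algebra => /=.
rewrite -bigcup_seq/=; exists i => /=; first by rewrite mem_index_enum.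
by exists Y => //; rewrite setTI.
Qed.

Lemma measurable_fun_rV (R : realType) dT (T : measurableType dT) d
    (f : T -> 'rV[R]_d) :
  (forall i, measurable_fun [set: T] (fun t => f t 0 i)) ->
  measurable_fun [set: T] f.
Proof.
move=> mf.
have sub : g_sigma_preimage (fun i t => f t 0 i) `<=` measurable.
  apply: smallest_sub; first exact: sigma_algebra_measurable.
  case: d => [|d] in f mf *; first by rewrite big_ord0.
  rewrite -bigcup_mkord_ord; apply: bigcup_sub => i Ii.
  by move=> A [B mB <-]; exact: mf.
move=> _ A mA; apply: sub.
rewrite (g_sigma_preimage_comp (fun i (x : 'rV[R]_d) => x 0 i) f).
by exists A.
Qed.

Section next_dimension.
Context {R : realType} (d : nat).
Variable mu : {sigma_finite_measure set 'rV[R]_d -> \bar R}.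

Definition glue_coor (p : R * 'rV[R]_d) : 'rV[R]_d.+1 :=
  row_mx (p.1%:M : 'rV[R]_1) p.2.

Lemma glue_coor0 p : glue_coor p 0 0 = p.1.
Proof.
have -> : 0 = lshift d 0 :> 'I_(1 + d) by exact/val_inj.
by rewrite [LHS]row_mxEl mxE.
Qed.

Lemma glue_coorS p i : glue_coor p 0 (lift ord0 i) = p.2 0 i.
Proof.
have -> : lift ord0 i = rshift 1 i :> 'I_(1 + d) by exact/val_inj.
by rewrite [LHS]row_mxEr.
Qed.

Lemma measurable_glue_coor : measurable_fun [set: R * 'rV[R]_d] glue_coor.
Proof.
apply: measurable_fun_rV => i; have [j ->|->] := unliftP ord0 i; last first.
  by under eq_fun do rewrite glue_coor0; exact: measurable_fst.
under eq_fun do rewrite glue_coorS.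
exact: measurableT_comp (measurable_coor j) measurable_snd.
Qed.

Definition next_measure : set 'rV[R]_d.+1 -> \bar R :=
  pushforward (@lebesgue_measure R \x mu)%E glue_coor.

Let measure_next : {measure set 'rV[R]_d.+1 -> \bar R} :=
  measure_function_pushforward__canonical__measure_function_Measure
    (@lebesgue_measure R \x mu)%E measurable_glue_coor.

HB.instance Definition _ := Measure.copy next_measure measure_next.

Let unglue (x : 'rV[R]_d.+1) : R * 'rV[R]_d :=
  (x 0 0, \row_i x 0 (lift ord0 i)).

Let unglueK : cancel glue_coor unglue.
Proof.
move=> [t x]; rewrite /unglue glue_coor0; congr pair.
by apply/rowP => i; rewrite mxE glue_coorS.
Qed.

Let measurable_unglue : measurable_fun [set: 'rV[R]_d.+1] unglue.
Proof.
apply: measurable_fun_pair; first exact: measurable_coor.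
apply: measurable_fun_rV => i; under eq_fun do rewrite mxE.
exact: measurable_coor.
Qed.

Let next_sigma_finite : sigma_finite setT next_measure.
Proof.
have /sigma_finiteP[F [TF ndF Foo]] := sigma_finiteT (@lebesgue_measure R).
have /sigma_finiteP[G [TG ndG Goo]] := sigma_finiteT mu.
exists (fun n => unglue @^-1` (F n `*` G n)).
  rewrite -preimage_bigcup -[LHS](preimage_setT unglue); congr (_ @^-1` _).
  rewrite -setXTT TF TG predeqE => -[x y]; split.
    move=> [/= [n _ Fnx] [k _ Gky]]; exists (maxn n k) => //; split.
    - by move: x Fnx; exact/subsetPset/ndF/leq_maxl.
    - by move: y Gky; exact/subsetPset/ndG/leq_maxr.
  by move=> [n _ []/= ? ?]; split; exists n.
move=> k; have [mF Fk] := Foo k; have [mG Gk] := Goo k.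
have mFG : measurable (F k `*` G k) by exact: measurableX.
split; first by rewrite -[X in measurable X]setTI; exact: measurable_unglue.
rewrite /next_measure /pushforward -comp_preimage.
rewrite (_ : unglue \o glue_coor = id); last by apply/funext => p /=.
by rewrite preimage_id product_measure1E// lte_mul_pinfty// ge0_fin_numE.
Qed.

HB.instance Definition _ :=
  Measure_isSigmaFinite.Build _ _ _ next_measure next_sigma_finite.

End next_dimension.

Fixpoint lebesgue_rV (R : realType) (d : nat) :
    {sigma_finite_measure set 'rV[R]_d -> \bar R} :=
  match d with
  | 0 => \d_(0 : 'rV[R]_0)
  | d'.+1 => next_measure (lebesgue_rV R d')
  end.

Lemma measurable_box (R : realType) d (A : 'I_d -> set R) :
  (forall i, measurable (A i)) ->
  measurable [set x : 'rV[R]_d | forall i, A i (x 0 i)].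
Proof.
move=> mA.
have -> : [set x : 'rV[R]_d | forall i, A i (x 0 i)] =
    \bigcap_(i in [set: 'I_d]) ((fun x : 'rV[R]_d => x 0 i) @^-1` A i).
  by apply/seteqP; split => x /= Ax i; [move=> _; exact: Ax | exact: Ax].
apply: fin_bigcap_measurable; first exact: finite_finset.
by move=> i _; rewrite -[X in measurable X]setTI; exact: measurable_coor.
Qed.

Lemma lebesgue_rV_box (R : realType) d (A : 'I_d -> set R) :
  (forall i, measurable (A i)) ->
  lebesgue_rV R d [set x | forall i, A i (x 0 i)] =
  (\prod_(i < d) lebesgue_measure (A i))%E.
Proof.
elim: d => [|d IHd] in A * => mA.
  by rewrite big_ord0 [LHS]diracE mem_set// => -[].
have mB := measurable_box (fun i => mA (lift ord0 i)).
rewrite big_ord_recl -IHd; last by move=> i; exact: mA.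
apply: etrans (product_measure1E lebesgue_measure (lebesgue_rV R d)
  (mA ord0) mB).
rewrite /= /next_measure /pushforward; congr (_ _).
apply/seteqP; split => -[t x] /=.
  move=> Ax; split=> [|i]; first by have := Ax ord0; rewrite glue_coor0.
  by have := Ax (lift ord0 i); rewrite glue_coorS.
by move=> [At Ax] i; have [j ->|->] := unliftP ord0 i;
  rewrite ?glue_coorS ?glue_coor0.
Qed.

Section sobolev.
Context {R : realType} {d : nat}.
Local Notation E := 'rV[R]_d.
Local Notation leb := (lebesgue_rV R d).

Definition dot (x y : E) : R := \sum_i x 0 i * y 0 i.

(* Near each boundary point, D is the part of space above the graph of a
   Lipschitz function g over the hyperplane orthogonal to a unit vector e. *)
Definition lipschitz_boundary (D : set E) : Prop :=
  forall p, closure D p -> ~ D p ->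
    exists (e : E) (g : E -> R) (k : R),
      [/\ dot e e = 1, k.-lipschitz g &
          \forall x \near p, D x <-> g (x - dot x e *: e) < dot x e].

Definition bounded_lipschitz_domain (D : set E) : Prop :=
  [/\ D !=set0, open D, connected D, bounded_set D & lipschitz_boundary D].

Definition partial (i : 'I_d) (phi : E -> R) : E -> R :=
  fun x => 'D_(delta_mx 0 i) phi x.

Definition smooth (phi : E -> R) : Prop :=
  forall s : seq 'I_d, let psi := foldr partial phi s in
    continuous psi /\ forall i x, derivable psi x (delta_mx 0 i).

Definition test_function (D : set E) (phi : E -> R) : Prop :=
  smooth phi /\
  exists K, [/\ compact K, K `<=` D & forall x, ~ K x -> phi x = 0].

Definition Lp_norm (p : \bar R) (D : set E) (f : E -> R) : \bar R :=
  'N[leb]_p[EFin \o (f \_ D)]%E.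

Definition in_Lp (p : \bar R) (D : set E) (f : E -> R) : Prop :=
  measurable_fun D f /\ (Lp_norm p D f < +oo)%E.

Definition weak_derivative (D : set E) (i : 'I_d) (f g : E -> R) : Prop :=
  forall phi, test_function D phi ->
    (\int[leb]_(x in D) (f x * partial i phi x)%:E =
     - \int[leb]_(x in D) (g x * phi x)%:E)%E.

(* A Sobolev function together with its weak gradient. As usual, functions
   that agree almost everywhere are not distinguished; all notions below depend
   on them only through integrals. *)
Definition sobolev_fun : Type := ((E -> R) * ('I_d -> E -> R))%type.

HB.instance Definition _ := GRing.Lmodule.on sobolev_fun.
HB.instance Definition _ := Choice.on sobolev_fun.

Definition grad_norm (D : set E) (v : sobolev_fun) : \bar R :=
  Lp_norm 2%:E D (fun x => Num.sqrt (\sum_i (v.2 i x) ^+ 2)).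

Definition H1 (D : set E) : set sobolev_fun :=
  [set v | in_Lp 2%:E D v.1 /\
    forall i, in_Lp 2%:E D (v.2 i) /\ weak_derivative D i v.1 (v.2 i)].

Definition classical_sobolev (phi : E -> R) : sobolev_fun :=
  (phi, fun i => partial i phi).

Definition H10 (D : set E) : set sobolev_fun :=
  [set v | H1 D v /\ forall eps : R, 0 < eps ->
    exists phi, [/\ test_function D phi,
      (Lp_norm 2%:E D (v - classical_sobolev phi)%R.1 < eps%:E)%E &
      (grad_norm D (v - classical_sobolev phi)%R < eps%:E)%E]].

Definition dual_H10 (D : set E) (f : sobolev_fun -> R) : Prop :=
  (forall (a : R) v w, H10 D v -> H10 D w -> f (a *: v + w) = a * f v + f w) /\
  exists B : R, forall v, H10 D v -> (`|f v|%:E <= B%:E * grad_norm D v)%E.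

End sobolev.

Section parametric_problem.
Context {R : realType} {d : nat}.
Local Notation E := 'rV[R]_d.
Local Notation leb := (lebesgue_rV R d).

Definition infinite_cube : set (nat -> R) :=
  [set y | forall j, -1 <= y j <= 1].

Definition affine_coef (abar : E -> R) (psi : nat -> E -> R) (y : nat -> R)
    (x : E) : R :=
  abar x + \big[+%R/0]_(0 <= j <oo) (y j * psi j x).

Definition parametric_solution (D : set E) (abar : E -> R)
    (psi : nat -> E -> R) (f : @sobolev_fun R d -> R)
    (u : (nat -> R) -> @sobolev_fun R d) : Prop :=
  forall y, infinite_cube y ->
    H10 D (u y) /\
    forall w, H10 D w ->
      (\int[leb]_(x in D) (affine_coef abar psi y x *
         \sum_i (u y).2 i x * w.2 i x)%:E = (f w)%:E)%E.

Definition unit_seq (j : nat) : nat -> R := fun k => (k == j)%:R.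

(* The limit of the difference quotients is taken in H10 D, whose norm is the
   L2 norm of the gradient. *)
Definition is_pderiv (D : set E) (j : nat) (U : (nat -> R) -> @sobolev_fun R d)
    (y : nat -> R) (w : @sobolev_fun R d) : Prop :=
  H10 D w /\
  grad_norm D (h^-1 *: (U (y + h *: unit_seq j) - U y) - w) @[h --> 0^']
    --> 0%E.

Definition pderiv (D : set E) (j : nat) (U : (nat -> R) -> @sobolev_fun R d) :
    (nat -> R) -> @sobolev_fun R d :=
  fun y => xget 0 [set w | is_pderiv D j U y w].

End parametric_problem.

Definition multi_index := {fsfun nat -> nat with 0%N}.

Definition nu (s : multi_index) : seq nat := sort leq (finsupp s).

Definition mi_fact (s : multi_index) : nat := (\prod_(j <- nu s) (s j)`!)%N.

Definition sigma (R : realType) (rho : nat -> R) (s : multi_index) : R :=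
  \prod_(j <- nu s) rho j ^+ s j.

Definition Lambda (R : realType) (rho : nat -> R) (q xi : R) :
    set multi_index :=
  [set s | sigma rho s `^ q <= xi].

Definition mixed_pderiv (R : realType) d (D : set 'rV[R]_d) (s : multi_index)
    (U : (nat -> R) -> @sobolev_fun R d) : (nat -> R) -> @sobolev_fun R d :=
  foldr (fun j => iter (s j) (pderiv D j)) U (nu s).

Definition taylor_coef (R : realType) d (D : set 'rV[R]_d)
    (u : (nat -> R) -> @sobolev_fun R d) (s : multi_index) : @sobolev_fun R d :=
  (mi_fact s)%:R^-1 *: mixed_pderiv D s u 0.

Section uniform_measure.
Context {R : realType}.

Definition cylinder (n : nat) (a b : nat -> R) : set (nat -> R) :=
  infinite_cube `&` [set y | forall j, (j < n)%N -> a j <= y j <= b j].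

Definition cylinder_measure (n : nat) (a b : nat -> R) : R :=
  \prod_(j < n) ((b j - a j) / 2).

(* The outer measure generated by the values of the uniform probability measure
   on cylinders; its null sets are those of the (completed) measure. *)
Definition uniform_outer (A : set (nat -> R)) : \bar R :=
  ereal_inf [set r | exists (n : nat -> nat) (a b : nat -> nat -> R),
    [/\ forall k j, -1 <= a k j /\ a k j <= b k j /\ b k j <= 1,
        A `<=` \bigcup_k cylinder (n k) (a k) (b k) &
        r = (\sum_(0 <= k <oo) (cylinder_measure (n k) (a k) (b k))%:E)%E]].

Definition uniform_ess_sup (g : (nat -> R) -> \bar R) : \bar R :=
  ereal_inf [set r | uniform_outer
    (infinite_cube `&` [set y | (r < g y)%E]) = 0%E].

End uniform_measure.

Section relu_networks.
Context {R : realType}.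

Definition relu (t : R) : R := Num.max t 0.

(* k is the output dimension and n the input dimension. The layers that follow
   a hidden layer of width p.+1 form a network that reads all n + p.+1 values
   computed so far, so layer l of the whole network receives the concatenation
   of z^0, ..., z^(l-1). *)
Inductive relu_net (k n : nat) : Type :=
  | OutputLayer of 'M[R]_(k, n) & 'cV[R]_k
  | HiddenLayer (p : nat) of 'M[R]_(p.+1, n) & 'cV[R]_p.+1 &
      relu_net k (n + p.+1).

Fixpoint net_eval k n (Phi : relu_net k n) : 'cV[R]_n -> 'cV[R]_k :=
  match Phi with
  | OutputLayer W b => fun z => W *m z + b
  | HiddenLayer p W b Psi => fun z =>
      net_eval Psi (col_mx z (map_mx relu (W *m z + b)))
  end.

Fixpoint net_depth k n (Phi : relu_net k n) : nat :=
  match Phi with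
  | OutputLayer _ _ => 1
  | HiddenLayer _ _ _ Psi => (net_depth Psi).+1
  end.

Definition nonzero_entries m n (W : 'M[R]_(m, n)) : nat :=
  #|[set ij : 'I_m * 'I_n | W ij.1 ij.2 != 0]%SET|.

Fixpoint net_size k n (Phi : relu_net k n) : nat :=
  match Phi with
  | OutputLayer W b => nonzero_entries W + nonzero_entries b
  | HiddenLayer p W b Psi =>
      nonzero_entries W + nonzero_entries b + net_size Psi
  end.

Definition input_dim k n (Phi : relu_net k n) : nat := n.
Definition output_dim k n (Phi : relu_net k n) : nat := k.

Definition deep k n (Phi : relu_net k n) : bool := (3 <= net_depth Phi)%N.

Definition eval_first k n (Phi : relu_net k n) (y : nat -> R) : 'cV[R]_k :=
  net_eval Phi (\col_(i < n) y i).

Definition eval_at k (r : seq nat) (Phi : relu_net k (size r))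
    (y : nat -> R) : 'cV[R]_k :=
  net_eval Phi (\col_(i < size r) y (nth 0%N r i)).

End relu_networks.

(* Main.v *)
(* Put alpha = 1/q - 1/2.  Differentiating the variational equation shows that
   the Taylor coefficients satisfy b_0(t_s, v) = - sum_j b_j(t_(s - e_j), v),
   where b_j is the form with coefficient psi_j and b_0 the one with coefficient
   abar.  Testing with t_s and using sum_j rho_j |psi_j| <= theta abar, the
   weighted energies sigma_s^2 b_0(t_s, t_s) summed over a level |s| = k decrease
   geometrically in k, so (sigma_s |t_s|) is square summable.  Since
   (sigma_s^-q) is summable, Cauchy-Schwarz bounds the tail of the Taylor series
   outside Lambda(xi) by a multiple of xi^-alpha, and |Lambda(xi)| <= S xi.

   Existence of the derivatives needs no Lax-Milgram argument: the equation makes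
   the difference quotients of u, and inductively of its derivatives, Cauchy in
   the energy norm.

   Lambda(xi) is closed under passing to smaller multi-indices, so every monomial
   y^s with |s| >= 2 is one approximate product of two monomials of half the
   degree that also belong to Lambda(xi).  Yarotsky's product network with r
   sawtooth layers has error 4^-(r+1), and the errors add up to at most
   |s| 4^-(r+1).  With |s| = O(log n), r of order log n and xi of order n/log n
   there are O(log log n) stages of O(log n) layers and at most n weights. *)

(* That the Taylor series sums to u is proved without analyticity in y. Put into the equation, a
   Taylor polynomial leaves a residual in which the recursion for the coefficients cancels all but
   the top level and the directions beyond a cutoff J. The first part decays geometrically, the
   second carries the factor 1/rho_J, and coercivity turns a small residual into a small error.

   The weight count relies on skip connections: a layer reads all earlier ones, so nothing is copied
   forward and the size is proportional to r times the number of gates.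

   The networks may depend on q and rho only, since the domain, the coefficients and f come later.
   Hence xi = max(1, eta n / log n), with eta fixed by the weight count per gate and by the sum of
   the sigma_s^-q.

   The coefficient bounds hold only almost everywhere, so the coefficients are replaced on a null
   set. The energy norm is then equivalent to the gradient norm, and both give the same
   derivatives. *)
Require Import Defs.
From HB Require Import structures.
From mathcomp Require Import all_boot all_order all_algebra.
From mathcomp Require Import finmap.
From mathcomp Require Import all_classical all_reals all_analysis.
From mathcomp Require Import ess_sup_inf measurable_realfun.
From mathcomp Require Import zify ring lra.

Set Implicit Arguments.
Unset Strict Implicit.
Unset Printing Implicit Defensive.

Import Order.TTheory GRing.Theory Num.Theory.
Import numFieldNormedType.Exports.

Local Open Scope classical_set_scope.
Local Open Scope ring_scope.

(** * Sparse affine layers and approximate products *)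

Section sparse_forms.
Context {R : realType}.

(* Pairs (address, coefficient) and a bias. *)
Definition form : Type := (seq (nat * R) * R)%type.

(** Addresses may repeat, which lets [form_add] be plain concatenation; the matrix entry collects
    all coefficients at one address. *)
Definition form_coef (F : form) (j : nat) : R :=
  \sum_(e <- F.1 | e.1 == j) e.2.

Definition form_eval (F : form) (v : nat -> R) : R :=
  \sum_(e <- F.1) e.2 * v e.1 + F.2.

Definition form_size (F : form) : nat := (size F.1 + (F.2 != 0%R))%N.

Definition form_below (n : nat) (F : form) : bool :=
  all (fun e => e.1 < n)%N F.1.

Definition form0 : form := ([::], 0).
Definition form_node (j : nat) : form := ([:: (j, 1)], 0).
Definition form_const (a : R) : form := ([::], a).
Definition form_add (F G : form) : form := (F.1 ++ G.1, F.2 + G.2).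
Definition form_scale (a : R) (F : form) : form :=
  ([seq (e.1, a * e.2) | e <- F.1], a * F.2).
Definition form_sum (n : nat) (F : nat -> form) : form :=
  foldr (fun i => form_add (F i)) form0 (iota 0 n).

Lemma form_eval0 v : form_eval form0 v = 0.
Proof. by rewrite /form_eval big_nil addr0. Qed.

Lemma form_eval_node j v : form_eval (form_node j) v = v j.
Proof. by rewrite /form_eval big_seq1 addr0 mul1r. Qed.

Lemma form_eval_const a v : form_eval (form_const a) v = a.
Proof. by rewrite /form_eval big_nil add0r. Qed.

Lemma form_eval_add F G v :
  form_eval (form_add F G) v = form_eval F v + form_eval G v.
Proof. by rewrite /form_eval big_cat/= addrACA. Qed.

Lemma form_eval_scale a F v : form_eval (form_scale a F) v = a * form_eval F v.
Proof.
rewrite /form_eval big_map/= mulrDr mulr_sumr; congr (_ + _).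
by apply: eq_bigr => e _; rewrite mulrA.
Qed.

Lemma form_eval_sum n F v :
  form_eval (form_sum n F) v = \sum_(i < n) form_eval (F i) v.
Proof.
rewrite -(big_mkord xpredT (fun i => form_eval (F i) v)) /index_iota subn0.
rewrite /form_sum; elim: (iota 0 n) => [|i s IH]/=.
  by rewrite big_nil form_eval0.
by rewrite big_cons form_eval_add IH.
Qed.

Definition form_evalE := (form_eval0, form_eval_node, form_eval_const,
  form_eval_add, form_eval_scale, form_eval_sum).

Lemma form_size_add F G : (form_size (form_add F G) <= form_size F + form_size G)%N.
Proof.
rewrite /form_size/= size_cat addnACA leq_add2l.
have [->|F0] := eqVneq F.2 0; first by rewrite add0r.
by case: (_ != 0) => //; rewrite addnC addn1.
Qed.

Lemma form_size_scale a F : (form_size (form_scale a F) <= form_size F)%N.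
Proof.
rewrite /form_size/= size_map leq_add2l.
by have [->|] := eqVneq F.2 0; [rewrite mulr0 eqxx|case: (_ * _ != 0)].
Qed.

Lemma form_size_sum n F c : (forall i, (i < n)%N -> (form_size (F i) <= c)%N) ->
  (form_size (form_sum n F) <= n * c)%N.
Proof.
move=> Fc.
have : forall i, i \in iota 0 n -> (form_size (F i) <= c)%N.
  by move=> i; rewrite mem_iota => /andP[_]; exact: Fc.
rewrite /form_sum -[X in (_ <= X * _)%N](size_iota 0 n).
elim: (iota 0 n) => [|i s IH] sc /=; first by rewrite /form_size eqxx.
rewrite mulSn (leq_trans (form_size_add _ _))// leq_add// ?sc ?mem_head//.
by apply: IH => j js; rewrite sc// inE js orbT.
Qed.

Lemma form_below_add n F G :
  form_below n (form_add F G) = form_below n F && form_below n G.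
Proof. by rewrite /form_below all_cat. Qed.

Lemma form_below_scale n a F : form_below n (form_scale a F) = form_below n F.
Proof. by rewrite /form_below all_map. Qed.

Lemma form_below_node n j : form_below n (form_node j) = (j < n)%N.
Proof. by rewrite /form_below/= andbT. Qed.

Lemma form_below_sum n m F : (forall i, (i < m)%N -> form_below n (F i)) ->
  form_below n (form_sum m F).
Proof.
move=> Fc.
have : forall i, i \in iota 0 m -> form_below n (F i).
  by move=> i; rewrite mem_iota => /andP[_]; exact: Fc.
rewrite /form_sum; elim: (iota 0 m) => [|i s IH] sc //=.
rewrite form_below_add sc ?mem_head// IH// => j js.
by rewrite sc// inE js orbT.
Qed.

Lemma form_coef_sum n F (v : nat -> R) : form_below n F ->
  \sum_(j < n) form_coef F j * v j = \sum_(e <- F.1) e.2 * v e.1.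
Proof.
rewrite /form_below /form_coef => /allP Fn.
under eq_bigr do rewrite mulr_suml.
rewrite (exchange_big_dep xpredT)//= [LHS]big_seq [RHS]big_seq.
apply: eq_bigr => e eF.
rewrite (bigD1 (Ordinal (Fn _ eF)))//= big1 ?addr0// => i /andP[/eqP ei].
by move=> /eqP[]; apply/val_inj.
Qed.

Definition form_mx m n (F : nat -> form) : 'M[R]_(m, n) :=
  \matrix_(i < m, j < n) form_coef (F i) j.
Definition form_bias m (F : nat -> form) : 'cV[R]_m := \col_(i < m) (F i).2.

Lemma form_mx_eval m n (F : nat -> form) (v : nat -> R) (i : 'I_m) : form_below n (F i) ->
  (form_mx m n F *m (\col_(j < n) v j) + form_bias m F) i 0 = form_eval (F i) v.
Proof.
move=> Fn; rewrite !mxE /form_eval -(form_coef_sum v Fn); congr (_ + _).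
by apply: eq_bigr => j _; rewrite !mxE.
Qed.

Lemma nonzero_entriesE m n (W : 'M[R]_(m, n)) :
  nonzero_entries W = (\sum_(i < m) \sum_(j < n) (W i j != 0%R))%N.
Proof.
rewrite pair_bigA/= /nonzero_entries cardsE -sum1_card big_mkcond/=.
by apply: eq_bigr => ij _; rewrite unfold_in/=; case: (_ != _).
Qed.

(** A nonzero column of a row is the address of some pair, so a row has no more nonzero entries than
    its list is long. *)
Lemma form_mx_size m n (F : nat -> form) :
  (nonzero_entries (form_mx m n F) + nonzero_entries (form_bias m F) <=
   \sum_(i < m) form_size (F i))%N.
Proof.
rewrite !nonzero_entriesE -big_split/=; apply: leq_sum => i _.
rewrite big_ord1 !mxE leq_add2r; under eq_bigr do rewrite mxE.
rewrite (_ : (\sum_(j < n) _ = #|[pred j : 'I_n | form_coef (F i) j != 0%R]|)%N).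
  rewrite -[X in (_ <= X)%N](size_map fst) cardE -(size_map val).
  apply: uniq_leq_size.
    by rewrite map_inj_uniq ?enum_uniq//; exact: val_inj.
  move=> _ /mapP[j + ->]; rewrite mem_enum inE/=; apply: contraNT => jF.
  rewrite /form_coef big_seq_cond big1// => e /andP[eF /eqP ej].
  by case/negP: jF; apply/mapP; exists e.
rewrite -sum1_card [RHS]big_mkcond/=.
by apply: eq_bigr => j _; rewrite inE; case: (_ != _).
Qed.

End sparse_forms.
Arguments form : clear implicits.

Section compile.
Context {R : realType} (k p : nat) (F : nat -> nat -> form R) (O : nat -> form R).

(** All hidden layers have the same width, so the address of a node is an arithmetic expression in
    its layer and position. Idle nodes get [form0] and cost no weight. Here [l] is the next layer
    and [n] the number of values computed so far. *)
Fixpoint compile (T l n : nat) : relu_net k n :=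
  match T with
  | 0 => OutputLayer (form_mx k n O) (form_bias k O)
  | T'.+1 => HiddenLayer (form_mx p.+1 n (F l)) (form_bias p.+1 (F l))
               (compile T' l.+1 (n + p.+1))
  end.

Lemma compile_depth T l n : net_depth (compile T l n) = T.+1.
Proof. by elim: T l n => //= T IH l n; rewrite IH. Qed.

Lemma compile_size T l n :
  (net_size (compile T l n) <=
   \sum_(l <= i < l + T) \sum_(j < p.+1) form_size (F i j) +
   \sum_(i < k) form_size (O i))%N.
Proof.
elim: T l n => [|T IH] l n /=.
  by rewrite addn0 big_geq// add0n form_mx_size.
rewrite big_ltn; last by lia.
rewrite -[X in (_ <= X)%N]addnA; apply: leq_add; first exact: form_mx_size.
by have := IH l.+1 (n + p.+1)%N; rewrite addSnnS.
Qed.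

(** The sequence [v] predicts the values of all nodes by address. If it satisfies the layer
    equations, it is what the network computes, so correctness is checked on a closed formula rather
    than along the recursion. *)
Lemma compile_eval (n0 L : nat) (v : nat -> R) :
  (forall l i, (l < L)%N -> (i <= p)%N ->
    form_below (n0 + l * p.+1) (F l i) /\
    v (n0 + l * p.+1 + i)%N = relu (form_eval (F l i) v)) ->
  (forall i, (i < k)%N -> form_below (n0 + L * p.+1) (O i)) ->
  forall T l n, (l + T = L)%N -> n = (n0 + l * p.+1)%N ->
  forall i : 'I_k,
    net_eval (compile T l n) (\col_(j < n) v j) i 0 = form_eval (O i) v.
Proof.
move=> HF HO; elim=> [|T IH] l n lT nE i /=.
  by rewrite form_mx_eval// nE -(addn0 l) lT HO.
rewrite -(IH l.+1 (n + p.+1)%N); last 2 first.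
- by rewrite addSn -addnS.
- by rewrite nE mulSn [(p.+1 + _)%N]addnC addnA.
congr (net_eval _ _ i 0); apply/colP => j; rewrite [RHS]mxE.
case: (split_ordP j) => a ->.
  by rewrite [LHS]col_mxEu mxE.
have lL : (l < L)%N by rewrite -lT -addSnnS leq_addr.
have [Fb va] := HF l a lL (ltn_ord a).
by rewrite [LHS]col_mxEd mxE form_mx_eval ?nE//= va.
Qed.

End compile.

Section pullback.
Context {R : realType}.

(** Precomposition with a linear map. Because of the skip connections every layer reads the inputs,
    so [E] has to be threaded through, acting as the identity on hidden values. *)
Fixpoint net_pullback k n n' (Phi : relu_net k n) :
    'M[R]_(n, n') -> @relu_net R k n' :=
  match Phi with
  | OutputLayer W b => fun E => OutputLayer (W *m E) b
  | HiddenLayer p W b Psi => fun E =>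
      HiddenLayer (W *m E) b
        (net_pullback Psi (block_mx E (0 : 'M[R]_(_, p.+1)) 0 1%:M))
  end.

Lemma net_pullback_eval k n n' (Phi : relu_net k n) (E : 'M[R]_(n, n')) z :
  net_eval (net_pullback Phi E) z = net_eval Phi (E *m z).
Proof.
elim: Phi n' E z => [{}n W b|{}n p W b Psi IH] n' E z /=; rewrite -mulmxA//.
by rewrite IH mul_block_col !mul0mx addr0 add0r mul1mx.
Qed.

Lemma net_pullback_depth k n n' (Phi : relu_net k n) (E : 'M[R]_(n, n')) :
  net_depth (net_pullback Phi E) = net_depth Phi.
Proof. by elim: Phi n' E => //= {}n p W b Psi IH n' E; rewrite IH. Qed.

Fixpoint net_component k n (i : 'I_k) (Phi : @relu_net R k n) :
    @relu_net R 1 n :=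
  match Phi with
  | OutputLayer W b => OutputLayer (row i W) (row i b)
  | HiddenLayer p W b Psi => HiddenLayer W b (net_component i Psi)
  end.

Lemma net_component_eval k n (i : 'I_k) (Phi : @relu_net R k n) z :
  net_eval (net_component i Phi) z 0 0 = net_eval Phi z i 0.
Proof.
elim: Phi z => //= {}n W b z; rewrite -row_mul !mxE.
by congr (_ + _); apply: eq_bigr => j _; rewrite !mxE.
Qed.

Lemma net_component_depth k n (i : 'I_k) (Phi : @relu_net R k n) :
  net_depth (net_component i Phi) = net_depth Phi.
Proof. by elim: Phi => //= {}n p W b Psi ->. Qed.

End pullback.

(** * Approximate squares and products built from tent maps *)

Section approximate_product.
Context {R : realType}.
Implicit Types x y : R.

(** The tent map on [0, 1]. Two relu's suffice because all arguments stay in that interval. *)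
Definition tooth x : R := 2 * relu x - 4 * relu (x - 2^-1).

Definition saw (n : nat) x : R := iter n tooth x.

(* Yarotsky's piecewise linear interpolant of the square at the dyadic points of
   level r. *)
Definition square_approx (r : nat) x : R :=
  x - \sum_(k < r) 4^-1 ^+ k.+1 * saw k.+1 x.

Definition relu_abs x : R := relu x + relu (- x).

(** Polarization: x y is the square of the half sum minus the square of the half difference.
    Absolute values bring both arguments into [0, 1]. *)
Definition mul_approx (r : nat) x y : R :=
  square_approx r (relu_abs (2^-1 * (x + y))) -
  square_approx r (relu_abs (2^-1 * (x - y))).

Lemma reluB x : relu x - relu (- x) = x.
Proof. by rewrite /relu; case: (leP x 0) => ?; case: (leP (- x) 0) => ?; lra. Qed.

Lemma relu_absE x : relu_abs x = `|x|.
Proof.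
rewrite /relu_abs /relu.
case: (ger0P x) => ?; case: (leP x 0) => ?; case: (leP (- x) 0) => ?; lra.
Qed.

Lemma tooth_itv x : 0 <= x <= 1 -> 0 <= tooth x <= 1.
Proof.
move=> x01; rewrite /tooth /relu.
case: (leP x 0) => ?; case: (leP (x - 2^-1) 0) => ?; lra.
Qed.

Lemma saw_itv n x : 0 <= x <= 1 -> 0 <= saw n x <= 1.
Proof. by move=> x01; elim: n => //= n; exact: tooth_itv. Qed.

Lemma sawSr n x : saw n.+1 x = saw n (tooth x).
Proof. exact: iterSr. Qed.

Lemma square_approxS r x :
  square_approx r.+1 x =
  x - 2^-1 * tooth x + 4^-1 * square_approx r (tooth x).
Proof.
have saw1 : saw 1 x = tooth x by [].
rewrite /square_approx big_ord_recl expr1 saw1.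
rewrite [4^-1 * (tooth x - _)]mulrBr mulr_sumr.
have -> : \sum_(i < r) 4^-1 ^+ (lift ord0 i).+1 * saw (lift ord0 i).+1 x =
    \sum_(i < r) 4^-1 * (4^-1 ^+ i.+1 * saw i.+1 (tooth x)).
  by apply: eq_bigr => i _; rewrite mulrA -exprS -sawSr.
lra.
Qed.

(** The square is self-similar under the tent map, x^2 = x - t/2 + t^2/4 with t = [tooth x], and so
    is the interpolant. Each level therefore divides the error by 4, starting from x - x^2 <=
    1/4. *)
Lemma square_approx_bound r x : 0 <= x <= 1 ->
  x ^+ 2 <= square_approx r x <= x ^+ 2 + 4^-1 ^+ r.+1.
Proof.
elim: r x => [|r IH] x x01.
  rewrite /square_approx big_ord0 expr1 subr0; apply/andP; split; first nra.
  by have := sqr_ge0 (x - 2^-1); rewrite !expr2; lra.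
rewrite square_approxS [4^-1 ^+ r.+2]exprS.
have key : x - 2^-1 * tooth x + 4^-1 * tooth x ^+ 2 = x ^+ 2.
  have [t2|t2] : tooth x = 2 * x \/ tooth x = 2 - 2 * x.
  - rewrite /tooth /relu; case: (leP x 0) => ?; case: (leP (x - 2^-1) 0) => ?;
      (by left; lra) || (by right; lra).
  - by rewrite t2; field.
  - by rewrite t2; field.
have /andP[] := IH _ (tooth_itv x01).
move: (square_approx r (tooth x)) (_ ^+ r.+1) (tooth x) key => s e t key ? ?.
by apply/andP; split; lra.
Qed.

Lemma square_approx_le1 r x : 0 <= x <= 1 -> 0 <= square_approx r x <= 1.
Proof.
move=> x01; have /andP[h _] := square_approx_bound r x01.
rewrite (le_trans _ h) ?sqr_ge0//=.
have /andP[_ x1] := x01; rewrite (le_trans _ x1)// /square_approx gerBl.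
by apply: sumr_ge0 => i _; rewrite mulr_ge0 ?exprn_ge0//; case/andP: (saw_itv i.+1 x01).
Qed.

Lemma abs_mid_itv x y : `|x| <= 1 -> `|y| <= 1 ->
  0 <= relu_abs (2^-1 * (x + y)) <= 1.
Proof.
rewrite relu_absE => x1 y1; rewrite normr_ge0/= normrM (le_trans (ler_wpM2l _ (ler_normD _ _)))//.
by rewrite ger0_norm//; lra.
Qed.

(** Both squares are overestimated, so their errors do not add in the difference. The bound by 1
    keeps the result admissible as an operand of the next product. *)
Lemma mul_approx_bound r x y : `|x| <= 1 -> `|y| <= 1 ->
  `|mul_approx r x y - x * y| <= 4^-1 ^+ r.+1 /\ `|mul_approx r x y| <= 1.
Proof.
move=> x1 y1; have y1' : `|- y| <= 1 by rewrite normrN.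
have u01 := abs_mid_itv x1 y1; have v01 := abs_mid_itv x1 y1'.
have /andP[? ?] := square_approx_bound r u01.
have /andP[? ?] := square_approx_bound r v01.
have /andP[? ?] := square_approx_le1 r u01.
have /andP[? ?] := square_approx_le1 r v01.
have e : relu_abs (2^-1 * (x + y)) ^+ 2 - relu_abs (2^-1 * (x - y)) ^+ 2 = x * y.
  by rewrite !relu_absE !real_normK ?num_real//; field.
split; rewrite /mul_approx ler_norml; last by apply/andP; split; lra.
by rewrite -e; apply/andP; split; lra.
Qed.

End approximate_product.

(** * Networks of product gates *)

Section gate_network.
Context {R : realType} (n0 N T r k : nat).
Variables (stage : nat -> nat) (A B : nat -> nat + nat).
Variable Out : nat -> option (nat + nat).

(* An operand is an input coordinate or the value of an earlier gate. *)
Definition operand_wf (i : nat) (o : nat + nat) : bool :=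
  match o with inl j => (j < n0)%N | inr g => (g < N)%N && (stage g < i)%N end.

Definition operand_val (y gv : nat -> R) (o : nat + nat) : R :=
  match o with inl j => y j | inr g => gv g end.

Definition output_wf (o : option (nat + nat)) : bool :=
  if o is Some o then operand_wf T o else true.

Definition output_val (y gv : nat -> R) (o : option (nat + nat)) : R :=
  if o is Some o then operand_val y gv o else 1.

Hypothesis A_wf : forall g, (g < N)%N -> operand_wf (stage g) (A g).
Hypothesis B_wf : forall g, (g < N)%N -> operand_wf (stage g) (B g).
Hypothesis Out_wf : forall i, (i < k)%N -> output_wf (Out i).

(** Every layer reserves four nodes for every gate, active or not; the spare node keeps the width
    positive. *)
Let width : nat := (4 * N).+1.

(* Gate g of stage i occupies four nodes c < 4 in each of the layers t < r + 2
   of that stage: two relu's for the half sum and half difference, then the two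
   relu's of each sawtooth iteration, finally the positive and negative parts
   of the product. *)
Let addr (i t g c : nat) : nat :=
  (n0 + (i * r.+2 + t) * width + (4 * g + c))%N.

(** Nodes carry relu values, so a possibly negative gate value is read as the difference of its
    positive and negative parts in the last layer of its stage. *)
Let operand_form (o : nat + nat) : form R :=
  match o with
  | inl j => form_node j
  | inr g => form_add (form_node (addr (stage g) r.+1 g 0))
      (form_scale (-1) (form_node (addr (stage g) r.+1 g 1)))
  end.

(** The index [h] is 0 for the half sum and 2 for the half difference. At [i] = 0 the two nodes add
    up to an absolute value, later they combine to one more tent map. *)
Let saw_form (g i h : nat) : form R :=
  if i == 0%N then form_add (form_node (addr (stage g) 0 g h))
                            (form_node (addr (stage g) 0 g h.+1))
  else form_add (form_scale 2 (form_node (addr (stage g) i g h)))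
                (form_scale (-4) (form_node (addr (stage g) i g h.+1))).

(** Skip connections let the last layer of a stage read all its sawtooth layers at once, so no
    partial sums travel through the layers. *)
Let square_form (g h : nat) : form R :=
  form_add (saw_form g 0 h) (form_scale (-1)
    (form_sum r (fun i => form_scale (4^-1 ^+ i.+1) (saw_form g i.+1 h)))).

Let mul_form (g : nat) : form R :=
  form_add (square_form g 0) (form_scale (-1) (square_form g 2)).

Let half (c : nat) : nat := if (c < 2)%N then 0%N else 2%N.

Let gate_form (t g c : nat) : form R :=
  if t is i.+1 then
    if (i < r)%N then
      form_add (saw_form g i (half c)) (form_const (if odd c then - 2^-1 else 0))
    else if c == 0%N then mul_form g
    else if c == 1%N then form_scale (-1) (mul_form g) else form0
  else form_scale ((-1) ^+ odd c * 2^-1)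
    (form_add (operand_form (A g))
       (form_scale (if (c < 2)%N then 1 else -1) (operand_form (B g)))).

Let layer_form (l i : nat) : form R :=
  let g := (i %/ 4)%N in
  if (g < N)%N && (stage g == l %/ r.+2)%N then
    gate_form (l %% r.+2)%N g (i %% 4)%N
  else form0.

Let output_form (i : nat) : form R :=
  if Out i is Some o then operand_form o else form_const 1.

Section values.
Variables y gv : nat -> R.
Hypothesis gvE : forall g, (g < N)%N ->
  gv g = mul_approx r (operand_val y gv (A g)) (operand_val y gv (B g)).

Let X g := operand_val y gv (A g).
Let Y g := operand_val y gv (B g).
Let U g h := relu_abs (2^-1 * (X g + (if (h < 2)%N then 1 else -1) * Y g)).

Let pre (t g c : nat) : R :=
  if t is i.+1 then
    if (i < r)%N then saw i (U g c) + (if odd c then - 2^-1 else 0)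
    else if c == 0%N then gv g else if c == 1%N then - gv g else 0
  else (-1) ^+ odd c * (2^-1 * (X g + (if (c < 2)%N then 1 else -1) * Y g)).

(** The predicted node values for [compile_eval]: division with remainder recovers layer, stage,
    gate and copy from the address. *)
Let v (a : nat) : R :=
  if (a < n0)%N then y a else
  let l := ((a - n0) %/ width)%N in let i := ((a - n0) %% width)%N in
  let g := (i %/ 4)%N in
  if (g < N)%N && (stage g == l %/ r.+2)%N then
    relu (pre (l %% r.+2)%N g (i %% 4)%N)
  else 0.

Let v_input j : (j < n0)%N -> v j = y j.
Proof. by rewrite /v => ->. Qed.

Let v_layer l i : (i < width)%N ->
  v (n0 + l * width + i)%N =
  if (i %/ 4 < N)%N && (stage (i %/ 4) == l %/ r.+2)%N then
    relu (pre (l %% r.+2)%N (i %/ 4) (i %% 4)%N)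
  else 0.
Proof.
move=> iw; rewrite /v -addnA ltnNge leq_addr/= addKn.
by rewrite divnMDl// (divn_small iw) addn0 modnMDl (modn_small iw).
Qed.

Let v_addr t g c : (t < r.+2)%N -> (g < N)%N -> (c < 4)%N ->
  v (addr (stage g) t g c) = relu (pre t g c).
Proof.
move=> tr gN c4; rewrite /addr v_layer; last by rewrite /width; lia.
rewrite [(4 * g)%N]mulnC !divnMDl// !modnMDl (divn_small c4) (modn_small c4).
by rewrite (divn_small tr) (modn_small tr) !addn0 gN eqxx.
Qed.

Let operand_formE i o : operand_wf i o ->
  form_eval (operand_form o) v = operand_val y gv o.
Proof.
case: o => [j|g]/= => [jn|/andP[gN _]]; rewrite !form_evalE.
  exact: v_input.
rewrite !v_addr// /pre ltnn/= mulN1r; exact: reluB.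
Qed.

Let saw_formE g i h : (g < N)%N -> (i <= r)%N -> (h == 0%N) || (h == 2%N) ->
  form_eval (saw_form g i h) v = saw i (U g h).
Proof.
move=> gN ir h02; rewrite /saw_form; case: i ir => [|i] ir/=.
  rewrite !form_evalE !v_addr//; [|by case/orP: h02 => /eqP ->..].
  by rewrite /U; case/orP: h02 => /eqP -> /=; rewrite expr0 expr1 !mul1r !mulN1r.
rewrite !form_evalE !v_addr//; [|by lia..].
rewrite /pre ir /U; case/orP: h02 => /eqP -> /=;
  by rewrite addr0 [-4 * _]mulNr.
Qed.

Let square_formE g h : (g < N)%N -> (h == 0%N) || (h == 2%N) ->
  form_eval (square_form g h) v = square_approx r (U g h).
Proof.
move=> gN h02; rewrite /square_form form_eval_add saw_formE// form_eval_scale form_eval_sum.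
rewrite mulN1r.
congr (_ - _); apply: eq_bigr => i _.
by rewrite form_eval_scale saw_formE.
Qed.

Let mul_formE g : (g < N)%N -> form_eval (mul_form g) v = gv g.
Proof.
move=> gN; rewrite /mul_form form_eval_add form_eval_scale !square_formE// gvE// /U/=.
by rewrite !mul1r !mulN1r.
Qed.

Let gate_formE t g c : (t < r.+2)%N -> (g < N)%N -> (c < 4)%N ->
  form_eval (gate_form t g c) v = pre t g c.
Proof.
move=> tr gN c4; rewrite /gate_form /pre; case: t tr => [|i] ir.
  rewrite form_eval_scale form_eval_add form_eval_scale.
  rewrite (operand_formE (A_wf gN)) (operand_formE (B_wf gN)).
  by rewrite mulrA.
case: ifPn => ir'.
  rewrite form_eval_add form_eval_const saw_formE// ?(ltnW ir')//; last by rewrite /half; case: ifP.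
  by congr (saw _ _ + _); rewrite /U /half; case: (c < 2)%N.
case: ifP => _; first exact: mul_formE.
case: ifP => _; first by rewrite form_eval_scale mul_formE// mulN1r.
by rewrite form_eval0.
Qed.

Let layer_formE l i : (i < width)%N ->
  v (n0 + l * width + i)%N = relu (form_eval (layer_form l i) v).
Proof.
move=> iw; rewrite v_layer// /layer_form; case: ifP => [/andP[gN _]|_].
  by rewrite gate_formE// ltn_pmod.
by rewrite form_evalE /relu maxxx.
Qed.

Let output_formE i : (i < k)%N ->
  form_eval (output_form i) v = output_val y gv (Out i).
Proof.
move=> /Out_wf; rewrite /output_form /output_val /output_wf.
case: (Out i) => [op|_]; first exact: operand_formE.
exact: form_eval_const.
Qed.

Lemma gate_values : exists w : nat -> R,
  [/\ forall j, (j < n0)%N -> w j = y j,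
      forall l i, (i < width)%N ->
        w (n0 + l * width + i)%N = relu (form_eval (layer_form l i) w) &
      forall i, (i < k)%N ->
        form_eval (output_form i) w = output_val y gv (Out i)].
Proof. by exists v. Qed.

End values.

Let addr_lt i t g c i' t' : (g < N)%N -> (c < 4)%N ->
  (i * r.+2 + t < i' * r.+2 + t')%N ->
  (addr i t g c < n0 + (i' * r.+2 + t') * width)%N.
Proof.
move=> gN c4 lt; rewrite /addr -addnA ltn_add2l.
apply: (@leq_trans ((i * r.+2 + t).+1 * width)); last by rewrite leq_mul2r lt orbT.
by rewrite [((i * r.+2 + t).+1 * _)%N]mulSn [X in (_ < X)%N]addnC ltn_add2l /width; lia.
Qed.

Let operand_below i t o : operand_wf i o ->
  form_below (n0 + (i * r.+2 + t) * width) (operand_form o).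
Proof.
case: o => [j|g]/= => [jn|/andP[gN si]].
  by rewrite form_below_node ltn_addr.
rewrite form_below_add form_below_scale !form_below_node !addr_lt//; nia.
Qed.

Let saw_below g i h t : (g < N)%N -> (i < t)%N -> (h == 0%N) || (h == 2%N) ->
  form_below (n0 + (stage g * r.+2 + t) * width) (saw_form g i h).
Proof.
move=> gN it h02; rewrite /saw_form; case: ifP => [/eqP i0|_];
  rewrite form_below_add ?form_below_scale !form_below_node !addr_lt//;
  by [lia|case/orP: h02 => /eqP ->].
Qed.

Let square_below g h : (g < N)%N -> (h == 0%N) || (h == 2%N) ->
  form_below (n0 + (stage g * r.+2 + r.+1) * width) (square_form g h).
Proof.
move=> gN h02; rewrite /square_form form_below_add form_below_scale saw_below//=.
by apply: form_below_sum => i ir; rewrite form_below_scale saw_below.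
Qed.

Let layer_below l i : (i < width)%N ->
  form_below (n0 + l * width) (layer_form l i).
Proof.
move=> iw; rewrite /layer_form; case: ifP => // /andP[gN /eqP sg].
rewrite {1}(divn_eq l r.+2) -sg.
have : (l %% r.+2 < r.+2)%N by rewrite ltn_pmod.
have : (i %% 4 < 4)%N by rewrite ltn_pmod.
move: (l %% r.+2)%N (i %% 4)%N (i %/ 4)%N gN {sg} => t c g gN c4 tr.
rewrite /gate_form; case: t tr => [|t] tr.
  rewrite form_below_scale form_below_add form_below_scale.
  by rewrite !operand_below ?A_wf ?B_wf.
case: ifPn => tr'.
  by rewrite form_below_add saw_below// /half; case: ifP.
have -> : t = r by lia.
have mb : form_below (n0 + (stage g * r.+2 + r.+1) * width) (mul_form g).
  by rewrite /mul_form form_below_add form_below_scale !square_below.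
by case: ifP => // _; case: ifP => // _; rewrite form_below_scale.
Qed.

Let output_below i : (i < k)%N ->
  form_below (n0 + T * r.+2 * width) (output_form i).
Proof.
move=> /Out_wf; rewrite /output_form; case: (Out i) => [op|]//= owf.
by have := operand_below 0 owf; rewrite addn0.
Qed.

Let node_size j : form_size (@form_node R j) = 1%N.
Proof. by rewrite /form_size/= eqxx. Qed.

Let operand_size o : (form_size (operand_form o) <= 2)%N.
Proof.
case: o => [j|g]/=; first by rewrite node_size.
rewrite (leq_trans (form_size_add _ _))// node_size.
by rewrite -[2%N]/(1 + 1)%N leq_add2l (leq_trans (form_size_scale _ _))// node_size.
Qed.

Let saw_size g i h : (form_size (saw_form g i h) <= 2)%N.
Proof.
rewrite /saw_form; case: ifP => _;
  rewrite (leq_trans (form_size_add _ _))// -[2%N]/(1 + 1)%N leq_add ?node_size//;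
  by rewrite (leq_trans (form_size_scale _ _))// node_size.
Qed.

Let square_size g h : (form_size (square_form g h) <= 2 + 2 * r)%N.
Proof.
rewrite /square_form (leq_trans (form_size_add _ _))// leq_add//.
rewrite (leq_trans (form_size_scale _ _))// mulnC form_size_sum// => i _.
by rewrite (leq_trans (form_size_scale _ _)).
Qed.

Let mul_size g : (form_size (mul_form g) <= 4 * r.+1)%N.
Proof.
rewrite /mul_form (leq_trans (form_size_add _ _))//.
have -> : (4 * r.+1 = (2 + 2 * r) + (2 + 2 * r))%N by lia.
by rewrite leq_add// (leq_trans (form_size_scale _ _)).
Qed.

Let gate_size t g c : (t < r.+2)%N ->
  (form_size (gate_form t g c) <= if t == r.+1 then 4 * r.+1 else 4)%N.
Proof.
rewrite /gate_form; case: t => [|i] ir.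
  rewrite (leq_trans (form_size_scale _ _))// (leq_trans (form_size_add _ _))//.
  rewrite -[4%N]/(2 + 2)%N leq_add//.
  by rewrite (leq_trans (form_size_scale _ _)).
case: ifP => ir'.
  rewrite ltn_eqF//.
  rewrite (leq_trans (form_size_add _ _))// -[4%N]/(2 + 2)%N leq_add//.
  by rewrite /form_size/=; case: (_ != 0).
have -> : i = r by lia.
rewrite eqxx.
case: ifP => _; first exact: mul_size.
case: ifP => _; first by rewrite (leq_trans (form_size_scale _ _)).
by rewrite /form_size eqxx.
Qed.

(** A gate works in the layers of a single stage, so summing over all layers counts one block,
    whatever the number of stages. *)
Let block_sum m s S (b : nat -> nat) :
  (\sum_(0 <= l < S * m.+1)
     (if s == l %/ m.+1 then b (l %% m.+1) else 0) =
   if s < S then \sum_(0 <= t < m.+1) b t else 0)%N.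
Proof.
elim: S => [|S IH]; first by rewrite big_geq.
rewrite mulSn addnC (big_cat_nat (n := S * m.+1))//= ?leq_addr// IH.
rewrite -{1}[(S * m.+1)%N]add0n big_addn addKn.
have -> : (\sum_(0 <= i < m.+1) (if s == (i + S * m.+1) %/ m.+1
      then b ((i + S * m.+1) %% m.+1) else 0) =
    \sum_(0 <= t < m.+1) if s == S then b t else 0)%N.
  apply: eq_big_nat => t /andP[_ tm].
  by rewrite addnC divnMDl// modnMDl divn_small// addn0 modn_small.
have [sS|sS|->] := ltngtP s S.
- by rewrite ltnS (ltnW sS) [X in (_ + X)%N]big1 ?addn0.
- by rewrite ltnS leqNgt sS big1.
- by rewrite ltnSn add0n.
Qed.

(** Each of the four nodes of a gate costs at most 4 in each of the first r + 1 layers of its stage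
    and at most 4 (r + 1) in the last one, hence 8 (r + 1) per node. *)
Let layer_size :
  (\sum_(0 <= l < T * r.+2) \sum_(i < width) form_size (layer_form l i) <=
   32 * r.+1 * N)%N.
Proof.
rewrite exchange_big/= -/width /width big_ord_recr/=.
rewrite [X in (_ + X)%N]big1 ?addn0; last first.
  by move=> l _; rewrite /layer_form mulKn// ltnn /form_size eqxx.
rewrite (_ : 32 * r.+1 * N = \sum_(i < 4 * N) (8 * r.+1))%N; last first.
  by rewrite sum_nat_const card_ord; lia.
apply: leq_sum => i _.
pose b t := (if t == r.+1 then 4 * r.+1 else 4)%N.
apply: (@leq_trans (\sum_(0 <= l < T * r.+2)
    (if stage (i %/ 4) == l %/ r.+2 then b (l %% r.+2) else 0))%N).
  apply: leq_sum => l _; rewrite /layer_form; case: ifP => [/andP[_ ->]|_].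
    by rewrite gate_size// ltn_pmod.
  by rewrite /form_size eqxx.
rewrite block_sum; case: ifP => // _.
rewrite big_nat_recr//= [b r.+1]/b eqxx.
have -> : (\sum_(0 <= t < r.+1) b t = \sum_(0 <= t < r.+1) 4)%N.
  by apply: eq_big_nat => t /andP[_ tr]; rewrite /b ltn_eqF.
by rewrite sum_nat_const_nat; lia.
Qed.

Lemma gate_network : exists Phi : @relu_net R k n0,
  [/\ net_depth Phi = (T * r.+2).+1,
      (net_size Phi <= 32 * r.+1 * N + 2 * k)%N &
      forall y gv : nat -> R,
        (forall g, (g < N)%N ->
          gv g = mul_approx r (operand_val y gv (A g)) (operand_val y gv (B g))) ->
        forall i : 'I_k,
          net_eval Phi (\col_(j < n0) y j) i 0 = output_val y gv (Out i)].
Proof.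
exists (compile k (4 * N) layer_form output_form (T * r.+2) 0 n0); split.
- exact: compile_depth.
- rewrite (leq_trans (compile_size _ _ _ _ _ _ _))// add0n leq_add//.
  rewrite mulnC -[k in (_ <= k * _)%N]card_ord -sum_nat_const.
  apply: leq_sum => i _; rewrite /output_form; case: (Out i) => [op|] //.
  by rewrite /form_size/=; case: (_ != 0).
- move=> y gv gvE i; have [w [wy wl wo]] := gate_values gvE.
  rewrite -wo// -(@compile_eval _ k (4 * N) layer_form output_form n0
    (T * r.+2) w _ _ (T * r.+2)%N 0%N n0) ?addn0//.
  + congr (net_eval _ _ i 0); apply/colP => j.
    by rewrite !mxE wy.
  + move=> l j lT jw; split; first exact: layer_below.
    exact: wl.
Qed.

End gate_network.

(** * Multi-indices *)

Section multi_indices.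
Implicit Types (s r : multi_index) (j : nat).

Lemma mem_nu s j : (j \in nu s) = (s j != 0)%N.
Proof. by rewrite /nu mem_sort mem_finsupp. Qed.

Lemma nu_uniq s : uniq (nu s).
Proof. by rewrite /nu sort_uniq fset_uniq. Qed.

Lemma nu_sorted s : sorted leq (nu s).
Proof. exact: (sort_sorted leq_total). Qed.

Definition mi_bound s : nat := (\max_(j <- nu s) j).+1.

Lemma mi_boundP s j : (s j != 0)%N -> (j < mi_bound s)%N.
Proof. by rewrite -mem_nu ltnS => js; rewrite leq_bigmax_seq. Qed.

(** Over a common initial segment two multi-indices can be compared factor by factor, although their
    supports differ. *)
Lemma big_nu (T : Type) (idx : T) (op : Monoid.com_law idx)
    (F : nat -> nat -> T) s n :
  (forall j, F j 0%N = idx) -> (forall j, (s j != 0)%N -> (j < n)%N) ->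
  \big[op/idx]_(j <- nu s) F j (s j) = \big[op/idx]_(j < n) F j (s j).
Proof.
move=> F0 sn; rewrite -(big_mkord xpredT (fun j => F j (s j))).
rewrite [RHS](bigID (fun j => s j != 0%N))/= [X in op _ X]big1 ?Monoid.mulm1; last first.
  by move=> j; rewrite negbK => /eqP ->.
rewrite -[RHS]big_filter; apply: perm_big; apply: uniq_perm.
- exact: nu_uniq.
- by rewrite filter_uniq// iota_uniq.
- move=> j; rewrite mem_nu mem_filter mem_index_iota/=.
  by case: (boolP (s j != 0%N)) => // /sn ->.
Qed.

Definition mi_of (n : nat) (g : nat -> nat) : multi_index :=
  [fsfun j in [fset j in iota 0 n]%fset => g j].

Lemma mi_ofE n g j : mi_of n g j = if (j < n)%N then g j else 0%N.
Proof. by rewrite fsfun_fun inE/= mem_iota. Qed.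

Definition mi_inc s j : multi_index := [fsfun s with j |-> (s j).+1].
Definition mi_dec s j : multi_index := [fsfun s with j |-> (s j).-1].
Definition mi0 : multi_index := [fsfun].

Lemma mi_incE s j i : mi_inc s j i = (s i + (i == j))%N.
Proof. by rewrite fsfun_withE; case: eqP => [->|]; rewrite ?addn1 ?addn0. Qed.

Lemma mi_decE s j i : mi_dec s j i = (s i - (i == j))%N.
Proof. by rewrite fsfun_withE; case: eqP => [->|]; rewrite ?subn1 ?subn0. Qed.

Lemma mi0E j : mi0 j = 0%N. Proof. exact: fsfun0E. Qed.

Lemma mi_eq s r : (forall j, s j = r j) -> s = r.
Proof. by move=> sr; apply/fsfunP. Qed.

Lemma mi_incK s j : mi_dec (mi_inc s j) j = s.
Proof. by apply: mi_eq => i; rewrite mi_decE mi_incE addnK. Qed.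

Lemma mi_decK s j : (s j != 0)%N -> mi_inc (mi_dec s j) j = s.
Proof.
move=> sj; apply: mi_eq => i; rewrite mi_incE mi_decE.
by case: eqP => [->|_]; rewrite ?subn0 ?addn0// subnK// lt0n.
Qed.

Definition mi_deg s : nat := (\sum_(j <- nu s) s j)%N.

Lemma mi_degE s n : (forall j, (s j != 0)%N -> (j < n)%N) ->
  mi_deg s = (\sum_(j < n) s j)%N.
Proof. exact: (@big_nu _ _ _ (fun _ i => i)). Qed.

Lemma mi_deg0 : mi_deg mi0 = 0%N.
Proof. by rewrite (@mi_degE _ 0%N) ?big_ord0// => j; rewrite mi0E. Qed.

Lemma mi_deg_ge s j : (s j <= mi_deg s)%N.
Proof.
have [->//|sj] := eqVneq (s j) 0%N.
by rewrite /mi_deg (bigD1_seq j) ?mem_nu ?nu_uniq//= leq_addr.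
Qed.

Lemma mi_deg_eq0 s : (mi_deg s == 0)%N = (s == mi0).
Proof.
apply/eqP/eqP => [s0|->]; last exact: mi_deg0.
by apply: mi_eq => j; rewrite mi0E; have := mi_deg_ge s j; rewrite s0 leqn0 => /eqP.
Qed.

Lemma mi_inc_lt s j n : (j < n)%N ->
  (forall i, (s i != 0)%N -> (i < n)%N) ->
  forall i, (mi_inc s j i != 0)%N -> (i < n)%N.
Proof.
by move=> jn sn i; rewrite mi_incE; have [->//|_] := eqVneq i j; rewrite addn0 => /sn.
Qed.

Let incb s j n (nE : n = maxn j.+1 (mi_bound s)) :
  (j < n)%N /\ forall i, (s i != 0)%N -> (i < n)%N.
Proof.
rewrite nE; split=> [|i /mi_boundP]; rewrite leq_max ?leqnn// => ->.
by rewrite orbT.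
Qed.

Lemma mi_deg_inc s j : mi_deg (mi_inc s j) = (mi_deg s).+1.
Proof.
have [jn sn] := incb (erefl (maxn j.+1 (mi_bound s))).
rewrite (mi_degE sn) (mi_degE (mi_inc_lt jn sn)).
under eq_bigr do rewrite mi_incE.
rewrite big_split/= -[RHS]addn1; congr (_ + _)%N.
by rewrite (bigD1 (Ordinal jn))//= eqxx big1 ?addn0// => i; rewrite -val_eqE/= => /negPf ->.
Qed.

Lemma mi_fact0 : mi_fact mi0 = 1%N.
Proof.
by rewrite /mi_fact (@big_nu _ _ _ (fun _ i => i`!) _ 0%N) ?big_ord0// => j; rewrite mi0E.
Qed.

Lemma mi_fact_gt0 s : (0 < mi_fact s)%N.
Proof. by rewrite /mi_fact; apply: prodn_gt0 => j; exact: fact_gt0. Qed.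

Lemma mi_fact_inc s j : mi_fact (mi_inc s j) = ((s j).+1 * mi_fact s)%N.
Proof.
have [jn sn] := incb (erefl (maxn j.+1 (mi_bound s))).
rewrite /mi_fact !(@big_nu _ _ _ (fun _ i => i`!) _ _ _ sn)//.
rewrite !(@big_nu _ _ _ (fun _ i => i`!) _ _ _ (mi_inc_lt jn sn))//.
rewrite [in LHS](bigD1 (Ordinal jn))//= [in RHS](bigD1 (Ordinal jn))//= mi_incE eqxx addn1 factS mulnA; congr muln.
by apply: eq_bigr => i; rewrite -val_eqE/= => /negPf ij; rewrite mi_incE ij addn0.
Qed.

Section monomials.
Context {R : realType}.
Implicit Types y : nat -> R.

Lemma sigmaE y s n : (forall j, (s j != 0)%N -> (j < n)%N) ->
  sigma y s = \prod_(j < n) y j ^+ s j.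
Proof. by apply: (@big_nu _ _ _ (fun j i => y j ^+ i)) => j; rewrite expr0. Qed.

Lemma sigma0 y : sigma y mi0 = 1.
Proof. by rewrite (@sigmaE _ _ 0%N) ?big_ord0// => j; rewrite mi0E. Qed.

Lemma sigma_inc y s j : sigma y (mi_inc s j) = y j * sigma y s.
Proof.
have [jn sn] := incb (erefl (maxn j.+1 (mi_bound s))).
rewrite (sigmaE _ sn) (sigmaE _ (mi_inc_lt jn sn)).
rewrite [in LHS](bigD1 (Ordinal jn))//= [in RHS](bigD1 (Ordinal jn))//= mi_incE eqxx addn1 exprS mulrA; congr (_ * _).
by apply: eq_bigr => i; rewrite -val_eqE/= => /negPf ij; rewrite mi_incE ij addn0.
Qed.

Lemma sigma_gt0 y s : (forall j, 0 < y j) -> 0 < sigma y s.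
Proof. by move=> y0; apply: prodr_gt0 => j _; rewrite exprn_gt0. Qed.

Lemma sigma_ge1 y s : (forall j, 1 <= y j) -> 1 <= sigma y s.
Proof.
move=> y1; rewrite /sigma; elim: (nu s) => [|j l IH]; rewrite ?big_nil// big_cons.
by rewrite mulr_ege1// exprn_ege1.
Qed.

Lemma sigma_norm_le1 y s : (forall j, `|y j| <= 1) -> `|sigma y s| <= 1.
Proof.
move=> y1; rewrite /sigma normr_prod; apply: prodr_ile1 => j _.
by rewrite normr_ge0/= normrX exprn_ile1.
Qed.

Lemma sigma_ge_deg y s a : 0 <= a -> (forall j, a <= y j) ->
  a ^+ mi_deg s <= sigma y s.
Proof.
move=> a0 ay; rewrite /sigma /mi_deg; elim: (nu s) => [|j l IH].
  by rewrite !big_nil expr0.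
by rewrite !big_cons exprD ler_pM ?exprn_ge0// lerXn2r// nnegrE// (le_trans a0).
Qed.

Lemma sigma_ge_coord y s j : (forall j, 1 <= y j) -> (s j != 0)%N ->
  y j <= sigma y s.
Proof.
move=> y1 sj; rewrite -(mi_decK sj) sigma_inc ler_peMr ?sigma_ge1//.
by rewrite (le_trans ler01).
Qed.

Lemma sigma_mono y s r : (forall j, 1 <= y j) -> (forall j, (r j <= s j)%N) ->
  sigma y r <= sigma y s.
Proof.
move=> y1 rs.
have rn j : (r j != 0)%N -> (j < mi_bound s)%N.
  by move=> rj; apply: mi_boundP; have := rs j; lia.
rewrite (sigmaE _ (@mi_boundP s)) (sigmaE _ rn); apply: ler_prod => j _.
by rewrite exprn_ge0 ?(le_trans ler01)//= ler_weXn2l.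
Qed.

Lemma sigma_powR y s (a : R) : (forall j, 0 < y j) ->
  sigma (fun j => y j `^ a) s = sigma y s `^ a.
Proof.
move=> y0; rewrite /sigma; elim: (nu s) => [|j l IH].
  by rewrite !big_nil powR1.
rewrite !big_cons IH powRM ?exprn_ge0 ?(ltW (y0 _))//; last first.
  by apply: prodr_ge0 => i _; rewrite exprn_ge0 ?(ltW (y0 _)).
congr (_ * _); rewrite -powR_mulrn ?powR_ge0// -powRrM.
by rewrite -[y j ^+ _]powR_mulrn ?(ltW (y0 _))// -powRrM mulrC.
Qed.

End monomials.

(* Halving multi-indices keeps the multiplication tree of logarithmic depth. *)
Lemma mi_split s k : (k <= mi_deg s)%N ->
  exists a b : multi_index, [/\ mi_deg a = k, (mi_deg a + mi_deg b = mi_deg s)%N,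
    (forall j, s j = a j + b j)%N &
    forall (R : realType) (y : nat -> R), sigma y s = sigma y a * sigma y b].
Proof.
move=> ks.
suff [a [b [ak abs sab]]] : exists a b : multi_index, [/\ mi_deg a = k,
    (mi_deg a + mi_deg b = mi_deg s)%N & forall j, (s j = a j + b j)%N].
  exists a, b; split=> // R y.
  have an j : (a j != 0)%N -> (j < mi_bound s)%N.
    by move=> aj; apply: mi_boundP; have := sab j; lia.
  have bn j : (b j != 0)%N -> (j < mi_bound s)%N.
    by move=> bj; apply: mi_boundP; have := sab j; lia.
  rewrite (sigmaE _ (@mi_boundP s)) (sigmaE _ an) (sigmaE _ bn) -big_split/=.
  by apply: eq_bigr => j _; rewrite sab exprD.
elim: k ks => [|k IH] ks.
  by exists mi0, s; split=> [||j]; rewrite ?mi_deg0 ?mi0E.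
have [a [b [ak abs sab]]] := IH (ltnW ks).
have [j bj] : exists j, (b j != 0)%N.
  have : (mi_deg b != 0)%N by lia.
  by rewrite mi_deg_eq0; apply: contraPP => /forallNP b0; apply/negP/negPn/eqP;
    apply: mi_eq => j; rewrite mi0E; have /negP := b0 j; rewrite negbK => /eqP.
exists (mi_inc a j), (mi_dec b j).
have bE : mi_deg b = (mi_deg (mi_dec b j)).+1 by rewrite -{1}(mi_decK bj) mi_deg_inc.
split; rewrite ?mi_deg_inc ?ak//; first by rewrite -abs bE ak; lia.
move=> i; rewrite mi_incE mi_decE sab; case: eqP => [->|_]; lia.
Qed.

Definition mi_box (J k : nat) : seq multi_index :=
  [seq mi_of J (fun j => if insub j is Some i then f i : nat else 0%N) |
     f : {ffun 'I_J -> 'I_k.+1}].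

Lemma mi_boxE J k (f : {ffun 'I_J -> 'I_k.+1}) (i : 'I_J) :
  mi_of J (fun j => if insub j is Some i then f i : nat else 0%N) i = f i.
Proof. by rewrite mi_ofE ltn_ord valK. Qed.

Lemma mem_mi_box J k s : (s \in mi_box J k) <->
  (forall j, (s j != 0)%N -> (j < J)%N) /\ (forall j, (s j <= k)%N).
Proof.
split=> [/mapP[f _ ->]|[sJ sk]].
  split=> j; rewrite mi_ofE; case: ifP => // jJ.
  by rewrite insubT /= -ltnS.
apply/mapP; exists [ffun i : 'I_J => inord (s i)]; rewrite ?mem_enum//.
apply: mi_eq => j.
rewrite mi_ofE; case: ifPn => [jJ|].
  by rewrite insubT/= ffunE inordK// ltnS.
by apply: contraNeq => /sJ.
Qed.

Lemma mi_box_uniq J k : uniq (mi_box J k).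
Proof.
rewrite map_inj_uniq ?enum_uniq// => f g fg; apply/ffunP => i; apply/val_inj.
by rewrite /= -(mi_boxE f) -(mi_boxE g) fg.
Qed.

Lemma sub_mi_box (L : seq multi_index) :
  exists n, forall J k, (n <= J)%N -> (n <= k)%N -> {subset L <= mi_box J k}.
Proof.
elim: L => [|s L [n nL]]; first by exists 0%N.
exists (maxn n (maxn (mi_bound s) (mi_deg s))) => J k.
rewrite !geq_max => /and3P[nJ bJ dJ] /and3P[nk bk dk] r.
rewrite inE => /orP[/eqP ->|]; last exact: nL.
apply/mem_mi_box; split=> j; first by move=> /mi_boundP/leq_trans; exact.
by rewrite (leq_trans (mi_deg_ge _ _)).
Qed.

(** Expanding the product of truncated geometric series picks one exponent per coordinate, that is
    one multi-index of the box. This turns summability over coordinates into summability over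
    multi-indices. *)
Lemma sum_mi_box (R : realType) (w : nat -> R) J k :
  \sum_(s <- mi_box J k) sigma w s = \prod_(j < J) \sum_(i < k.+1) w j ^+ i.
Proof.
rewrite bigA_distr_bigA/= big_map big_enum/=; apply: eq_bigr => f _.
rewrite (@sigmaE _ _ _ J); last by move=> j; rewrite mi_ofE; case: ifP.
by apply: eq_bigr => i _; rewrite mi_boxE.
Qed.

Lemma ler_sum_sub (R : numDomainType) (T : eqType) (L M : seq T) (F : T -> R) :
  uniq L -> {subset L <= M} -> (forall x, 0 <= F x) ->
  \sum_(x <- L) F x <= \sum_(x <- M) F x.
Proof.
move=> uL LM F0.
have pM : perm_eq M (seq.filter (mem L) M ++ seq.filter (predC (mem L)) M).
  by rewrite perm_sym perm_filterC.
rewrite (perm_big _ pM)/= big_cat/= -[leLHS]addr0 lerD ?sumr_ge0//.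
have -> : \sum_(x <- L) F x = \sum_(x <- undup (seq.filter (mem L) M)) F x.
  apply: perm_big; apply: uniq_perm; rewrite ?undup_uniq// => x.
  by rewrite mem_undup mem_filter/= andb_idr//; exact: LM.
elim: (seq.filter _ _) => [|x l IH]; first by rewrite !big_nil.
rewrite big_cons/=; case: ifP => _; first by rewrite (le_trans IH)// lerDr.
by rewrite big_cons lerD2l.
Qed.

(** Used to reorder a double sum over s and its support by the predecessor: (j, r) occurs exactly
    when r + e_j is in [L]. *)
Definition mi_pairs (L : seq multi_index) : seq (nat * multi_index) :=
  [seq (j, mi_dec s j) | s <- L, j <- nu s].

Lemma sum_mi_pairs (V : nmodType) (F : nat -> multi_index -> V) L :
  \sum_(s <- L) \sum_(j <- nu s) F j (mi_dec s j) =
  \sum_(p <- mi_pairs L) F p.1 p.2.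
Proof. by rewrite big_allpairs_dep. Qed.

Lemma mem_mi_pairs L p : (p \in mi_pairs L) = (mi_inc p.2 p.1 \in L).
Proof.
apply/allpairsPdep/idP => [[s [j [sL js ->]]]/=|pL].
  by rewrite mi_decK// -mem_nu.
exists (mi_inc p.2 p.1), p.1; split=> //.
  by rewrite mem_nu mi_incE eqxx addn1.
by rewrite mi_incK; case: p pL.
Qed.

Lemma mi_pairs_uniq L : uniq L -> uniq (mi_pairs L).
Proof.
move=> uL; apply: allpairs_uniq_dep => // [s _|]; first exact: nu_uniq.
move=> p p' /allpairsPdep[s [j [_ js ->]]] /allpairsPdep[s' [j' [_ js' ->]]]/=.
case=> jj ss; rewrite !mem_nu in js js'.
have e : s = s' by rewrite -(mi_decK js) -(mi_decK js') ss jj.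
by rewrite e jj.
Qed.

(** The order in which [mixed_pderiv] differentiates; the induction on derivatives runs over words,
    which remember this order. *)
Definition mi_word s : seq nat := flatten [seq nseq (s j) j | j <- nu s].

Definition seq_delete (T : Type) (i : nat) (w : seq T) : seq T :=
  take i w ++ drop i.+1 w.

Lemma count_mi_word s j : count_mem j (mi_word s) = s j.
Proof.
rewrite /mi_word count_flatten -map_comp sumnE big_map/=.
have [sj|sj] := eqVneq (s j) 0%N; last first.
  rewrite (bigD1_seq j) ?mem_nu ?nu_uniq//= count_nseq/= eqxx mul1n.
  by rewrite big1 ?addn0// => i ij; rewrite count_nseq/= (negPf ij).
rewrite sj big1_seq// => i /andP[_ _]; rewrite count_nseq/=.
by case: eqP => [->|//]; rewrite sj muln0.
Qed.

Lemma mi_word_sorted s : sorted leq (mi_word s).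
Proof.
rewrite /mi_word; have := nu_sorted s; elim: (nu s) => //= j l IH.
rewrite (path_sortedE leq_trans) => /andP[jl sl].
rewrite (sorted_pairwise leq_trans) pairwise_cat -!(sorted_pairwise leq_trans) IH//.
rewrite andbT; apply/andP; split; last first.
  elim: (s j) => //= n; case: n => //= n ->; by rewrite leqnn.
apply/allrelP => x y /nseqP[-> _] /flattenP[_ /mapP[i il ->]] /nseqP[-> _].
by move/allP: jl; apply.
Qed.

Lemma count_seq_delete (T : eqType) (x0 : T) a i (w : seq T) : (i < size w)%N ->
  count a w = (count a (seq_delete i w) + a (nth x0 w i))%N.
Proof.
move=> iw; rewrite -{1}(cat_take_drop i w) (drop_nth x0 iw) /seq_delete.
by rewrite !count_cat/= addnCA addnC.
Qed.

Lemma size_seq_delete (T : Type) i (w : seq T) : (i < size w)%N ->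
  size w = (size (seq_delete i w)).+1.
Proof.
by move=> iw; rewrite size_cat size_take size_drop iw; lia.
Qed.

(** Deleting a letter keeps the word sorted, and a sorted word is determined by its letter counts.
    Thus the lower derivatives in the recursion are again those of multi-indices, with no appeal to
    symmetry of mixed derivatives. *)
Lemma seq_delete_word s i : (i < size (mi_word s))%N ->
  seq_delete i (mi_word s) = mi_word (mi_dec s (nth 0%N (mi_word s) i)).
Proof.
move=> iw; apply: (sorted_eq leq_trans anti_leq).
- apply: (subseq_sorted leq_trans _ (mi_word_sorted s)).
  rewrite -{2}(cat_take_drop i (mi_word s)) cat_subseq//.
  by rewrite (drop_nth 0%N iw) subseq_cons.
- exact: mi_word_sorted.
- apply/allP => j _ /=; rewrite count_mi_word mi_decE -{1}(count_mi_word s j).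
  by rewrite (count_seq_delete 0%N _ iw)/= [j == nth _ _ _]eq_sym addnK.
Qed.

Lemma mem_mi_word s j : (j \in mi_word s) = (s j != 0)%N.
Proof. by rewrite -has_pred1 has_count count_mi_word lt0n. Qed.

Lemma sum_mi_word (V : nmodType) (F : nat -> V) s :
  \sum_(i < size (mi_word s)) F (nth 0%N (mi_word s) i) =
  \sum_(j <- nu s) F j *+ s j.
Proof.
rewrite -(big_mkord xpredT (fun i => F (nth 0%N (mi_word s) i))).
rewrite -(big_nth 0%N xpredT) /mi_word big_flatten big_map.
by apply: eq_bigr => j _; rewrite big_nseq iter_addr_0.
Qed.

Lemma mi_word0 : mi_word mi0 = [::].
Proof.
by apply/eqP; rewrite -size_eq0 -leqn0 leqNgt -has_predT; apply/hasPn => j;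
  rewrite mem_mi_word mi0E.
Qed.

End multi_indices.

Lemma foldr_iter_flatten (I T : Type) (f : I -> T -> T) (m : I -> nat) (x : T)
    (l : seq I) :
  foldr (fun i => iter (m i) (f i)) x l =
  foldr f x (flatten [seq nseq (m i) i | i <- l]).
Proof.
elim: l => //= i l ->; rewrite foldr_cat.
by elim: (m i) => //= k ->.
Qed.

Lemma mixed_pderiv_word (R : realType) d (D : set 'rV[R]_d) (s : multi_index)
    (U : (nat -> R) -> @sobolev_fun R d) :
  mixed_pderiv D s U = foldr (pderiv D) U (mi_word s).
Proof. exact: foldr_iter_flatten. Qed.

(** * Square integrable functions *)

Lemma is_cvg_series_bounded (R : realType) (u : R^nat) (M : R) :
  (forall n, \sum_(0 <= k < n) `|u k| <= M) -> cvgn (series u).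
Proof.
move=> uM; apply: normed_cvg; apply: nondecreasing_is_cvgn.
  by apply: nondecreasing_series => n _ _; exact: normr_ge0.
by exists M => _ [n _ <-]; exact: uM.
Qed.

Lemma le_limn_einf (R : realType) (u : (\bar R)^nat) (e : \bar R) :
  (\forall n \near \oo, u n <= e)%E -> (limn_einf u <= e)%E.
Proof.
move=> ue; rewrite limn_einf_lim; apply: lime_le.
  by apply: ereal_nondecreasing_is_cvgn; exact: nondecreasing_einfs.
apply: filterS ue => n; apply: le_trans.
by apply: ereal_inf_lbound; exists n => /=.
Qed.

Section integrable_real.
Context d (T : measurableType d) (R : realType).
Variables (mu : {measure set T -> \bar R}) (D : set T).
Hypothesis mD : measurable D.
Implicit Types f g : T -> R.

Lemma integrable_realD f g : mu.-integrable D (EFin \o f) ->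
  mu.-integrable D (EFin \o g) -> mu.-integrable D (EFin \o (fun x => f x + g x)).
Proof. by move=> fi gi; exact: (integrableD mD fi gi). Qed.

Lemma integrable_realZ a f : mu.-integrable D (EFin \o f) ->
  mu.-integrable D (EFin \o (fun x => a * f x)).
Proof. by move=> fi; exact: (integrableZl mD a fi). Qed.

Lemma integrable_realB f g : mu.-integrable D (EFin \o f) ->
  mu.-integrable D (EFin \o g) -> mu.-integrable D (EFin \o (fun x => f x - g x)).
Proof. by move=> fi gi; exact: (integrableB mD fi gi). Qed.

Lemma Rintegral_EFin f : mu.-integrable D (EFin \o f) ->
  (\int[mu]_(x in D) (f x)%:E = (\int[mu]_(x in D) f x)%:E)%E.
Proof. by move=> fi; rewrite /Rintegral fineK//; exact: integrable_fin_num. Qed.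

End integrable_real.

Section L2.
Context d (T : measurableType d) (R : realType).
Variables (mu : {measure set T -> \bar R}) (D : set T).
Hypothesis mD : measurable D.
Implicit Types f g h : T -> R.

Definition L2 f : Prop :=
  measurable_fun D f /\ mu.-integrable D (EFin \o (fun x => f x ^+ 2)).

Definition L2dot f g : R := \int[mu]_(x in D) (f x * g x).

Lemma L2_mul_integrable f g : L2 f -> L2 g ->
  mu.-integrable D (EFin \o (fun x => f x * g x)).
Proof.
move=> [mf f2] [mg g2]; apply: le_integrable (integrableD mD f2 g2) => //.
  by apply/measurable_EFinP; exact: measurable_funM.
move=> x _ /=; rewrite lee_fin normrM [leRHS]ger0_norm ?addr_ge0 ?sqr_ge0//.
rewrite -[f x ^+ 2]real_normK ?num_real// -[g x ^+ 2]real_normK ?num_real//.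
by have := sqr_ge0 (`|f x| - `|g x|); have := sqr_ge0 (`|f x| + `|g x|); nra.
Qed.

Lemma L2_linear a f g : L2 f -> L2 g -> L2 (fun x => a * f x + g x).
Proof.
move=> Lf Lg; have [mf f2] := Lf; have [mg g2] := Lg; split.
  by apply: measurable_funD => //; exact: measurable_funM.
have := integrableD mD (integrableZl mD (a ^+ 2) f2)
  (integrableD mD (integrableZl mD (2 * a) (L2_mul_integrable Lf Lg)) g2).
apply: eq_integrable => // x _ /=; rewrite -!EFinM -!EFinD; congr EFin; ring.
Qed.

Lemma L2B f g : L2 f -> L2 g -> L2 (fun x => f x - g x).
Proof.
move=> Lf Lg; have := L2_linear (-1) Lg Lf.
by under eq_fun do rewrite mulN1r addrC.
Qed.

Lemma L2dotC f g : L2dot f g = L2dot g f.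
Proof. by apply: eq_Rintegral => x _; rewrite mulrC. Qed.

Lemma L2dot_linear a f g h : L2 f -> L2 g -> L2 h ->
  L2dot (fun x => a * f x + g x) h = a * L2dot f h + L2dot g h.
Proof.
move=> Lf Lg Lh; rewrite /L2dot -RintegralZl//; last exact: L2_mul_integrable.
rewrite -RintegralD//; last exact: L2_mul_integrable.
  by apply: eq_Rintegral => x _; rewrite mulrDl mulrA.
exact: (integrableZl mD a (L2_mul_integrable Lf Lh)).
Qed.

Lemma L2dot_ge0 f : 0 <= L2dot f f.
Proof. by apply: Rintegral_ge0 => x _; rewrite -expr2 sqr_ge0. Qed.

Lemma L2dot_EFin f g : L2 f -> L2 g ->
  (L2dot f g)%:E = (\int[mu]_(x in D) (f x * g x)%:E)%E.
Proof.
move=> Lf Lg; rewrite /L2dot /Rintegral fineK//.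
by apply: integrable_fin_num => //; exact: L2_mul_integrable.
Qed.

(* Along a subsequence with ||g_(k+1) - g_k||^2 <= 8^-k the series of the
   2^k (g_(k+1) - g_k)^2 is integrable, hence finite almost everywhere. *)
Let fast_cauchy_limit (g : nat -> T -> R) :
  (forall k, L2 (g k)) ->
  (forall k, L2dot (fun x => g k.+1 x - g k x) (fun x => g k.+1 x - g k x) <=
             8^-1 ^+ k) ->
  exists2 f : T -> R, measurable_fun D f &
    {ae mu, forall x, D x -> (fun k => g k x) @ \oo --> f x}.
Proof.
move=> Lg dg.
pose dl k x := g k.+1 x - g k x.
have Ld k : L2 (dl k) by exact: L2B.
pose w k x : \bar R := (2 ^+ k * dl k x ^+ 2)%:E.
have w0 k x : (0 <= w k x)%E by rewrite lee_fin mulr_ge0 ?sqr_ge0 ?exprn_ge0.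
have mw k : measurable_fun D (w k).
  apply/measurable_EFinP; apply: measurable_funM => //.
  by apply: measurable_funX; case: (Ld k).
pose S x := (\sum_(k <oo) w k x)%E.
have iS : mu.-integrable D S.
  apply/integrableP; split; first by apply: ge0_emeasurable_sum.
  under eq_integral => x _ do rewrite gee0_abs ?nneseries_ge0//.
  rewrite integral_nneseries//.
  apply: (@le_lt_trans _ _ (\sum_(k <oo) (4^-1 ^+ k : R)%:E)%E).
    apply: lee_nneseries => [k _ _|k _]; first by apply: integral_ge0.
    under eq_integral do rewrite /w EFinM.
    rewrite integralZl//; last by case: (Ld k).
    have -> : (\int[mu]_(x in D) (dl k x ^+ 2)%:E)%E = (L2dot (dl k) (dl k))%:E.
      by rewrite L2dot_EFin//; apply: eq_integral => x _; rewrite expr2.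
    rewrite -EFinM lee_fin (le_trans (ler_wpM2l _ (dg k))) ?exprn_ge0//.
    by rewrite -exprMn (_ : 2 * 8^-1 = 4^-1 :> R)//; field.
  have c4 : `|4^-1 : R| < 1 by rewrite ger0_norm; lra.
  have cg := @cvg_geometric_series _ 1 _ c4.
  rewrite (_ : (fun n => _) = EFin \o series (geometric 1 4^-1)); last first.
    apply/funext => n /=; rewrite sumEFin; congr EFin.
    by apply: eq_bigr => i _; rewrite /geometric/= mul1r.
  by rewrite EFin_lim ?ltry//; apply/cvg_ex; eexists; exact: cg.
(* The upper limit is defined everywhere and measurable, and it agrees with the limit wherever that
   exists. *)
pose f x := fine (limn_esup (fun k => (g k x)%:E)).
exists f.
  apply: measurableT_comp => //; apply: measurable_fun_limn_esup => k.
  by apply/measurable_EFinP; case: (Lg k).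
apply: filterS (integrable_ae mD iS) => x /= /[apply] Sx.
have S0 : (0 <= S x)%E by exact: nneseries_ge0.
(* By |t| <= (2^k t^2 + 2^-k) / 2 the telescoping series converges absolutely wherever [S] is
   finite. *)
have bd n : \sum_(0 <= k < n) `|dl k x| <= 2^-1 * (fine (S x) + 2).
  have h1 : \sum_(0 <= k < n) 2 ^+ k * dl k x ^+ 2 <= fine (S x).
    rewrite -lee_fin fineK// -sumEFin.
    by apply: (@nneseries_lim_ge _ (w ^~ x) xpredT 0%N n) => k _ _; exact: w0.
  have h2 : \sum_(0 <= k < n) 2^-1 ^+ k <= 2 :> R.
    have -> : \sum_(0 <= k < n) 2^-1 ^+ k = 2 - 2 * 2^-1 ^+ n :> R.
      elim: n {h1} => [|n IH]; first by rewrite big_geq// expr0 mulr1 subrr.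
      by rewrite big_nat_recr//= IH exprS; field.
    by rewrite gerBl mulr_ge0 ?exprn_ge0.
  apply: le_trans (ler_wpM2l _ (lerD h1 h2)) => //.
  rewrite -big_split/= mulr_sumr; apply: ler_sum => k _.
  have e0 : 0 < (2 : R) ^+ k by rewrite exprn_gt0.
  have := sqr_ge0 (2 ^+ k * `|dl k x| - 1).
  rewrite -[dl k x ^+ 2]real_normK ?num_real//.
  have -> : (2^-1 : R) ^+ k = (2 ^+ k)^-1 by rewrite exprVn.
  move: (2 ^+ k) e0 => e e0 h.
  have -> : 2^-1 * (e * `|dl k x| ^+ 2 + e^-1) =
      `|dl k x| + (2 * e)^-1 * (e * `|dl k x| - 1) ^+ 2.
    by field; rewrite gt_eqF.
  rewrite lerDl; apply: mulr_ge0 => //.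
  by rewrite invr_ge0; apply: mulr_ge0 => //; exact: ltW.
have /cvg_ex[l cl] := is_cvg_series_bounded bd.
have gl : (fun k => g k x) @ \oo --> g 0%N x + l.
  have -> : (fun k => g k x) = (fun k => g 0%N x + series (fun k => dl k x) k).
    apply/funext => n; rewrite /series/= telescope_sumr//; ring.
  by apply: cvgD => //; exact: cvg_cst.
suff -> : f x = g 0%N x + l by [].
have el : (fun k => (g k x)%:E) @ \oo --> (g 0%N x + l)%:E.
  by apply: cvg_EFin; [exact: nearW|exact: gl].
rewrite /f is_cvg_limn_esupE; last by apply/cvg_ex; exists (g 0%N x + l)%:E.
by rewrite (cvg_lim _ el).
Qed.

(** Riesz-Fischer. A fast subsequence converges almost everywhere, and Fatou's lemma carries the
    Cauchy estimate to the limit, which yields both square integrability and convergence of the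
    whole sequence. *)
Lemma L2_complete (f_ : nat -> T -> R) :
  (forall n, L2 (f_ n)) ->
  (forall e, 0 < e -> exists N, forall m n, (N <= m)%N -> (N <= n)%N ->
    L2dot (fun x => f_ m x - f_ n x) (fun x => f_ m x - f_ n x) <= e) ->
  exists2 f : T -> R, L2 f &
    forall e, 0 < e -> exists N, forall n, (N <= n)%N ->
    L2dot (fun x => f_ n x - f x) (fun x => f_ n x - f x) <= e.
Proof.
move=> Lf cf.
have /choice[N0 N0P] : forall k, exists N, forall m n, (N <= m)%N -> (N <= n)%N ->
    L2dot (fun x => f_ m x - f_ n x) (fun x => f_ m x - f_ n x) <= 8^-1 ^+ k.
  by move=> k; apply: cf; rewrite exprn_gt0.
(* The sum makes [phi] monotone and at least [N0 k]; the summand [k] makes it unbounded. *)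
pose phi k := (\sum_(i < k.+1) N0 i + k)%N.
have phi_ge k : (N0 k <= phi k)%N by rewrite /phi big_ord_recr/= -addnA addnCA leq_addr.
have phiS k : (phi k <= phi k.+1)%N.
  by rewrite /phi [in X in (_ <= X)%N]big_ord_recr/= leq_add// leq_addr.
have phi_id k : (k <= phi k)%N by rewrite leq_addl.
have [f mf fl] : exists2 f : T -> R, measurable_fun D f &
    {ae mu, forall x, D x -> (fun k => f_ (phi k) x) @ \oo --> f x}.
  apply: fast_cauchy_limit => k; first exact: Lf.
  by apply: N0P; rewrite ?(leq_trans (phi_ge k)).
have lim_le e N : (forall m n, (N <= m)%N -> (N <= n)%N ->
    L2dot (fun x => f_ m x - f_ n x) (fun x => f_ m x - f_ n x) <= e) ->
  forall n, (N <= n)%N ->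
    (\int[mu]_(x in D) ((f_ n x - f x) ^+ 2)%:E <= e%:E)%E.
  move=> Ne n Nn.
  pose s k x := ((f_ n x - f_ (phi k) x) ^+ 2)%:E.
  have ms k : measurable_fun D (s k).
    apply/measurable_EFinP; apply: measurable_funX; apply: measurable_funB.
      by case: (Lf n).
    by case: (Lf (phi k)).
  apply: (@le_trans _ _ (\int[mu]_(x in D) limn_einf (s ^~ x))%E).
    apply: ae_ge0_le_integral => //.
    - by move=> x _; rewrite lee_fin sqr_ge0.
    - apply/measurable_EFinP; apply: measurable_funX; apply: measurable_funB => //.
      by case: (Lf n).
    - move=> x _; rewrite limn_einf_lim; apply: lime_ge.
        by apply: ereal_nondecreasing_is_cvgn; exact: nondecreasing_einfs.
      apply: nearW => k; apply: le_ereal_inf_tmp => _ [j _ <-].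
      by rewrite lee_fin sqr_ge0.
    - have mNs k : measurable_fun D (fun x => - s k x)%E.
        by apply: measurableT_comp => //; exact: ms.
      have : measurable_fun D (fun x => - limn_esup (fun k => - s k x))%E.
        by apply: measurableT_comp => //; exact: measurable_fun_limn_esup.
      apply: eq_measurable_fun => x _; rewrite -[in RHS](oppeK (limn_einf _)).
      by rewrite -limn_esupN.
    - apply: filterS fl => x /= /[apply] fx.
      have sx : (s ^~ x) @ \oo --> ((f_ n x - f x) ^+ 2)%:E.
        have gx : (fun k => f_ n x - f_ (phi k) x) @ \oo --> f_ n x - f x.
          by apply: cvgB => //; exact: cvg_cst.
        apply: cvg_EFin; first exact: nearW.
        by under [X in X @ _]eq_fun do rewrite /= expr2; rewrite expr2; exact: cvgM.
      rewrite is_cvg_limn_einfE; last by apply/cvg_ex; eexists; exact: sx.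
      by rewrite (cvg_lim _ sx).
  have s0 k x : D x -> (0 <= s k x)%E by rewrite lee_fin sqr_ge0.
  apply: (le_trans (fatou mu mD ms s0)).
  apply: le_limn_einf; near=> k.
  have Nk : (N <= phi k)%N by rewrite (leq_trans _ (phi_id k))//; near: k; exact: nbhs_infty_ge.
  have := Ne n (phi k) Nn Nk; rewrite -lee_fin L2dot_EFin; [|exact: L2B..].
  by rewrite /s; under eq_integral do rewrite -expr2.
have [N1 N1P] := cf 1 ltr01.
have Ld : L2 (fun x => f_ N1 x - f x).
  split; first by apply: measurable_funB => //; case: (Lf N1).
  apply/integrableP; split.
    apply/measurable_EFinP; apply: measurable_funX; apply: measurable_funB => //.
    by case: (Lf N1).
  under eq_integral => x _ do rewrite /= ger0_norm ?sqr_ge0//.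
  by rewrite (le_lt_trans (lim_le 1 N1 N1P N1 (leqnn _)))// ltry.
have L2f : L2 f.
  have := L2B (Lf N1) Ld.
  by under eq_fun do rewrite opprB addrCA subrr addr0.
exists f => // e e0; have [N NP] := cf e e0; exists N => n Nn.
rewrite -lee_fin L2dot_EFin//; [|exact: L2B..].
under eq_integral do rewrite -expr2.
exact: lim_le Nn.
Unshelve. all: by end_near. Qed.

End L2.

(** * Test functions and the Poincare inequality *)

Section open_measurable_rV.
Context {R : realType} {d : nat}.
Local Notation E := 'rV[R]_d.

Let cell (a : {ffun 'I_d -> rat} * nat) : set E :=
  [set x | forall i, `]ratr (a.1 i) - a.2.+1%:R^-1, ratr (a.1 i) + a.2.+1%:R^-1[%classic (x 0 i)].

Let measurable_cell a : measurable (cell a).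
Proof.
apply: (@measurable_box R d (fun i => `]ratr (a.1 i) - a.2.+1%:R^-1, ratr (a.1 i) + a.2.+1%:R^-1[%classic)).
by move=> i; exact: measurable_itv.
Qed.

(** The sigma-algebra is generated by the coordinates, and an open set is the union of the countably
    many rational cubes it contains. *)
Lemma open_measurable_rV (A : set E) : open A -> measurable A.
Proof.
move=> oA.
have -> : A = \bigcup_n (if @choice.unpickle ({ffun 'I_d -> rat} * nat)%type n is Some a
    then if `[< cell a `<=` A >] then cell a else set0 else set0).
  apply/seteqP; split=> [x Ax|x [n _]]; last first.
    case: choice.unpickle => [a|//]; case: ifPn => // /asboolP; exact.
  have /nbhs_ballP[e /= e0 eA] := open_nbhs_nbhs (conj oA Ax).
  have [k ke] : exists k, 2 * k.+1%:R^-1 < e.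
    exists (Num.truncn (2 / e)).
    by rewrite ltr_pdivrMr ?ltr0n// mulrC -ltr_pdivrMr// truncnS_gt.
  have k0 : (0 : R) < k.+1%:R^-1 by rewrite invr_gt0.
  have /choice[q qP] : forall i : 'I_d, exists q : rat,
      ratr q \in `]x 0 i - k.+1%:R^-1, x 0 i + k.+1%:R^-1[.
    move=> i; apply: rat_in_itvoo; rewrite ltrBlDr -addrA ltrDl.
    by rewrite addr_gt0.
  pose a : ({ffun 'I_d -> rat} * nat)%type := ([ffun i => q i], k).
  have ax : cell a x.
    move=> i; rewrite /a/= ffunE in_itv/=; have := qP i; rewrite in_itv/=.
    move: (k.+1%:R^-1) => e'; move: (ratr _) => z.
    by move=> /andP[? ?]; apply/andP; split; lra.
  exists (choice.pickle a) => //; rewrite choice.pickleK ifT//; apply/asboolP => y ay.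
  apply: eA; split=> // i j; rewrite ord1; have := ax j; have := ay j.
  rewrite /a/= ffunE /ball/= !in_itv/= ltr_distl; move: (ratr _) (k.+1%:R^-1) ke => z e' ?.
  by move=> /andP[? ?] /andP[? ?]; apply/andP; split; lra.
apply: bigcup_measurable => n _; case: choice.unpickle => [a|] //.
by case: ifP.
Qed.

Lemma continuous_measurable_rV (f : E -> R) :
  continuous f -> measurable_fun setT f.
Proof.
move=> /continuousP cf; apply: (measurability _ (RGenOpens.measurableE R)).
move=> _ [_ [a [b ->] <-]]; rewrite setTI; apply: open_measurable_rV.
exact/cf/interval_open.
Qed.

End open_measurable_rV.

Section poincare_line.
Context {R : realType}.
Variables (g g' : R -> R) (M : R).
Hypothesis M0 : 0 < M.
Hypothesis cg : continuous g.
Hypothesis cg' : continuous g'.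
Hypothesis dg : forall t : R, is_derive t (1 : R) g (g' t).
Hypothesis g0 : forall t, M <= `|t| -> g t = 0.
Let I : set R := `[- M, M]%classic.

(* The integral of (t g(t)^2)' vanishes, and
   g^2 + 2 t g g' = 2^-1 (g + 2 t g')^2 + 2^-1 g^2 - 2 t^2 g'^2. *)
Lemma poincare_line :
  (\int[lebesgue_measure]_(x in I) (g x ^+ 2)%:E <=
   (4 * M ^+ 2)%:E * \int[lebesgue_measure]_(x in I) (g' x ^+ 2)%:E)%E.
Proof.
pose f t := g t ^+ 2 + 2 * t * g t * g' t.
pose F t := t * g t ^+ 2.
have cint (h : R -> R) : continuous h ->
    (@lebesgue_measure R).-integrable I (EFin \o h).
  move=> ch; apply: continuous_compact_integrable; first exact: segment_compact.
  exact: continuous_subspaceT.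
have cg2 : continuous (fun t => g t ^+ 2).
  move=> t; have -> : (fun t => g t ^+ 2) = (fun t => g t * g t) by apply/funext.
  by apply: cvgM; exact: cg.
have cg'2 : continuous (fun t => g' t ^+ 2).
  move=> t; have -> : (fun t => g' t ^+ 2) = (fun t => g' t * g' t) by apply/funext.
  by apply: cvgM; exact: cg'.
have cf : continuous f.
  move=> t; apply: cvgD; first exact: cg2.
  apply: cvgM; last exact: cg'.
  apply: cvgM; last exact: cg.
  by apply: cvgM; [exact: cvg_cst|exact: cvg_id].
have dF (t : R) : is_derive t (1 : R) F (f t).
  have := is_deriveM (is_derive_id t (1 : R)) (is_deriveM (dg t) (dg t)).
  rewrite (_ : (id * (g * g))%R = F); last by apply/funext => x; rewrite /F expr2.
  move=> h; apply: (is_derive_eq h); rewrite /f /GRing.scale/=.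
  rewrite -[(g * g) t]/(g t * g t) expr2; ring.
have F0 : (\int[lebesgue_measure]_(x in I) (f x)%:E = 0)%E.
  rewrite (@continuous_FTC2 _ f F)//.
  - by rewrite /F !g0 ?normrN ?ger0_norm// ?(ltW M0)// expr0n !mulr0 subee.
  - by rewrite gtrN.
  - exact: continuous_subspaceT.
  - have cF : continuous F.
      move=> t; apply: cvgM; first exact: cvg_id.
      exact: cg2.
    split=> [t _||]; first by case: (dF t).
    + by apply: cvg_at_right_filter; exact: cF.
    + by apply: cvg_at_left_filter; exact: cF.
  - by move=> t _; rewrite derive1E; case: (dF t).
have i2 := cint _ cg2; have i2' := cint _ cg'2.
have mI : measurable I by exact: measurable_itv.
have : 0 >= \int[lebesgue_measure]_(x in I) (2^-1 * g x ^+ 2 - (2 * M ^+ 2) * g' x ^+ 2).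
  have <- : \int[lebesgue_measure]_(x in I) f x = 0 by rewrite /Rintegral F0.
  apply: le_Rintegral => //.
  - by apply: integrable_realB => //; exact: integrable_realZ.
  - exact: cint.
  - move=> t; rewrite /I/= in_itv/= -ler_norml => tM; rewrite /f.
    have t2 : t ^+ 2 <= M ^+ 2.
      by rewrite -real_normK ?num_real// lerXn2r// ?nnegrE// ltW.
    have := sqr_ge0 (g t + 2 * t * g' t).
    have := mulr_ge0 (sqr_ge0 (g' t)) (_ : 0 <= M ^+ 2 - t ^+ 2).
    rewrite subr_ge0 => /(_ t2); rewrite !expr2; nra.
rewrite RintegralB//; [|exact: integrable_realZ..].
rewrite !RintegralZl// => h.
rewrite !Rintegral_EFin// -EFinM lee_fin; lra.
Qed.

End poincare_line.

Section test_functions.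
Context {R : realType} {d : nat}.
Local Notation E := 'rV[R]_d.
Implicit Types (D K : set E) (phi psi : E -> R).

Lemma smooth_linear (a : R) phi psi : smooth phi -> smooth psi ->
  smooth (fun x => a * phi x + psi x) /\
  forall i x, partial i (fun x => a * phi x + psi x) x =
              a * partial i phi x + partial i psi x.
Proof.
move=> sphi spsi.
have dlin (f g : E -> R) i x : derivable f x (delta_mx 0 i) ->
    derivable g x (delta_mx 0 i) ->
    is_derive x (delta_mx 0 i) (fun x => a * f x + g x)
      (a * partial i f x + partial i g x).
  move=> /derivableP df /derivableP dg.
  exact: (is_deriveD (is_deriveZ a df) dg).
have lin (s : seq 'I_d) : foldr partial (fun x => a * phi x + psi x) s =
    fun x => a * foldr partial phi s x + foldr partial psi s x.
  elim: s => //= i s ->; apply/funext => x.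
  have [_ dphi] := sphi s; have [_ dpsi] := spsi s.
  by have [_ <-] := dlin _ _ i x (dphi i x) (dpsi i x).
split=> [s|i x]; last first.
  have [_ dphi] := sphi [::]; have [_ dpsi] := spsi [::].
  by have [_ <-] := dlin _ _ i x (dphi i x) (dpsi i x).
have [cphi dphi] := sphi s; have [cpsi dpsi] := spsi s.
rewrite lin; split=> [x|i x]; last by have [] := dlin _ _ i x (dphi i x) (dpsi i x).
by apply: (cvgD _ (cpsi x)); exact: (cvgM (cvg_cst a) (cphi x)).
Qed.

Lemma test_function_linear D (a : R) phi psi :
  test_function D phi -> test_function D psi ->
  test_function D (fun x => a * phi x + psi x).
Proof.
move=> [sphi [K [cK KD K0]]] [spsi [L [cL LD L0]]].
split; first by case: (smooth_linear a sphi spsi).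
exists (K `|` L); split.
- exact: compactU.
- by rewrite subUset.
- by move=> x /not_orP[xK xL]; rewrite K0// L0// mulr0 addr0.
Qed.

Lemma smooth_continuous phi : smooth phi -> continuous phi.
Proof. by move=> /(_ [::])[]. Qed.

Lemma smooth_partial_continuous phi i : smooth phi -> continuous (partial i phi).
Proof. by move=> /(_ [:: i])[]. Qed.

Lemma smooth_is_derive phi i x : smooth phi ->
  is_derive x (delta_mx 0 i) phi (partial i phi x).
Proof. by move=> /(_ [::])[_ /(_ i x) dphi]; exact: derivableP. Qed.

Lemma partial_supp phi K i x : compact K -> (forall x, ~ K x -> phi x = 0) ->
  ~ K x -> partial i phi x = 0.
Proof.
move=> cK K0 Kx.
have oK : open (~` K) by apply: closed_openC; apply: compact_closed => //; exact: norm_hausdorff.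
rewrite /partial (@near_eq_derive _ _ _ phi (cst 0)) ?derive_cst//.
near=> z; rewrite K0//; near: z.
exact: open_nbhs_nbhs.
Unshelve. all: by end_near. Qed.

Lemma supp_bounded D phi : (exists K, [/\ compact K, K `<=` D &
    forall x, ~ K x -> phi x = 0]) -> continuous phi ->
  exists M : R, forall x, `|phi x| <= M.
Proof.
move=> [K [cK _ K0]] cphi.
have /compact_bounded[M [_ MP]] : compact (phi @` K).
  by apply: continuous_compact => //; exact: continuous_subspaceT.
exists (Num.max 0 (M + 1)) => x; have [Kx|/K0 ->] := pselect (K x); last first.
  by rewrite normr0 le_max lexx.
rewrite le_max; apply/orP; right; apply: (MP (M + 1)); first by rewrite ltrDl.
by exists x.
Qed.

End test_functions.

Section sobolev_domain.
Context {R : realType} {n : nat}.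
Local Notation d := n.+1.
Local Notation E := 'rV[R]_d.
Local Notation leb := (lebesgue_rV R d).
Variable D : set E.
Hypothesis oD : open D.
Hypothesis bD : bounded_set D.

Lemma domain_measurable : measurable D. Proof. exact: open_measurable_rV. Qed.
Local Notation mD := domain_measurable.

Lemma rV_coor_le (x : E) i : `|x 0 i| <= `|x|.
Proof.
rewrite [leRHS]mx_normrE.
exact: (le_bigmax 0 (fun ij : 'I_1 * 'I_d => `|x ij.1 ij.2|) (0, i)).
Qed.

Lemma domain_coor_bound : exists2 M : R, 0 < M &
  forall x i, D x -> `|x 0 i| < M.
Proof.
have [M [_ MP]] := bD; exists (`|M| + 2); first by rewrite ltr_pwDr.
move=> x i Dx; apply: (@le_lt_trans _ _ (`|M| + 1)); last by rewrite ltrD2l ltr1n.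
apply: le_trans (rV_coor_le x i) _; apply: (MP (`|M| + 1)) => //.
by rewrite (le_lt_trans (ler_norm M))// ltrDl.
Qed.

Lemma domain_measure_lty : (leb D < +oo)%E.
Proof.
have [M M0 MD] := domain_coor_bound.
have mI (i : 'I_d) : measurable (`[- M, M]%classic : set R) by exact: measurable_itv.
apply: (@le_lt_trans _ _ (leb [set x : E | forall i, `[- M, M]%classic (x 0 i)])).
  apply: le_measure; rewrite ?inE; [exact: mD|exact: (measurable_box mI)|].
  by move=> x Dx i /=; rewrite in_itv/= -ler_norml ltW// MD.
rewrite (lebesgue_rV_box mI) ltey_eq; apply/orP; left.
apply: (big_ind (fun x => x \is a fin_num)) => //.
  by move=> x y; exact: fin_numM.
by move=> i _; rewrite lebesgue_measure_itv/=; case: ifP.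
Qed.

Lemma continuous_bounded_L2 (f : E -> R) (M : R) : continuous f ->
  (forall x, `|f x| <= M) -> L2 leb D f.
Proof.
move=> cf fM; have mf : measurable_fun D f.
  by apply: measurable_funTS; exact: continuous_measurable_rV.
split=> //; apply: measurable_bounded_integrable; first exact: mD.
- exact: domain_measure_lty.
- exact: measurable_funX.
- exists (M ^+ 2); split; first exact: num_real.
  move=> z Mz x _ /=; rewrite (le_trans _ (ltW Mz))// normrX lerXn2r ?nnegrE//.
  by rewrite (le_trans _ (fM x)).
Qed.

Section test.
Variable phi : E -> R.
Hypothesis tphi : test_function D phi.

Lemma test_L2 : L2 leb D phi.
Proof.
have [sphi supp] := tphi; have cphi := smooth_continuous sphi.
by have [M MP] := supp_bounded supp cphi; exact: (continuous_bounded_L2 cphi MP).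
Qed.

Lemma test_partial_L2 i : L2 leb D (partial i phi).
Proof.
have [sphi [K [cK KD K0]]] := tphi.
have cphi := smooth_partial_continuous (i := i) sphi.
have [|M MP] := @supp_bounded _ _ D (partial i phi) _ cphi; last first.
  exact: (continuous_bounded_L2 cphi MP).
by exists K; split=> // x; exact: partial_supp.
Qed.

Lemma integral_next (h : E -> \bar R) : measurable_fun setT h ->
  (forall x, 0 <= h x)%E ->
  (\int[leb]_x h x =
   \int[lebesgue_rV R n]_y \int[lebesgue_measure]_t h (glue_coor (t, y)))%E.
Proof.
move=> mh h0.
have lebE : (leb : set E -> \bar R) =
    pushforward (@lebesgue_measure R \x lebesgue_rV R n)%E (@glue_coor R n) by [].
rewrite lebE ge0_integral_pushforward//; last exact: measurable_glue_coor.
rewrite preimage_setT.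
rewrite fubini_tonelli2//; last by move=> x; exact: h0.
by apply: measurableT_comp => //; exact: measurable_glue_coor.
Qed.

Lemma measurable_inner_integral (h : E -> \bar R) : measurable_fun setT h ->
  (forall x, 0 <= h x)%E ->
  measurable_fun setT
    (fun y => \int[@lebesgue_measure R]_t h (glue_coor (t, y)))%E.
Proof.
move=> mh h0.
apply: (@measurable_fun_fubini_tonelli_G _ _ _ _ _ (@lebesgue_measure R)
  (fun z => h (glue_coor z))) => //.
by apply: measurableT_comp => //; exact: measurable_glue_coor.
Qed.

Lemma glue_coorD (t h : R) (y : 'rV[R]_n) :
  h *: delta_mx 0 0 + glue_coor (t, y) = glue_coor (t + h, y).
Proof.
apply/rowP => i; have [j ->|->] := unliftP ord0 i.
  by rewrite [LHS]mxE !glue_coorS !(mxE, mulr0) add0r.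
by rewrite [LHS]mxE !glue_coor0 !(mxE, mulr1) addrC.
Qed.

Lemma continuous_glue_coor (y : 'rV[R]_n) : continuous (fun t : R => glue_coor (t, y)).
Proof.
have -> : (fun t : R => glue_coor (t, y)) =
    (fun t => t *: (delta_mx 0 0 : E) + glue_coor (0, y)).
  by apply/funext => t; rewrite glue_coorD add0r.
move=> t; apply: cvgD; last exact: cvg_cst.
by apply: cvgZl; exact: cvg_id.
Qed.

Lemma is_derive_glue (y : 'rV[R]_n) (t : R) :
  is_derive t (1 : R) (fun t : R => phi (glue_coor (t, y)))
    (partial 0 phi (glue_coor (t, y))).
Proof.
have [sphi _] := tphi.
have [dphi ephi] := smooth_is_derive 0 (glue_coor (t, y)) sphi.
have e : (fun h : R => h^-1 *: (((fun t => phi (glue_coor (t, y))) \o shift t) (h *: (1 : R)) -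
      phi (glue_coor (t, y)))) =
    (fun h : R => h^-1 *: ((phi \o shift (glue_coor (t, y))) (h *: (delta_mx 0 0 : E)) -
      phi (glue_coor (t, y)))).
  apply/funext => h /=; rewrite glue_coorD.
  by rewrite [h *: 1]mulr1 [h + t]addrC.
by apply: DeriveDef; rewrite ?/derivable ?/derive e.
Qed.

(** On each line parallel to the first axis the test function vanishes for |t| >= M, so the
    inequality on the line can be integrated over the other coordinates by Tonelli. *)
Lemma test_poincare (M : R) : 0 < M -> (forall x i, D x -> `|x 0 i| < M) ->
  L2dot leb D phi phi <= 4 * M ^+ 2 * L2dot leb D (partial 0 phi) (partial 0 phi).
Proof.
move=> M0 MD; have [sphi [K [cK KD K0]]] := tphi.
have cphi := smooth_continuous sphi.
have cdphi := smooth_partial_continuous (i := 0) sphi.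
have dK0 x : ~ K x -> partial 0 phi x = 0 by exact: partial_supp.
have KM t y : M <= `|t| -> ~ K (glue_coor (t, y)).
  by move=> Mt /KD /(MD _ 0); rewrite glue_coor0/= ltNge Mt.
pose I : set R := `[- M, M]%classic.
have sq_meas (h : E -> R) : continuous h ->
    measurable_fun setT (fun x => (h x ^+ 2)%:E).
  move=> ch; apply/measurable_EFinP; apply: measurable_funX.
  exact: continuous_measurable_rV.
have sq0 (h : E -> R) x : (0 <= (h x ^+ 2)%:E)%E by rewrite lee_fin sqr_ge0.
have full (h : E -> R) : L2 leb D h -> continuous h ->
    (forall x, ~ K x -> h x = 0) ->
    (L2dot leb D h h)%:E = (\int[lebesgue_rV R n]_y
      \int[lebesgue_measure]_(t in I) (h (glue_coor (t, y)) ^+ 2)%:E)%E.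
  move=> Lh ch h0; rewrite (L2dot_EFin mD Lh Lh) integral_mkcond.
  rewrite (_ : (_ \_ D) = (fun x => (h x ^+ 2)%:E)); last first.
    apply/funext => x; rewrite patchE; case: ifPn; rewrite ?expr2// => /negP.
    by rewrite inE => Dx; rewrite h0 ?mulr0// => /KD.
  rewrite integral_next; [|exact: sq_meas|exact: sq0].
  apply: eq_integral => y _; rewrite [RHS]integral_mkcond.
  apply: eq_integral => t _; rewrite patchE; case: ifPn => // /negP.
  rewrite inE /I/= in_itv/= -ler_norml => /negP; rewrite -ltNge => /ltW Mt.
  by rewrite h0 ?expr0n//; exact: KM.
rewrite -lee_fin EFinM (full _ test_L2 cphi K0) (full _ (test_partial_L2 0) cdphi dK0).
have mfull (h : E -> R) : continuous h -> measurable_fun setT (fun y =>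
    \int[@lebesgue_measure R]_(t in I) (h (glue_coor (t, y)) ^+ 2)%:E)%E.
  move=> ch; pose h' (x : E) := if `|x 0 0| <= M then (h x ^+ 2)%:E else 0%E.
  have mh' : measurable_fun setT h'.
    apply: measurable_fun_ifT => //; last exact: sq_meas.
    apply: measurable_fun_ler => //; apply: measurableT_comp => //.
    exact: measurable_coor.
  have h'0 x : (0 <= h' x)%E by rewrite /h'; case: ifP.
  have := measurable_inner_integral mh' h'0.
  congr measurable_fun; apply/funext => y; rewrite [RHS]integral_mkcond.
  apply: eq_integral => t _; rewrite patchE /h' glue_coor0/=.
  by rewrite /I mem_setE in_itv/= -ler_norml.
rewrite -ge0_integralZl_EFin//; last 3 first.
- by move=> y _; exact: integral_ge0.
- exact: mfull.
- by rewrite mulr_ge0 ?exprn_ge0 ?(ltW M0).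
apply: ge0_le_integral => //.
- by move=> y _; exact: integral_ge0.
- exact: mfull.
- by apply: measurable_funeM; exact: mfull.
- move=> y _; apply: poincare_line => //.
  + by move=> t; apply: (continuous_comp (@continuous_glue_coor y t)); exact: cphi.
  + by move=> t; apply: (continuous_comp (@continuous_glue_coor y t)); exact: cdphi.
  + exact: is_derive_glue.
  + by move=> t Mt; rewrite K0//; exact: KM.
Qed.

End test.
End sobolev_domain.

(** * The energy space *)

Lemma discriminant_le (R : realFieldType) (A B C : R) : 0 <= A ->
  (forall a, 0 <= a ^+ 2 * A + 2 * a * B + C) -> B ^+ 2 <= A * C.
Proof.
rewrite le_eqVlt => /predU1P[<-|A0] h.
  have [->|B0] := eqVneq B 0; first by rewrite expr0n/= mul0r.
  have := h (- (C + 1) / (2 * B)).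
  have -> : 2 * (- (C + 1) / (2 * B)) * B = - (C + 1) by field.
  by rewrite mulr0 add0r; lra.
have := h (- B / A).
have -> : (- B / A) ^+ 2 * A + 2 * (- B / A) * B + C = (A * C - B ^+ 2) / A.
  by field; rewrite gt_eqF.
by rewrite pmulr_lge0 ?invr_gt0// subr_ge0.
Qed.

Section L2_more.
Context d (T : measurableType d) (R : realType).
Variables (mu : {measure set T -> \bar R}) (D : set T).
Hypothesis mD : measurable D.
Implicit Types f g h : T -> R.
Local Notation dot := (L2dot mu D).
Local Notation L2 := (L2 mu D).

Lemma L2_cst0 : L2 (cst 0).
Proof.
split; first exact: measurable_cst.
by under eq_fun do rewrite expr0n/=; exact: integrable0.
Qed.

Lemma L2dotBl f g h : L2 f -> L2 g -> L2 h ->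
  dot (fun x => f x - g x) h = dot f h - dot g h.
Proof.
move=> Lf Lg Lh; have := L2dot_linear mD (-1) Lg Lf Lh.
under [X in L2dot _ _ X]eq_fun do rewrite mulN1r addrC.
by move=> ->; rewrite mulN1r addrC.
Qed.

Lemma L2dot_CS f g : L2 f -> L2 g -> dot f g ^+ 2 <= dot f f * dot g g.
Proof.
move=> Lf Lg; apply: discriminant_le; first exact: L2dot_ge0.
move=> a; have Lh := L2_linear mD a Lf Lg.
have := L2dot_ge0 mu D (fun x => a * f x + g x).
rewrite (L2dot_linear mD a Lf Lg Lh) [dot f _]L2dotC [dot g _]L2dotC.
rewrite (L2dot_linear mD a Lf Lg Lf) (L2dot_linear mD a Lf Lg Lg) [dot g f]L2dotC.
suff -> : forall x y z : R, a * (a * x + y) + (a * y + z) = a ^+ 2 * x + 2 * a * y + z by [].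
by move=> x y z; ring.
Qed.

Lemma L2dot_linear_le a f g : L2 f -> L2 g ->
  dot (fun x => a * f x + g x) (fun x => a * f x + g x) <=
  2 * a ^+ 2 * dot f f + 2 * dot g g.
Proof.
move=> Lf Lg.
have i1 := L2_mul_integrable mD Lf Lf; have i2 := L2_mul_integrable mD Lg Lg.
rewrite -!RintegralZl// -RintegralD//; [|exact: integrable_realZ..].
apply: le_Rintegral => //.
- by apply: L2_mul_integrable => //; exact: L2_linear.
- by apply: integrable_realD => //; exact: integrable_realZ.
- by move=> x _; have := sqr_ge0 (a * f x - g x); rewrite !expr2; nra.
Qed.

End L2_more.

Section H10_space.
Context {R : realType} {n : nat}.
Local Notation d := n.+1.
Local Notation E := 'rV[R]_d.
Local Notation leb := (lebesgue_rV R d).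
Variable D : set E.
Hypothesis oD : open D.
Hypothesis bD : bounded_set D.
Let mD : measurable D := domain_measurable oD.
Local Notation dot := (L2dot leb D).
Local Notation L2 := (L2 leb D).
Implicit Types (f g : E -> R) (v w : @sobolev_fun R d).

Lemma Lp_norm2E f : Lp_norm 2%:E D f = ((\int[leb]_(x in D) (f x ^+ 2)%:E) `^ 2^-1)%E.
Proof.
rewrite /Lp_norm unlock; congr (_ `^ _)%E; rewrite [RHS]integral_mkcond.
apply: eq_integral => x _; rewrite /= !patchE; case: ifP => _ /=.
  by rewrite powR_mulrn// real_normK// num_real.
by rewrite normr0 powR0.
Qed.

Lemma in_Lp2P f : in_Lp 2%:E D f <-> L2 f.
Proof.
split=> [[mf]|[mf /integrableP[mf2 f2]]].
  rewrite Lp_norm2E => foo; split=> //; apply/integrableP; split.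
    by apply/measurable_EFinP; exact: measurable_funX.
  under eq_integral => x _ do rewrite /= ger0_norm ?sqr_ge0//.
  rewrite ltNge leye_eq; apply/negP => /eqP foo'; move: foo.
  by rewrite foo' poweRyr ?invr_neq0// ltxx.
split=> //; rewrite Lp_norm2E; apply: poweR_lty; move: f2.
by under eq_integral => x _ do rewrite /= ger0_norm ?sqr_ge0//.
Qed.

Lemma Lp_norm2_sqrt f : L2 f -> Lp_norm 2%:E D f = (Num.sqrt (dot f f))%:E.
Proof.
move=> Lf; rewrite Lp_norm2E -powR12_sqrt ?L2dot_ge0// -poweR_EFin.
by rewrite (L2dot_EFin mD)//; under [in RHS]eq_integral do rewrite -expr2.
Qed.

Definition grad_dot v w : R := \sum_i dot (v.2 i) (w.2 i).

Definition gradL2 v : Prop := forall i, L2 (v.2 i).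

Lemma grad_dot_ge0 v : 0 <= grad_dot v v.
Proof. by apply: sumr_ge0 => i _; exact: L2dot_ge0. Qed.

Lemma grad_normE v : gradL2 v -> grad_norm D v = (Num.sqrt (grad_dot v v))%:E.
Proof.
move=> Lv; pose G x := Num.sqrt (\sum_i (v.2 i x) ^+ 2).
have G2 x : G x ^+ 2 = \sum_i (v.2 i x) ^+ 2.
  by rewrite sqr_sqrtr// sumr_ge0// => i _; exact: sqr_ge0.
have mS : measurable_fun D (fun x => \sum_i (v.2 i x) ^+ 2).
  apply: measurable_sum => i; apply: measurable_funX.
  by case: (Lv i).
have iS : leb.-integrable D (EFin \o (fun x => \sum_i (v.2 i x) ^+ 2)).
  have := @integrable_sum _ _ _ leb D mD _ (index_enum 'I_d) xpredT
    (fun i x => ((v.2 i x) ^+ 2)%:E).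
  move=> /(_ (fun i _ => (Lv i).2)).
  by apply: eq_integrable => // x _; rewrite sumEFin.
have LG : L2 G.
  split; last by under eq_fun do rewrite G2.
  apply: measurableT_comp => //; apply: continuous_measurable_fun.
    exact: sqrt_continuous.
rewrite /grad_norm Lp_norm2_sqrt//; congr (Num.sqrt _)%:E.
apply: EFin_inj; rewrite (L2dot_EFin mD)// -sumEFin.
under eq_bigr do rewrite (L2dot_EFin mD (Lv _) (Lv _)).
rewrite -integral_sum//; last by move=> i; exact: L2_mul_integrable (Lv i) (Lv i).
by apply: eq_integral => x _; rewrite -expr2 G2 sumEFin; congr EFin; apply: eq_bigr.
Qed.

End H10_space.

Section H10_complete.
Context {R : realType} {n : nat}.
Local Notation d := n.+1.
Local Notation E := 'rV[R]_d.
Local Notation leb := (lebesgue_rV R d).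
Variable D : set E.
Hypothesis oD : open D.
Hypothesis bD : bounded_set D.
Let mD : measurable D := domain_measurable oD.
Local Notation dot := (L2dot leb D).
Local Notation L2 := (L2 leb D).
Implicit Types (f g : E -> R) (v w : @sobolev_fun R d).

Definition h1_dot v w : R := dot v.1 w.1 + grad_dot D v w.

Lemma dot_le_grad v i : dot (v.2 i) (v.2 i) <= grad_dot D v v.
Proof.
by rewrite /grad_dot (bigD1 i)//= lerDl sumr_ge0// => j _; exact: L2dot_ge0.
Qed.

Definition sobL2 v : Prop := L2 v.1 /\ gradL2 D v.

Lemma sobL2_classical phi : test_function D phi -> sobL2 (classical_sobolev phi).
Proof.
move=> tphi; split; first exact: (test_L2 oD bD tphi).
by move=> i; exact: (test_partial_L2 oD bD tphi).
Qed.

Lemma gradL2_linear a v w : gradL2 D v -> gradL2 D w -> gradL2 D (a *: v + w).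
Proof. by move=> Lv Lw i; exact: (L2_linear mD a (Lv i) (Lw i)). Qed.

Lemma sobL2_linear a v w : sobL2 v -> sobL2 w -> sobL2 (a *: v + w).
Proof.
move=> [Lv gv] [Lw gw]; split; last exact: gradL2_linear.
exact: (L2_linear mD a Lv Lw).
Qed.

Lemma subr_linear (V : lmodType R) (v w : V) : v - w = (-1) *: w + v.
Proof. by rewrite scaleN1r addrC. Qed.

Lemma sobL2B v w : sobL2 v -> sobL2 w -> sobL2 (v - w).
Proof. by move=> Lv Lw; rewrite subr_linear; exact: sobL2_linear. Qed.

Lemma grad_dot_linear_le a v w : gradL2 D v -> gradL2 D w ->
  grad_dot D (a *: v + w) (a *: v + w) <=
  2 * a ^+ 2 * grad_dot D v v + 2 * grad_dot D w w.
Proof.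
move=> Lv Lw; rewrite /grad_dot !mulr_sumr -big_split/=; apply: ler_sum => i _.
exact: (L2dot_linear_le mD a (Lv i) (Lw i)).
Qed.

Lemma h1_dot_linear_le a v w : sobL2 v -> sobL2 w ->
  h1_dot (a *: v + w) (a *: v + w) <= 2 * a ^+ 2 * h1_dot v v + 2 * h1_dot w w.
Proof.
move=> [Lv gv] [Lw gw]; rewrite /h1_dot.
have := grad_dot_linear_le a gv gw; have := L2dot_linear_le mD a Lv Lw.
set x := dot _ _; set y := grad_dot _ _ _; rewrite -[X in X + y]/x; lra.
Qed.

Lemma weak_derivativeP i f g : L2 f -> L2 g ->
  weak_derivative D i f g <->
  (forall phi, test_function D phi -> dot f (partial i phi) = - dot g phi).
Proof.
move=> Lf Lg; split=> h phi tphi; have := h phi tphi;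
  rewrite -(L2dot_EFin mD Lf (test_partial_L2 oD bD tphi i));
  rewrite -(L2dot_EFin mD Lg (test_L2 oD bD tphi)); first by case.
by move=> ->.
Qed.

Lemma sqrt_lt_sqr (x e : R) : 0 < e -> 0 <= x -> (Num.sqrt x < e) = (x < e ^+ 2).
Proof.
move=> e0 x0; rewrite -[in RHS](sqr_sqrtr x0) ltr_pXn2r// ?nnegrE ?sqrtr_ge0//.
exact: ltW.
Qed.

(** The working form of [H10]: real inner products replace extended integrals, and one squared H1
    distance replaces two norms. *)
Lemma H10P v : H10 D v <->
  [/\ sobL2 v,
      forall i phi, test_function D phi ->
        dot v.1 (partial i phi) = - dot (v.2 i) phi &
      forall e, 0 < e -> exists2 phi, test_function D phi &
        h1_dot (v - classical_sobolev phi) (v - classical_sobolev phi) < e].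
Proof.
have approx phi e : sobL2 v -> 0 < e -> test_function D phi ->
    ((Lp_norm 2%:E D (v - classical_sobolev phi)%R.1 < e%:E)%E /\
     (grad_norm D (v - classical_sobolev phi)%R < e%:E)%E) <->
    (dot (v - classical_sobolev phi)%R.1 (v - classical_sobolev phi)%R.1 < e ^+ 2 /\
     grad_dot D (v - classical_sobolev phi) (v - classical_sobolev phi) < e ^+ 2).
  move=> Lv e0 tphi; have [L1 L2] := sobL2B Lv (sobL2_classical tphi).
  rewrite (Lp_norm2_sqrt oD L1) (grad_normE oD L2) !lte_fin.
  by rewrite !sqrt_lt_sqr ?L2dot_ge0 ?grad_dot_ge0.
split=> [[[L1 L2d] ap]|[[L1 L2g] wd ap]].
  have L1' : L2 v.1 by apply/in_Lp2P.
  have L2' : gradL2 D v by move=> i; apply/in_Lp2P; case: (L2d i).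
  split=> // [i|e e0].
    by apply/weak_derivativeP => //; case: (L2d i).
  (* The square of this radius is at most e / 2, so the two squared distances add up to less than
     e. *)
  have e1 : 0 < Num.min 1 (e / 2) by rewrite lt_min ltr01 divr_gt0.
  have [phi [tphi a1 a2]] := ap _ e1; exists phi => //.
  have [/(_ (conj a1 a2))[b1 b2] _] := approx phi _ (conj L1' L2') e1 tphi.
  have : (Num.min 1 (e / 2)) ^+ 2 <= e / 2.
    rewrite expr2 (le_trans (ler_piMl _ _)) ?(ltW e1)// ?ge_min ?lexx ?orbT//.
  by rewrite /h1_dot; move: b1 b2; lra.
have Lv : sobL2 v by [].
split.
  split; first by apply/in_Lp2P.
  move=> i; split; first by apply/in_Lp2P => //; exact: L2g.
  by apply/weak_derivativeP => //; exact: wd.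
move=> e e0; have e2 : 0 < e ^+ 2 by rewrite exprn_gt0.
have [phi tphi he] := ap _ e2; exists phi.
have [_] := approx phi e Lv e0 tphi; case.
  have := L2dot_ge0 leb D (v - classical_sobolev phi)%R.1.
  have := grad_dot_ge0 D (v - classical_sobolev phi).
  by move: he; rewrite /h1_dot => *; split; lra.
by [].
Qed.

Lemma H10_sobL2 v : H10 D v -> sobL2 v. Proof. by case/H10P. Qed.
Lemma H10_gradL2 v : H10 D v -> gradL2 D v. Proof. by case/H10_sobL2. Qed.

Lemma test0 : test_function D (cst 0).
Proof.
have p0 (s : seq 'I_d) : foldr partial (cst 0 : E -> R) s = cst 0.
  elim: s => //= i s ->; apply/funext => x.
  by rewrite /partial derive_cst.
split.
  move=> s; rewrite p0; split; first exact: cst_continuous.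
  by move=> i x; exact: derivable_cst.
by exists set0; split=> //; exact: compact0.
Qed.

Lemma H10_0 : H10 D 0.
Proof.
have dot0 (f : E -> R) : dot 0 f = 0.
  rewrite /L2dot -[RHS](_ : \int[leb]_(x in D) (0 : R) = 0).
    by apply: eq_Rintegral => x _; rewrite mul0r.
  by rewrite Rintegral_cst// mul0r.
apply/H10P; split.
- by split=> [|i]; exact: L2_cst0.
- by move=> i phi _; rewrite !dot0 oppr0.
- move=> e e0; exists (cst 0); first exact: test0.
  rewrite (_ : 0 - _ = 0 :> @sobolev_fun R d).
    by rewrite /h1_dot /grad_dot dot0 big1 ?addr0// => i _; exact: dot0.
  rewrite sub0r -[RHS]oppr0; congr (- _); congr pair.
  by apply/funext => i; apply/funext => x; rewrite /partial derive_cst.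
Qed.

Lemma H10_linear a v w : H10 D v -> H10 D w -> H10 D (a *: v + w).
Proof.
move=> /H10P[Lv dv av] /H10P[Lw dw aw]; apply/H10P; split.
- exact: sobL2_linear.
- move=> i phi tphi.
  have [[Lv1 Lv2] [Lw1 Lw2]] := (Lv, Lw).
  have Lp := test_L2 oD bD tphi; have Ldp := test_partial_L2 oD bD tphi i.
  rewrite (L2dot_linear mD a Lv1 Lw1 Ldp) (L2dot_linear mD a (Lv2 i) (Lw2 i) Lp).
  by rewrite dv// dw//; ring.
- move=> e e0; pose e' := e / (2 * a ^+ 2 + 2).
  have c0 : 0 < 2 * a ^+ 2 + 2 by have := sqr_ge0 a; lra.
  have e'0 : 0 < e' by rewrite divr_gt0.
  have [p tp hp] := av _ e'0; have [r tr hr] := aw _ e'0.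
  exists (fun x => a * p x + r x); first exact: test_function_linear.
  have [[sp _] [sr _]] := (tp, tr).
  have -> : a *: v + w - classical_sobolev (fun x => a * p x + r x) =
      a *: (v - classical_sobolev p) + (w - classical_sobolev r).
    rewrite scalerBr addrACA -opprD; congr (_ - _); congr pair.
    apply/funext => i; apply/funext => x.
    by case: (smooth_linear a sp sr) => _ ->.
  have Lp := sobL2B Lv (sobL2_classical tp); have Lr := sobL2B Lw (sobL2_classical tr).
  apply: le_lt_trans (h1_dot_linear_le a Lp Lr) _.
  have -> : e = 2 * a ^+ 2 * e' + 2 * e'.
    by rewrite /e' -mulrDl; field; rewrite gt_eqF.
  have := sqr_ge0 a; move: hp hr; set x := h1_dot _ _; set y := h1_dot _ _.
  by move: (a ^+ 2) => b *; nra.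
Qed.

Lemma H10B v w : H10 D v -> H10 D w -> H10 D (v - w).
Proof. by move=> Hv Hw; rewrite subr_linear; exact: H10_linear. Qed.

(** Density of test functions. Splitting v = (v - phi) + phi and then the derivative of phi costs a
    factor 2 each time, which turns 4 M^2 into 16 M^2 and leaves (2 + 16 M^2) times the squared
    approximation error. *)
Lemma H10_poincare : exists2 C : R, 0 < C &
  forall v, H10 D v -> dot v.1 v.1 <= C * grad_dot D v v.
Proof.
have [M M0 MD] := domain_coor_bound bD.
have M2 : 0 < M ^+ 2 by rewrite exprn_gt0.
exists (16 * M ^+ 2); first by rewrite mulr_gt0.
move=> v /H10P[[Lv gv] _ av].
apply: (@le_trans _ _ (16 * M ^+ 2 * dot (v.2 0) (v.2 0))); last first.
  by rewrite ler_pM2l ?mulr_gt0// dot_le_grad.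
apply/ler_addgt0Pr => e e0.
pose e' := e / (2 + 16 * M ^+ 2).
have c0 : 0 < 2 + 16 * M ^+ 2 by lra.
have e'0 : 0 < e' by rewrite divr_gt0.
have [phi tphi hphi] := av _ e'0.
have Lp := test_L2 oD bD tphi; have Ldp := test_partial_L2 oD bD tphi 0.
have := L2dot_linear_le mD 1 (L2B mD Lv Lp) Lp.
have := L2dot_linear_le mD (-1) (L2B mD (gv 0) Ldp) (gv 0).
under [X in L2dot _ _ X _]eq_fun do rewrite mulN1r opprB subrK.
under [X in L2dot _ _ _ X]eq_fun do rewrite mulN1r opprB subrK.
under [X in L2dot _ _ X _ <= 2 * 1 ^+ 2 * _ + _]eq_fun do rewrite mul1r subrK.
under [X in L2dot _ _ _ X <= 2 * 1 ^+ 2 * _ + _]eq_fun do rewrite mul1r subrK.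
have := test_poincare oD bD tphi M0 MD.
have : dot (v - classical_sobolev phi)%R.1 (v - classical_sobolev phi)%R.1 < e'.
  by apply: le_lt_trans hphi; rewrite lerDl grad_dot_ge0.
have : dot ((v - classical_sobolev phi)%R.2 0) ((v - classical_sobolev phi)%R.2 0) < e'.
  apply: le_lt_trans hphi; apply: (le_trans (dot_le_grad _ 0)).
  by rewrite lerDr L2dot_ge0.
have -> : e = (2 + 16 * M ^+ 2) * e' by rewrite /e'; field; rewrite gt_eqF.
rewrite sqrrN !expr1n.
rewrite -[(v - _).1]/(fun x => v.1 x - phi x).
rewrite -[(v - _).2 0]/(fun x => v.2 0 x - partial 0 phi x).
move: (M ^+ 2) M2 => K K0.
set a1 := dot (fun x => v.2 0 x - _) _; set a2 := dot (fun x => v.1 x - _) _.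
set b1 := dot phi phi; set b2 := dot (partial 0 phi) _.
set c1 := dot (v.2 0) _; set c2 := dot v.1 _ => *; nra.
Qed.

(** The Poincare inequality makes the functions Cauchy along with their gradients, so all components
    have L2 limits. The weak derivative relation passes to the limit by Cauchy-Schwarz, and
    approximation by test functions is inherited from a late member of the sequence. *)
Lemma H10_complete (v_ : nat -> @sobolev_fun R d) :
  (forall k, H10 D (v_ k)) ->
  (forall e, 0 < e -> exists N, forall k l, (N <= k)%N -> (N <= l)%N ->
    grad_dot D (v_ k - v_ l) (v_ k - v_ l) <= e) ->
  exists2 v, H10 D v & forall e, 0 < e -> exists N, forall k, (N <= k)%N ->
    grad_dot D (v_ k - v) (v_ k - v) <= e.
Proof.
move=> Hv cv; have [C C0 CP] := H10_poincare.
have [f Lf fl] : exists2 f : E -> R, L2 f & forall e, 0 < e -> exists N,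
    forall k, (N <= k)%N -> dot (fun x => (v_ k).1 x - f x) (fun x => (v_ k).1 x - f x) <= e.
  apply: (L2_complete mD) => [k|e e0]; first by case: (H10_sobL2 (Hv k)).
  have [N NP] := cv _ (divr_gt0 e0 C0); exists N => k l Nk Nl.
  apply: le_trans (CP _ (H10B (Hv k) (Hv l))) _.
  by rewrite mulrC -ler_pdivlMr// NP.
have /choice[g gP] : forall i, exists g : E -> R, L2 g /\ forall e, 0 < e -> exists N,
    forall k, (N <= k)%N ->
      dot (fun x => (v_ k).2 i x - g x) (fun x => (v_ k).2 i x - g x) <= e.
  move=> i.
  have [|e e0|g Lg gl] := @L2_complete _ _ _ leb D mD (fun k => (v_ k).2 i).
  - by move=> k; have := H10_gradL2 (Hv k); exact.
  - have [N NP] := cv e e0; exists N => k l Nk Nl.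
    exact: le_trans (dot_le_grad (v_ k - v_ l) i) (NP k l Nk Nl).
  - by exists g.
pose v : @sobolev_fun R d := (f, g).
have Lv : sobL2 v by split=> // i; case: (gP i).
have gl e : 0 < e -> exists N, forall k, (N <= k)%N ->
    grad_dot D (v_ k - v) (v_ k - v) <= e.
  move=> e0; have e'0 : 0 < e / d%:R by rewrite divr_gt0.
  have /choice[N NP] : forall i, exists N, forall k, (N <= k)%N ->
      dot (fun x => (v_ k).2 i x - g i x) (fun x => (v_ k).2 i x - g i x) <= e / d%:R.
    by move=> i; have [_] := gP i; exact.
  exists (\max_i N i)%N => k Nk; rewrite /grad_dot.
  rewrite -[leRHS](divfK (_ : d%:R != 0)) ?pnatr_eq0// mulr_natr.
  rewrite -[X in _ *+ X]card_ord -sumr_const; apply: ler_sum => i _.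
  by apply: NP; rewrite (leq_trans _ Nk)// leq_bigmax.
exists v => //; apply/H10P; split=> // [i phi tphi|e e0].
  have Lp := test_L2 oD bD tphi; have Ldp := test_partial_L2 oD bD tphi i.
  have [Lg gil] := gP i.
  apply/eqP; rewrite -subr_eq0 opprK -sqrf_eq0 -normr_le0 ger0_norm ?sqr_ge0//.
  apply/ler_addgt0Pr => e e0; rewrite add0r.
  pose c := 2 * dot (partial i phi) (partial i phi) + 2 * dot phi phi + 1.
  have c0 : 0 < c.
    have := L2dot_ge0 leb D phi; have := L2dot_ge0 leb D (partial i phi).
    by rewrite /c => *; lra.
  have ec : 0 < e / c by rewrite divr_gt0.
  have [N1 N1P] := fl _ ec; have [N2 N2P] := gil _ ec.
  pose k := maxn N1 N2.
  have [[Lk Lgk] wk _] := (H10P (v_ k)).1 (Hv k).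
  have h1 := N1P k (leq_maxl _ _); have h2 := N2P k (leq_maxr _ _).
  have cs1 := L2dot_CS mD (L2B mD Lk Lf) Ldp.
  have cs2 := L2dot_CS mD (L2B mD (Lgk i) Lg) Lp.
  rewrite (L2dotBl mD Lk Lf Ldp) wk// in cs1.
  rewrite (L2dotBl mD (Lgk i) Lg Lp) in cs2.
  have et : e = e / c * (2 * dot (partial i phi) (partial i phi) + 2 * dot phi phi + 1).
    by rewrite -/c divfK// gt_eqF.
  rewrite [leRHS]et; move: h1 h2 cs1 cs2.
  have := L2dot_ge0 leb D phi; have := L2dot_ge0 leb D (partial i phi).
  have := L2dot_ge0 leb D (fun x => (v_ k).1 x - f x).
  have := L2dot_ge0 leb D (fun x => (v_ k).2 i x - g i x).
  rewrite -[v.1]/f -[v.2 i]/(g i).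
  set A := dot (fun x => (v_ k).2 i x - _) _; set B := dot (fun x => (v_ k).1 x - _) _.
  set P := dot (partial i phi) _; set Q := dot phi phi.
  set X := dot f _; set Y := dot (g i) _; set Z := dot ((v_ k).2 i) _.
  move=> A0 B0 P0 Q0 h1 h2 cs1 cs2.
  have k1 : B * P <= e / c * P by rewrite ler_wpM2r.
  have k2 : A * Q <= e / c * Q by rewrite ler_wpM2r.
  have := sqr_ge0 ((- Z - X) - (Z - Y)); move: (ltW ec); move: (e / c) h1 h2 k1 k2.
  move=> t h1 h2 k1 k2 t0; rewrite !expr2 in cs1 cs2 *; nra.
have e4 : 0 < e / 8 by lra.
have [N1 N1P] := fl _ e4; have [N2 N2P] := gl _ e4.
pose k := maxn N1 N2.
have h1 := N1P k (leq_maxl _ _); have h2 := N2P k (leq_maxr _ _).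
have [Lk _ ak] := (H10P (v_ k)).1 (Hv k).
have [phi tphi hphi] := ak _ e4; exists phi => //.
have Lkp := sobL2B Lk (sobL2_classical tphi).
have -> : v - classical_sobolev phi =
    (-1) *: (v_ k - v) + (v_ k - classical_sobolev phi).
  by rewrite scaleN1r opprB addrA subrK.
apply: le_lt_trans (h1_dot_linear_le (-1) (sobL2B Lk Lv) Lkp) _.
rewrite sqrrN expr1n; move: hphi; set x := h1_dot _ _ => hx.
have : h1_dot (v_ k - v) (v_ k - v) <= e / 8 + e / 8 by exact: lerD.
by set y := h1_dot (v_ k - v) _ => *; lra.
Qed.

End H10_complete.

(** * Parametric families of bilinear forms *)

Lemma cvg_sumr (R : realType) (T I : Type) (G : set_system T) {FG : Filter G}
    (r : seq I) (g : I -> T -> R) (l : I -> R) :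
  (forall i, g i @ G --> l i) ->
  (fun t => \sum_(i <- r) g i t) @ G --> \sum_(i <- r) l i.
Proof.
move=> gl; elim: r => [|i r IH].
  by rewrite big_nil; under eq_fun do rewrite big_nil; exact: cvg_cst.
by rewrite big_cons; under eq_fun do rewrite big_cons; exact: cvgD.
Qed.

Section parametric_form.
Context {R : realType} {V : lmodType R}.
Variables (H : set V) (b0 : V -> V -> R) (b : nat -> V -> V -> R).
Variables (c : nat -> V -> R) (rho : nat -> R) (theta : R).

Hypothesis H_zero : H 0.
Hypothesis H_linear : forall a v w, H v -> H w -> H (a *: v + w).
Hypothesis b0_linear : forall a u v w, H u -> H v -> H w ->
  b0 (a *: u + v) w = a * b0 u w + b0 v w.
Hypothesis b0_sym : forall v w, b0 v w = b0 w v.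
Hypothesis b0_ge0 : forall v, H v -> 0 <= b0 v v.
Hypothesis b_linear : forall j a u v w, H u -> H v -> H w ->
  b j (a *: u + v) w = a * b j u w + b j v w.
Hypothesis b_sym : forall j v w, b j v w = b j w v.
Hypothesis rho_gt1 : forall j, 1 < rho j.
Hypothesis theta01 : 0 <= theta < 1.
(** In the application [c j v] is the energy of v with weight rho_j |psi_j|. This bound is then the
    pointwise inequality between products and squares, and [c_sum] is the smallness assumption on
    the psi_j. *)
Hypothesis bc : forall j v w, H v -> H w ->
  rho j * `|b j v w| <= 2^-1 * (c j v + c j w).
Hypothesis c_ge0 : forall j v, H v -> 0 <= c j v.
Hypothesis c_sum : forall J v, H v ->
  \sum_(0 <= j < J) c j v <= theta * b0 v v.

Definition nrm v : R := Num.sqrt (b0 v v).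

Lemma H_scale a v : H v -> H (a *: v).
Proof. by move=> Hv; rewrite -[_ *: _]addr0; exact: H_linear. Qed.

Lemma H_add v w : H v -> H w -> H (v + w).
Proof. by move=> Hv Hw; rewrite -[v]scale1r; exact: H_linear. Qed.

Lemma H_sub v w : H v -> H w -> H (v - w).
Proof. by move=> Hv Hw; rewrite addrC -scaleN1r; exact: H_linear. Qed.

Lemma H_sum I (r : seq I) (P : pred I) (F : I -> V) :
  (forall i, P i -> H (F i)) -> H (\sum_(i <- r | P i) F i).
Proof. by move=> HF; elim/big_ind: _ => // v w; exact: H_add. Qed.

Section bilinear.
Variable B : V -> V -> R.
Hypothesis B_linear : forall a u v w, H u -> H v -> H w ->
  B (a *: u + v) w = a * B u w + B v w.

Lemma form_add_l u v w : H u -> H v -> H w -> B (u + v) w = B u w + B v w.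
Proof. by move=> Hu Hv Hw; rewrite -{1}[u]scale1r B_linear// mul1r. Qed.

Lemma form_zero w : H w -> B 0 w = 0.
Proof.
move=> Hw; apply: (addrI (B 0 w)).
by rewrite -form_add_l// !addr0.
Qed.

Lemma form_scale_l a v w : H v -> H w -> B (a *: v) w = a * B v w.
Proof. by move=> Hv Hw; rewrite -[a *: v]addr0 B_linear// form_zero// addr0. Qed.

Lemma form_sub_l u v w : H u -> H v -> H w -> B (u - v) w = B u w - B v w.
Proof. by move=> Hu Hv Hw; rewrite addrC -scaleN1r B_linear// mulN1r addrC. Qed.

Lemma form_sum_l I (r : seq I) (F : I -> V) w : (forall i, H (F i)) -> H w ->
  B (\sum_(i <- r) F i) w = \sum_(i <- r) B (F i) w.
Proof.
move=> HF Hw; elim: r => [|i r IH]; first by rewrite !big_nil form_zero.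
by rewrite !big_cons form_add_l// ?IH//; exact: H_sum.
Qed.

End bilinear.

Lemma nrm_ge0 v : 0 <= nrm v. Proof. exact: sqrtr_ge0. Qed.

Lemma nrm_sqr v : H v -> nrm v ^+ 2 = b0 v v.
Proof. by move=> Hv; rewrite sqr_sqrtr ?b0_ge0. Qed.

Lemma nrm0 : nrm 0 = 0.
Proof. by rewrite /nrm form_zero ?sqrtr0. Qed.

Lemma nrm_scale a v : H v -> nrm (a *: v) = `|a| * nrm v.
Proof.
move=> Hv; rewrite /nrm (form_scale_l b0_linear) ?H_scale//; last exact: H_scale.
rewrite b0_sym (form_scale_l b0_linear)// mulrA -expr2.
by rewrite sqrtrM ?sqr_ge0// sqrtr_sqr.
Qed.

Lemma b0_norm_le v w : H v -> H w -> `|b0 v w| <= nrm v * nrm w.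
Proof.
move=> Hv Hw.
have : b0 v w ^+ 2 <= b0 v v * b0 w w.
  apply: discriminant_le => [|a]; first exact: b0_ge0.
  have Hvw := H_linear a Hv Hw.
  have := b0_ge0 Hvw; rewrite b0_linear// [b0 v _]b0_sym [b0 w _]b0_sym.
  rewrite !b0_linear// [b0 w v]b0_sym.
  suff -> : forall x y z : R,
    a * (a * x + y) + (a * y + z) = a ^+ 2 * x + 2 * a * y + z by [].
  by move=> x y z; ring.
rewrite -!nrm_sqr// -exprMn -(@ler_sqr _ `|_|) ?nnegrE ?mulr_ge0 ?nrm_ge0//.
by rewrite real_normK ?num_real.
Qed.

Lemma nrm_triangle v w : H v -> H w -> nrm (v + w) <= nrm v + nrm w.
Proof.
move=> Hv Hw; rewrite -(@ler_sqr _ (nrm _)) ?nnegrE ?addr_ge0 ?nrm_ge0//.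
rewrite sqrrD !nrm_sqr//; last exact: H_add.
have Hvw := H_add Hv Hw.
rewrite (form_add_l b0_linear)// [b0 v _]b0_sym [b0 w _]b0_sym.
rewrite !(form_add_l b0_linear)// [b0 w v]b0_sym.
by have := le_trans (ler_norm _) (b0_norm_le Hv Hw); rewrite mulr2n; lra.
Qed.

Lemma nrmN v : H v -> nrm (- v) = nrm v.
Proof. by move=> Hv; rewrite -scaleN1r nrm_scale// normrN1 mul1r. Qed.

Lemma nrm_distC v w : H v -> H w -> nrm (v - w) = nrm (w - v).
Proof. by move=> Hv Hw; rewrite -nrmN ?opprB//; exact: H_sub. Qed.

Lemma nrm_sum_le I (r : seq I) (F : I -> V) : (forall i, H (F i)) ->
  nrm (\sum_(i <- r) F i) <= \sum_(i <- r) nrm (F i).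
Proof.
move=> HF; elim: r => [|i r IH]; first by rewrite !big_nil nrm0.
rewrite !big_cons (le_trans (nrm_triangle _ _))// ?lerD2l//; exact: H_sum.
Qed.

Lemma rho_gt0 j : 0 < rho j. Proof. exact: lt_trans (rho_gt1 j). Qed.

(* Normalizing v and w turns the quadratic bound into a product bound. *)
Lemma b_sum_le J v w : H v -> H w ->
  \sum_(0 <= j < J) rho j * `|b j v w| <= theta * (nrm v * nrm w).
Proof.
have /andP[th0 _] := theta01; move=> Hv Hw.
(* The shift by [e] keeps the normalizing factors positive when a norm vanishes. *)
suff h e : 0 < e -> \sum_(0 <= j < J) rho j * `|b j v w| <=
    theta * ((nrm v + e) * (nrm w + e)).
  apply/ler_addgt0Pr => e e0.
  have n0 := nrm_ge0 v; have m0 := nrm_ge0 w.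
  pose x := Num.min 1 (e / (nrm v + nrm w + 1)).
  have d0 : 0 < nrm v + nrm w + 1 by lra.
  have x0 : 0 < x by rewrite lt_min ltr01 divr_gt0.
  have x1 : x <= 1 by rewrite ge_min lexx.
  have xe : x * (nrm v + nrm w + 1) <= e.
    by rewrite -ler_pdivlMr// ge_min lexx orbT.
  apply: le_trans (h x x0) _.
  have hx : (nrm v + x) * (nrm w + x) <= nrm v * nrm w + e by nra.
  apply: le_trans (ler_wpM2l th0 hx) _; rewrite mulrDr lerD2l.
  by have /andP[_ ?] := theta01; rewrite ler_piMl// ltW.
move=> e0.
have n0 : 0 < nrm v + e by rewrite ltr_wpDl ?nrm_ge0.
have m0 : 0 < nrm w + e by rewrite ltr_wpDl ?nrm_ge0.
pose v' := (nrm v + e)^-1 *: v; pose w' := (nrm w + e)^-1 *: w.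
have Hv' : H v' by exact: H_scale.
have Hw' : H w' by exact: H_scale.
have unit_le z : H z -> b0 ((nrm z + e)^-1 *: z) ((nrm z + e)^-1 *: z) <= 1.
  move=> Hz; have z0 : 0 < nrm z + e by rewrite ltr_wpDl ?nrm_ge0.
  rewrite -nrm_sqr; last exact: H_scale.
  rewrite nrm_scale// ger0_norm ?invr_ge0 ?(ltW z0)// expr_le1//.
    by rewrite mulrC ler_pdivrMr// mul1r lerDl ltW.
  by rewrite mulr_ge0 ?invr_ge0 ?nrm_ge0// ltW.
have bE j : b j v w = (nrm v + e) * (nrm w + e) * b j v' w'.
  rewrite /v' (form_scale_l (b_linear j))// [b j v w']b_sym /w'.
  rewrite (form_scale_l (b_linear j))// [b j w v]b_sym.
  by field; rewrite !gt_eqF.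
under eq_bigr => j _.
  rewrite bE normrM ger0_norm; last by rewrite mulr_ge0 ?ltW.
  rewrite mulrCA; over.
rewrite -mulr_sumr mulrC ler_pM2r ?mulr_gt0//.
apply: (@le_trans _ _ (\sum_(0 <= j < J) 2^-1 * (c j v' + c j w'))).
  by apply: ler_sum => j _; exact: bc.
rewrite -mulr_sumr big_split/=.
have h1 := c_sum J Hv'; have h2 := c_sum J Hw'.
have h3 : theta * b0 v' v' <= theta by rewrite ler_piMr// unit_le.
have h4 : theta * b0 w' w' <= theta by rewrite ler_piMr// unit_le.
lra.
Qed.

Lemma b_norm_le j v w : H v -> H w -> `|b j v w| <= nrm v * nrm w.
Proof.
move=> Hv Hw; have := b_sum_le j.+1 Hv Hw.
rewrite big_nat_recr//= => h.
have s0 : 0 <= \sum_(0 <= i < j) rho i * `|b i v w|.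
  by apply: sumr_ge0 => i _; rewrite mulr_ge0// ltW ?rho_gt0.
have n0 : 0 <= nrm v * nrm w by rewrite mulr_ge0 ?nrm_ge0.
have h1 : `|b j v w| <= rho j * `|b j v w| by rewrite ler_peMl// ltW.
have /andP[t0 t1] := theta01.
have h2 : theta * (nrm v * nrm w) <= nrm v * nrm w by rewrite ler_piMl// ltW.
lra.
Qed.

Definition cube (y : nat -> R) : Prop := forall j, `|y j| <= 1.

Definition bser (y : nat -> R) v w : R^nat := series (fun j => y j * b j v w).

Lemma bser_abs_le y J v w : cube y -> H v -> H w ->
  \sum_(0 <= j < J) `|y j * b j v w| <= theta * (nrm v * nrm w).
Proof.
move=> yc Hv Hw; apply: le_trans (b_sum_le J Hv Hw); apply: ler_sum => j _.
by rewrite normrM ler_wpM2r// (le_trans (yc j))// ltW.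
Qed.

Lemma bser_cvg y v w : cube y -> H v -> H w -> cvgn (bser y v w).
Proof.
move=> yc Hv Hw; apply: (@is_cvg_series_bounded _ _ (theta * (nrm v * nrm w))).
by move=> n; exact: bser_abs_le.
Qed.

Definition blim y v w : R := limn (bser y v w).

Lemma blim_linear y a u v w : cube y -> H u -> H v -> H w ->
  blim y (a *: u + v) w = a * blim y u w + blim y v w.
Proof.
move=> yc Hu Hv Hw; rewrite /blim; apply: cvg_lim => //.
have -> : bser y (a *: u + v) w = (fun n => a * bser y u w n + bser y v w n).
  apply/funext => n; rewrite /bser /series/= mulr_sumr -big_split/=.
  by apply: eq_bigr => j _; rewrite b_linear//; ring.
apply: cvgD; last exact: bser_cvg.
by apply: cvgMl_tmp; exact: bser_cvg.
Qed.

Lemma bser_shift y j h v w n :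
  bser (y + h *: unit_seq j) v w n =
  bser y v w n + (if (j < n)%N then h * b j v w else 0).
Proof.
rewrite /bser /series/=.
under eq_bigr => i _ do
  rewrite [(y + _) i]/(y i + h * (i == j)%:R) mulrDl.
rewrite big_split/=; congr (_ + _); case: ifPn => jn.
  rewrite (bigD1_seq j) ?mem_index_iota ?iota_uniq//= eqxx mulr1 big1 ?addr0//.
  by move=> i /negPf ->; rewrite mulr0 mul0r.
rewrite big_seq big1// => i; rewrite mem_index_iota => /andP[_ iN].
case: eqP => [ij|_]; last by rewrite mulr0 mul0r.
by move: jn; rewrite -ij iN.
Qed.

(** The shifted point may leave the cube: only one term of the series changes, so convergence
    persists. *)
Lemma blim_shift y j h v w : cube y -> H v -> H w ->
  blim (y + h *: unit_seq j) v w = blim y v w + h * b j v w.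
Proof.
move=> yc Hv Hw; rewrite {1}/blim; apply: cvg_lim => //.
have -> : bser (y + h *: unit_seq j) v w = (fun n => bser y v w n +
    (if (j < n)%N then h * b j v w else 0)) by apply/funext => n; exact: bser_shift.
apply: cvgD; first exact: bser_cvg.
apply: cvg_near_cst; near=> n; rewrite ifT//.
by near: n; exact: nbhs_infty_gt.
Unshelve. all: by end_near. Qed.

Lemma blim_norm_le y v w : cube y -> H v -> H w ->
  `|blim y v w| <= theta * (nrm v * nrm w).
Proof.
move=> yc Hv Hw; rewrite ler_norml; apply/andP; split.
  apply: limr_ge; first exact: bser_cvg.
  apply: nearW => n; have := le_trans (ler_norm_sum _ _ _) (bser_abs_le n yc Hv Hw).
  by rewrite ler_norml => /andP[].
apply: limr_le; first exact: bser_cvg.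
apply: nearW => n; have := le_trans (ler_norm_sum _ _ _) (bser_abs_le n yc Hv Hw).
by rewrite ler_norml => /andP[].
Qed.

(** Beyond J monotonicity gives 1 <= rho_j / rho_J, so the weighted bound [b_sum_le] gains the
    factor 1/rho_J. *)
Lemma blim_tail y J v w : nondecreasing_seq rho -> cube y -> H v -> H w ->
  `|blim y v w - bser y v w J| <= (rho J)^-1 * (nrm v * nrm w).
Proof.
move=> rnd yc Hv Hw.
have K0 : 0 <= nrm v * nrm w by rewrite mulr_ge0 ?nrm_ge0.
have bd n : (J <= n)%N -> `|bser y v w n - bser y v w J| <= (rho J)^-1 * (nrm v * nrm w).
  move=> Jn; rewrite /bser sub_series_geq//.
  rewrite (le_trans (ler_norm_sum _ _ _))// -ler_pdivrMl ?invr_gt0 ?rho_gt0// invrK.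
  have := b_sum_le n Hv Hw; rewrite (big_cat_nat (n := J))//= => h.
  have s0 : 0 <= \sum_(0 <= i < J) rho i * `|b i v w|.
    by apply: sumr_ge0 => i _; rewrite mulr_ge0// ltW ?rho_gt0.
  have /andP[t0 t1] := theta01.
  have h2 : theta * (nrm v * nrm w) <= nrm v * nrm w by rewrite ler_piMl// ltW.
  rewrite mulr_sumr; apply: (@le_trans _ _ (\sum_(J <= i < n) rho i * `|b i v w|)).
    rewrite big_nat [leRHS]big_nat; apply: ler_sum => i /andP[Ji _].
    rewrite normrM mulrA ler_wpM2r//.
    rewrite -[leRHS]mulr1 ler_pM//; [exact: ltW (rho_gt0 _)|exact: rnd].
  lra.
have cv : bser y v w n - bser y v w J @[n --> \oo] --> blim y v w - bser y v w J.
  by apply: cvgB; [exact: bser_cvg|exact: cvg_cst].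
have cn : `|bser y v w n - bser y v w J| @[n --> \oo] -->
    `|blim y v w - bser y v w J| by exact: cvg_norm cv.
rewrite -(cvg_lim _ cn)//.
apply: limr_le; first by apply/cvg_ex; eexists; exact: cn.
near=> n; apply: bd; near: n; exact: nbhs_infty_ge.
Unshelve. all: by end_near. Qed.

Definition Bform y v w : R := b0 v w + blim y v w.

Lemma Bform_linear y a u v w : cube y -> H u -> H v -> H w ->
  Bform y (a *: u + v) w = a * Bform y u w + Bform y v w.
Proof.
by move=> yc Hu Hv Hw; rewrite /Bform b0_linear// blim_linear//; ring.
Qed.

Lemma Bform_norm_le y v w : cube y -> H v -> H w ->
  `|Bform y v w| <= 2 * (nrm v * nrm w).
Proof.
move=> yc Hv Hw; rewrite /Bform (le_trans (ler_normD _ _))//.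
have := b0_norm_le Hv Hw; have := blim_norm_le yc Hv Hw.
have K0 : 0 <= nrm v * nrm w by rewrite mulr_ge0 ?nrm_ge0.
have /andP[t0 t1] := theta01.
have h2 : theta * (nrm v * nrm w) <= nrm v * nrm w by rewrite ler_piMl// ltW.
lra.
Qed.

(** Test with [z] itself: the perturbation takes away at most the fraction theta of its energy. This
    is how residual bounds become norm bounds. *)
Lemma Bform_coercive y z K : cube y -> H z -> 0 <= K ->
  (forall v, H v -> `|Bform y z v| <= K * nrm v) -> (1 - theta) * nrm z <= K.
Proof.
move=> yc Hz K0 hK; have /andP[t0 t1] := theta01.
have := blim_norm_le yc Hz Hz; rewrite ler_norml => /andP[h1 _].
have := le_trans (ler_norm _) (hK z Hz); rewrite /Bform -nrm_sqr// => h2.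
have [->|n0] := eqVneq (nrm z) 0; first by rewrite mulr0.
have {}n0 : 0 < nrm z by rewrite lt_def n0 nrm_ge0.
rewrite -(ler_pM2r n0) -mulrA; rewrite expr2 in h2; lra.
Qed.

Variables (f : V -> R) (F : R) (u : (nat -> R) -> V).
Variable Dv : seq nat -> (nat -> R) -> V.

Hypothesis rho_nd : nondecreasing_seq rho.
Hypothesis f_bound : forall w, H w -> `|f w| <= F * nrm w.
Hypothesis H_complete : forall v_ : nat -> V, (forall k, H (v_ k)) ->
  (forall e, 0 < e -> exists N, forall k l, (N <= k)%N -> (N <= l)%N ->
     nrm (v_ k - v_ l) <= e) ->
  exists2 v, H v &
    forall e, 0 < e -> exists N, forall k, (N <= k)%N -> nrm (v_ k - v) <= e.
Hypothesis u_H : forall y, cube y -> H (u y).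
Hypothesis u_eq : forall y w, cube y -> H w -> Bform y (u y) w = f w.

(** A partial difference quotient moves a single coordinate, so strictness in each coordinate leaves
    enough room inside the cube. *)
Definition ocube (y : nat -> R) : Prop := forall j, `|y j| < 1.

Lemma ocube_cube y : ocube y -> cube y. Proof. by move=> yo j; exact: ltW. Qed.

Definition dquot (U : (nat -> R) -> V) j y (h : R) : V :=
  h^-1 *: (U (y + h *: unit_seq j) - U y).

Definition is_pd j (U : (nat -> R) -> V) y z : Prop :=
  H z /\ nrm (dquot U j y h - z) @[h --> 0^'] --> (0 : R).

Hypothesis Dv_nil : Dv [::] = u.
(** In the application derivatives are picked by a choice operator, so [Dv] is known to be a
    derivative only once one exists. *)
Hypothesis Dv_cons : forall j w y, ocube y ->
  (forall y', ocube y' -> H (Dv w y')) -> (exists z, is_pd j (Dv w) y z) ->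
  is_pd j (Dv w) y (Dv (j :: w) y).

Lemma nrm_dist_triangle v w z : H v -> H w -> H z ->
  nrm (v - z) <= nrm (v - w) + nrm (w - z).
Proof.
move=> Hv Hw Hz; rewrite -[v - z](_ : (v - w) + (w - z) = _).
  by apply: nrm_triangle; exact: H_sub.
by rewrite addrA subrK.
Qed.

(** Completeness is about sequences, the derivative about punctured neighbourhoods. The limit along
    points [s n] with |r| < 1/(n + 1) serves the whole family, because the Cauchy bound gives
    distance at most [r h] to it. *)
Lemma nrm_cauchy (Delta : R -> V) (r : R -> R) (A : set R) :
  (0 : R)^' A -> (forall h, A h -> H (Delta h)) ->
  (forall h k, A h -> A k -> nrm (Delta h - Delta k) <= r h + r k) ->
  r h @[h --> 0^'] --> (0 : R) ->
  exists2 z, H z & nrm (Delta h - z) @[h --> 0^'] --> (0 : R).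
Proof.
move=> A0 AH Ar r0.
have /choice[s sP] : forall n : nat, exists h, A h /\ `|r h| < n.+1%:R^-1.
  move=> n; have en : 0 < (n.+1%:R^-1 : R) by rewrite invr_gt0.
  have AI : (0 : R)^' (A `&` [set h | `|r h| < n.+1%:R^-1]).
    by apply: filterI => //; move/cvgrPdist_lt : r0 => /(_ _ en);
      apply: filterS => h /=; rewrite sub0r normrN.
  by have [h [Ah rh]] := filter_ex AI; exists h.
have small e : 0 < e -> exists N : nat, forall n, (N <= n)%N -> n.+1%:R^-1 <= e :> R.
  move=> e0; exists (Num.truncn e^-1) => n Nn.
  rewrite -[leRHS]invrK lef_pV2 ?posrE ?invr_gt0//.
  by apply: ltW; apply: lt_le_trans (truncnS_gt _) _; rewrite ler_nat ltnS.
have [|e e0|z Hz zl] := H_complete (v_ := fun n => Delta (s n)).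
- by move=> k; apply: AH; case: (sP k).
- have e2 : 0 < e / 2 by rewrite divr_gt0.
  have [N NP] := small _ e2; exists N => k l Nk Nl.
  have [Ak rk] := sP k; have [Al rl] := sP l.
  apply: le_trans (Ar _ _ Ak Al) _.
  have := NP _ Nk; have := NP _ Nl; have := ler_norm (r (s k)).
  have := ler_norm (r (s l)); move: (k.+1%:R^-1) (l.+1%:R^-1) rk rl => a c' *.
  lra.
exists z => //.
have zr h : A h -> nrm (Delta h - z) <= r h.
  move=> Ah; apply/ler_addgt0Pr => e e0.
  have e2 : 0 < e / 2 by rewrite divr_gt0.
  have [N NP] := small _ e2; have [M MP] := zl _ e2.
  pose k := maxn N M; have [Ak rk] := sP k.
  have h1 := NP k (leq_maxl _ _); have h2 := MP k (leq_maxr _ _).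
  have h3 := nrm_dist_triangle (AH _ Ah) (AH _ Ak) Hz.
  have h4 := Ar _ _ Ah Ak; have h5 := ler_norm (r (s k)).
  by move: (k.+1%:R^-1) rk h1 h2 h3 h4 h5 => a *; lra.
apply/cvgrPdist_lt => e e0; move/cvgrPdist_lt : r0 => /(_ _ e0).
apply: filterS2 A0 => h Ah; rewrite !sub0r !normrN => re.
by rewrite ger0_norm ?nrm_ge0// (le_lt_trans (zr h Ah))// (le_lt_trans (ler_norm _)).
Qed.

(** The equation differentiated along [w]. The coefficient is affine in y, so the product rule lets
    at most one derivative fall on it, giving one term per position of the word. *)
Definition weak_eq (w : seq nat) : Prop := forall y, ocube y ->
  H (Dv w y) /\ forall v, H v -> Bform y (Dv w y) v =
    (w == [::])%:R * f v -
    \sum_(i < size w) b (nth 0%N w i) (Dv (seq_delete i w) y) v.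

Definition has_pd (w : seq nat) j : Prop :=
  forall y, ocube y -> is_pd j (Dv w) y (Dv (j :: w) y).

Section step.
Variables (w : seq nat) (j : nat).
Hypothesis IHpd : forall i, (i < size w)%N -> has_pd (seq_delete i w) j.
Hypothesis IHeq : weak_eq w.
Hypothesis IHeqd : forall i, (i < size w)%N -> weak_eq (seq_delete i w).
Variable y : nat -> R.
Hypothesis yo : ocube y.

Let U := Dv w.
Let Ui (i : 'I_(size w)) := Dv (seq_delete i w).
Let zi (i : 'I_(size w)) := Dv (j :: seq_delete i w) y.
Let yh h := y + h *: unit_seq j.
Let good : set R := [set h | h != 0 /\ `|h| < 1 - `|y j|].
Let s h := \sum_(i < size w) nrm (dquot (Ui i) j y h - zi i).

Let yc : cube y := ocube_cube yo.

Let Bl' a p q v : H p -> H q -> H v ->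
  Bform y (a *: p + q) v = a * Bform y p v + Bform y q v.
Proof. exact: Bform_linear. Qed.

Let yh_o h : good h -> ocube (yh h).
Proof.
move=> [_ hy] i; have -> : yh h i = y i + h * (i == j)%:R by [].
have [->|ij] := eqVneq i j; last by rewrite mulr0 addr0; exact: yo.
by rewrite mulr1 (le_lt_trans (ler_normD _ _))//; move: hy; lra.
Qed.

Let good_near : (0 : R)^' good.
Proof.
have y0 : 0 < 1 - `|y j| by rewrite subr_gt0.
near=> h; split; first by near: h; exact: nbhs_dnbhs_neq.
by near: h; exact: dnbhs0_lt.
Unshelve. all: by end_near. Qed.

Let HU h : good h -> H (U (yh h)). Proof. by move=> /yh_o/IHeq[]. Qed.
Let HU0 : H (U y). Proof. by case: (IHeq yo). Qed.
Let HUi i h : good h -> H (Ui i (yh h)).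
Proof. by move=> /yh_o /(IHeqd (ltn_ord i))[]. Qed.
Let HUi0 i : H (Ui i y). Proof. by case: (IHeqd (ltn_ord i) yo). Qed.
Let Hzi i : H (zi i). Proof. by case: (IHpd (ltn_ord i) yo). Qed.
Let Hd h : good h -> H (dquot U j y h).
Proof. by move=> gh; apply: H_scale; apply: H_sub => //; exact: HU. Qed.
Let Hdi i h : good h -> H (dquot (Ui i) j y h).
Proof. by move=> gh; apply: H_scale; apply: H_sub => //; exact: HUi. Qed.

Let s_cvg : s h @[h --> 0^'] --> (0 : R).
Proof.
rewrite /s [X in _ --> X](_ : 0 = \sum_(i < size w) (0 : R)); last by rewrite big1.
by apply: cvg_sumr => i; case: (IHpd (ltn_ord i) yo).
Qed.

Let UhE h : good h -> U (yh h) = U y + h *: dquot U j y h.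
Proof.
by move=> [h0 _]; rewrite /dquot scalerA mulfV// scale1r addrC subrK.
Qed.

(** The difference of the equations at [yh h] and [y], divided by h. The first term on the right
    comes from replacing the form at [yh h] by the one at [y]. *)
Let dquot_eq h v : good h -> H v -> Bform y (dquot U j y h) v =
  - b j (U (yh h)) v - \sum_(i < size w) b (nth 0%N w i) (dquot (Ui i) j y h) v.
Proof.
move=> gh Hv; have h0 := gh.1.
have HUh := HU gh; have Hdh := Hd gh; have Hdih i : H (dquot (Ui i) j y h) := Hdi i gh.
have HUih i : H (Ui i (yh h)) := HUi i gh; have Hhd := H_scale h Hdh.
have [_ /(_ v Hv) e1] := IHeq (yh_o gh); have [_ /(_ v Hv) e0] := IHeq yo.
rewrite {1}/dquot (form_scale_l Bl')//; last exact: H_sub.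
rewrite (form_sub_l Bl')//.
have e1' : Bform y (U (yh h)) v = Bform (yh h) (U (yh h)) v - h * b j (U (yh h)) v.
  by rewrite /Bform blim_shift//; ring.
have e2 (i : 'I_(size w)) : b (nth 0%N w i) (dquot (Ui i) j y h) v =
    h^-1 * (b (nth 0%N w i) (Ui i (yh h)) v - b (nth 0%N w i) (Ui i y) v).
  rewrite /dquot (form_scale_l (b_linear _))//; last exact: H_sub.
  by rewrite (form_sub_l (b_linear _))//.
under eq_bigr do rewrite e2.
rewrite -mulr_sumr sumrB -[yh h]/(y + h *: unit_seq j) in e1 *.
rewrite e1' [Bform (yh h) _ _]e1 [Bform y (U y) v]e0.
by field.
Qed.

Let c0 : 0 < 1 - theta. Proof. by have /andP[_ ?] := theta01; lra. Qed.

Let K0 := nrm (U y) + \sum_(i < size w) nrm (zi i) + 1.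
Let K1 := 2 * K0 / (1 - theta).
Let A : set R := good `&` [set h | `|h| < (1 - theta) / 2] `&` [set h | s h < 1].

Let A_near : (0 : R)^' A.
Proof.
have c2 : 0 < (1 - theta) / 2 by rewrite divr_gt0.
near=> h; split; first split.
- by near: h; exact: good_near.
- by near: h; exact: dnbhs0_lt.
- by near: h; exact: (cvgr_lt _ s_cvg _ ltr01).
Unshelve. all: by end_near. Qed.

(** Coercivity bounds (1 - theta) X by [K0] + |h| X, where [s h] < 1 accounts for the 1 in [K0]. As
    |h| < (1 - theta) / 2, half of the left side absorbs |h| X, hence the 2 in [K1]. *)
Let dquot_bounded h : A h -> nrm (dquot U j y h) <= K1.
Proof.
move=> [[gh hs] sh]; rewrite /= in hs sh.
have HUh := HU gh; have Hdh := Hd gh; have Hdih i : H (dquot (Ui i) j y h) := Hdi i gh.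
have HUih i : H (Ui i (yh h)) := HUi i gh; have Hhd := H_scale h Hdh.
set X := nrm _; have X0 : 0 <= X by exact: nrm_ge0.
have hU : nrm (U (yh h)) <= nrm (U y) + `|h| * X.
  by rewrite UhE// (le_trans (nrm_triangle _ _))// nrm_scale// -/X.
have hUi i : nrm (dquot (Ui i) j y h) <= nrm (dquot (Ui i) j y h - zi i) + nrm (zi i).
  by rewrite -{1}[dquot _ _ _ _](subrK (zi i)) nrm_triangle//; exact: H_sub.
have : (1 - theta) * X <= nrm (U (yh h)) + \sum_(i < size w) nrm (dquot (Ui i) j y h).
  apply: (@Bform_coercive y) => //.
    by rewrite addr_ge0 ?nrm_ge0// sumr_ge0// => i _; exact: nrm_ge0.
  move=> v Hv; rewrite dquot_eq// (le_trans (ler_normB _ _))// normrN mulrDl.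
  rewrite lerD ?b_norm_le// (le_trans (ler_norm_sum _ _ _))// mulr_suml.
  by apply: ler_sum => i _; rewrite b_norm_le.
have : \sum_(i < size w) nrm (dquot (Ui i) j y h) <= s h + \sum_(i < size w) nrm (zi i).
  by rewrite -big_split/=; apply: ler_sum => i _; exact: hUi.
have hX : `|h| * X <= (1 - theta) / 2 * X by rewrite ler_wpM2r// ltW.
move=> h1 h2; rewrite /K1 ler_pdivlMr//.
have : K0 = nrm (U y) + \sum_(i < size w) nrm (zi i) + 1 by [].
move: (K0) (\sum_(i < size w) nrm (dquot (Ui i) j y h)) (\sum_(i < size w) nrm (zi i)) h1 h2 => k q p *.
lra.
Qed.

Let r h := (1 - theta)^-1 * (`|h| * K1 + s h).

Let r_cvg : r h @[h --> 0^'] --> (0 : R).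
Proof.
rewrite [X in _ --> X](_ : 0 = (1 - theta)^-1 * (0 * K1 + 0)); last by rewrite mul0r addr0 mulr0.
apply: cvgMl_tmp; apply: cvgD; last exact: s_cvg.
apply: cvgMr_tmp; rewrite -[X in _ --> X](normr0 R); apply: cvg_norm.
exact: cvg_within.
Qed.

(** In the difference of two quotients the values of U differ by O(|h| + |k|) by the previous bound,
    and the quotients of the shorter words converge by hypothesis. *)
Let dquot_cauchy h k : A h -> A k ->
  nrm (dquot U j y h - dquot U j y k) <= r h + r k.
Proof.
move=> Ah Ak; have [[gh _] _] := Ah; have [[gk _] _] := Ak.
have HUh := HU gh; have Hdh := Hd gh; have Hdih i : H (dquot (Ui i) j y h) := Hdi i gh.
have HUih i : H (Ui i (yh h)) := HUi i gh; have Hhd := H_scale h Hdh.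
have HUk := HU gk; have Hdk := Hd gk; have Hdik i : H (dquot (Ui i) j y k) := Hdi i gk.
have HUik i : H (Ui i (yh k)) := HUi i gk; have Hkd := H_scale (- k) Hdk.
rewrite /r -mulrDr -ler_pdivrMl ?invr_gt0// invrK.
have hUhk : nrm (U (yh h) - U (yh k)) <= `|h| * K1 + `|k| * K1.
  rewrite !UhE// opprD addrACA subrr add0r -scaleNr.
  rewrite (le_trans (nrm_triangle _ _))// (nrm_scale h Hdh) (nrm_scale (- k) Hdk).
  by rewrite normrN; apply: lerD; apply: ler_wpM2l => //; exact: dquot_bounded.
have hUi i : nrm (dquot (Ui i) j y h - dquot (Ui i) j y k) <=
    nrm (dquot (Ui i) j y h - zi i) + nrm (dquot (Ui i) j y k - zi i).
  rewrite [leRHS](_ : _ = nrm (dquot (Ui i) j y h - zi i) +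
    nrm (zi i - dquot (Ui i) j y k)); last by congr (_ + _); exact: nrm_distC.
  exact: nrm_dist_triangle.
apply: (@le_trans _ _ (nrm (U (yh h) - U (yh k)) +
    \sum_(i < size w) nrm (dquot (Ui i) j y h - dquot (Ui i) j y k))).
  apply: (@Bform_coercive y) => //; first exact: H_sub.
    by rewrite addr_ge0 ?nrm_ge0// sumr_ge0// => i _; exact: nrm_ge0.
  move=> v Hv.
  rewrite (form_sub_l Bl')//.
  rewrite !dquot_eq//.
  have -> : forall a b' c' d' : R, - a - b' - (- c' - d') = - (a - c') - (b' - d').
    by move=> *; ring.
  rewrite -(form_sub_l (b_linear j))// -sumrB.
  rewrite (le_trans (ler_normB _ _))// normrN mulrDl lerD ?b_norm_le//.
    exact: H_sub.
  rewrite (le_trans (ler_norm_sum _ _ _))// mulr_suml; apply: ler_sum => i _.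
  rewrite -(form_sub_l (b_linear _))// b_norm_le//.
  exact: H_sub.
rewrite addrACA lerD// /s -big_split/=; apply: ler_sum => i _; exact: hUi.
Qed.

Lemma step_pd : is_pd j (Dv w) y (Dv (j :: w) y).
Proof.
apply: Dv_cons => //; first by move=> y' /IHeq[].
have [|z Hz zl] := nrm_cauchy A_near _ dquot_cauchy r_cvg.
  by move=> h [[gh _] _]; exact: Hd.
by exists z.
Qed.

Lemma step_eq v : H v -> Bform y (Dv (j :: w) y) v =
  - b j (U y) v - \sum_(i < size w) b (nth 0%N w i) (zi i) v.
Proof.
move=> Hv; have [Hz zl] := step_pd; set z := Dv _ y in Hz zl *.
apply/eqP; rewrite -subr_eq0 -normr_le0.
set X := (X in `|X|).
(* The defect [X] does not depend on h, yet it is bounded by [g h], which tends to 0. *)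
pose g h := (2 * nrm (dquot U j y h - z) + (`|h| * K1 + s h)) * nrm v.
have g0 : g h @[h --> 0^'] --> (0 : R).
  rewrite [X in _ --> X](_ : 0 = (2 * 0 + (0 * K1 + 0)) * nrm v); last by rewrite mulr0 mul0r !addr0 mul0r.
  apply: cvgMr_tmp; apply: cvgD; first exact: cvgMl_tmp.
  apply: cvgD; last exact: s_cvg.
  apply: cvgMr_tmp; rewrite -[X in _ --> X](normr0 R); apply: cvg_norm.
  exact: cvg_within.
rewrite -(cvg_lim _ g0)//; apply: limr_ge; first by apply/cvg_ex; exists 0.
apply: filterS A_near => h Ah; have [[gh _] _] := Ah.
have HUh := HU gh; have Hdh := Hd gh; have Hdih i : H (dquot (Ui i) j y h) := Hdi i gh.
have HUih i : H (Ui i (yh h)) := HUi i gh; have Hhd := H_scale h Hdh.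
have -> : X = - Bform y (dquot U j y h - z) v - b j (U (yh h) - U y) v -
    \sum_(i < size w) b (nth 0%N w i) (dquot (Ui i) j y h - zi i) v.
  under eq_bigr => i _ do rewrite (form_sub_l (b_linear _))//.
  rewrite sumrB (form_sub_l (b_linear _))//.
  rewrite (form_sub_l Bl')//.
  by rewrite dquot_eq// /X; ring.
rewrite (le_trans (ler_normB _ _))// /g mulrDl.
have -> : U (yh h) - U y = h *: dquot U j y h by rewrite UhE// addrC addKr.
have h1 : `|- Bform y (dquot U j y h - z) v| <= 2 * nrm (dquot U j y h - z) * nrm v.
  by rewrite normrN -mulrA Bform_norm_le//; exact: H_sub.
have h2 : `|b j (h *: dquot U j y h) v| <= `|h| * K1 * nrm v.
  rewrite (le_trans (b_norm_le _ _ _))// nrm_scale//.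
  by rewrite ler_wpM2r ?nrm_ge0//; apply: ler_wpM2l => //; exact: dquot_bounded.
have h3 : `|\sum_(i < size w) b (nth 0%N w i) (dquot (Ui i) j y h - zi i) v| <= s h * nrm v.
  rewrite (le_trans (ler_norm_sum _ _ _))// mulr_suml; apply: ler_sum => i _.
  by rewrite b_norm_le//; exact: H_sub.
have h4 := ler_normB (- Bform y (dquot U j y h - z) v) (b j (h *: dquot U j y h) v).
by rewrite mulrDl; lra.
Qed.

End step.

(** The two claims advance alternately: the equation up to length k and differentiability below
    length k give differentiability at length k, and passing to the limit there gives the equation
    at length k + 1. *)
Lemma derivatives k : (forall w, (size w <= k)%N -> weak_eq w) /\
  (forall w j, (size w < k)%N -> has_pd w j).
Proof.
elim: k => [|k [IHe IHd]].
  split=> // w; rewrite leqn0 size_eq0 => /eqP -> y yo.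
  rewrite Dv_nil; split; first exact: u_H (ocube_cube yo).
  by move=> v Hv; rewrite big_ord0 subr0 mul1r u_eq//; exact: ocube_cube.
have del w i : (size w <= k)%N -> (i < size w)%N ->
    (size (seq_delete i w) < k)%N.
  by move=> wk /size_seq_delete iw; rewrite -iw.
have pdk w j : (size w <= k)%N -> has_pd w j.
  move=> wk y yo; apply: step_pd => //.
  - by move=> i iw; apply: IHd; exact: del.
  - exact: IHe.
  - by move=> i iw; apply: IHe; apply: ltnW; exact: del.
split=> [[|j w]|w j]; rewrite ?ltnS.
- by move=> _; exact: IHe.
- move=> wk y yo; have [Hz _] := pdk w j wk y yo; split=> // v Hv.
  rewrite step_eq//; last 3 first.
  - by move=> i iw; apply: IHd; exact: del.
  - exact: IHe.
  - by move=> i iw; apply: IHe; apply: ltnW; exact: del.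
  rewrite mul0r sub0r big_ord_recl/= opprD; congr (- b j (Dv _ _) _ - _).
  by rewrite /seq_delete take0 drop1.
- exact: pdk.
Qed.

(** * Taylor coefficients and their weighted energies *)

Definition tc (s : multi_index) : V := (mi_fact s)%:R^-1 *: Dv (mi_word s) 0.

Lemma ocube0 : ocube 0. Proof. by move=> j; rewrite normr0. Qed.

Lemma weak_eq_all w : weak_eq w.
Proof. by case: (derivatives (size w)) => + _; apply. Qed.

Lemma H_tc s : H (tc s).
Proof. by apply: H_scale; case: (@weak_eq_all (mi_word s) 0 ocube0). Qed.

Lemma Bform0 v w : Bform 0 v w = b0 v w.
Proof.
rewrite /Bform /blim (_ : bser 0 v w = cst 0) ?lim_cst ?addr0//.
by apply/funext => n; rewrite /bser /series/= big1// => j _; rewrite mul0r.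
Qed.

Lemma mi_word_eq0 s : (mi_word s == [::]) = (s == mi0).
Proof.
apply/eqP/eqP => [s0|->]; last exact: mi_word0.
apply: mi_eq => j; rewrite mi0E; apply/eqP; rewrite -[_ == _]negbK.
by rewrite -mem_mi_word s0.
Qed.

(** The letter j occurs s_j times in the word, and s_j / s! = 1 / (s - e_j)!, so the multiplicities
    disappear into the factorials. *)
Lemma tc_eq s v : H v -> b0 (tc s) v =
  (s == mi0)%:R * f v - \sum_(j <- nu s) b j (tc (mi_dec s j)) v.
Proof.
move=> Hv; have [Hs /(_ v Hv)] := @weak_eq_all (mi_word s) 0 ocube0.
rewrite Bform0 mi_word_eq0 => e.
have Hd r : H (Dv (mi_word r) 0) by case: (@weak_eq_all (mi_word r) 0 ocube0).
rewrite {1}/tc (form_scale_l b0_linear)// e mulrBr; congr (_ - _).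
  by have [->|_] := eqVneq s mi0; rewrite ?mul0r ?mulr0// mi_fact0 invr1 mul1r.
under eq_bigr => i _ do rewrite seq_delete_word//.
rewrite (sum_mi_word (fun j => b j (Dv (mi_word (mi_dec s j)) 0) v)) mulr_sumr.
apply: eq_big_seq => j; rewrite mem_nu => sj.
rewrite /tc (form_scale_l (b_linear j))//.
have -> : mi_fact s = (s j * mi_fact (mi_dec s j))%N.
  by rewrite -{1}(mi_decK sj) mi_fact_inc mi_decE eqxx subn1 prednK// lt0n.
rewrite natrM invfM -mulr_natr; field.
have fn : (mi_fact (mi_dec s j))%:R != 0 :> R by rewrite pnatr_eq0 -lt0n mi_fact_gt0.
by rewrite ?fn ?pnatr_eq0 ?sj.
Qed.

Definition tcw s : V := sigma rho s *: tc s.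
Definition energy s : R := b0 (tcw s) (tcw s).
(** The ratio of consecutive levels: (1 - theta/2) E_(k+1) <= (theta/2) E_k. *)
Definition kappa : R := theta / (2 - theta).

Lemma H_tcw s : H (tcw s). Proof. exact: H_scale (H_tc s). Qed.

Lemma energy_ge0 s : 0 <= energy s. Proof. exact: b0_ge0 (H_tcw s). Qed.

Lemma sigma_rho_gt0 s : 0 < sigma rho s.
Proof. by apply: sigma_gt0 => j; exact: rho_gt0. Qed.

Lemma sigma_dec (y : nat -> R) (s : multi_index) j : (s j != 0)%N ->
  sigma y s = y j * sigma y (mi_dec s j).
Proof. by move=> sj; rewrite -sigma_inc mi_decK. Qed.

Lemma energyE s : energy s = (sigma rho s * nrm (tc s)) ^+ 2.
Proof.
rewrite /energy -nrm_sqr; last exact: H_tcw.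
rewrite /tcw nrm_scale; last exact: H_tc.
by rewrite gtr0_norm// sigma_rho_gt0.
Qed.

Lemma kappa_itv : 0 <= kappa < 1.
Proof.
have /andP[t0 t1] := theta01; rewrite /kappa divr_ge0/=; [|lra..].
by rewrite ltr_pdivrMr; lra.
Qed.

(** The weights of s and s - e_j differ by rho_j, exactly the factor in [bc]. The half of that bound
    falling on s itself is absorbed on the left by [c_sum]. *)
Lemma energy_step s : s != mi0 ->
  (1 - theta / 2) * energy s <=
  2^-1 * \sum_(j <- nu s) c j (tcw (mi_dec s j)).
Proof.
move=> s0.
have e1 : energy s <= \sum_(j <- nu s) 2^-1 * (c j (tcw (mi_dec s j)) + c j (tcw s)).
  rewrite /energy {1}/tcw (form_scale_l b0_linear _ (H_tc s) (H_tcw s)).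
  rewrite (tc_eq s (H_tcw s)).
  rewrite (negPf s0) mul0r sub0r mulrN (le_trans (ler_norm _))// normrN.
  rewrite mulr_sumr (le_trans (ler_norm_sum _ _ _))//.
  rewrite big_seq [leRHS]big_seq; apply: ler_sum => j; rewrite mem_nu => sj.
  apply: le_trans (bc j (H_tcw _) (H_tcw _)).
  rewrite (form_scale_l (b_linear j) _ (H_tc _) (H_tcw s)) (sigma_dec rho sj).
  by rewrite -mulrA normrM gtr0_norm// rho_gt0.
have e2 : \sum_(j <- nu s) c j (tcw s) <= theta * energy s.
  apply: le_trans (c_sum (mi_bound s) (H_tcw s)).
  apply: ler_sum_sub => [||j]; [exact: nu_uniq| |exact: c_ge0 (H_tcw s)].
  by move=> j; rewrite mem_nu mem_index_iota => /mi_boundP.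
by rewrite -mulr_sumr big_split/= in e1; lra.
Qed.

(** Regrouped by the predecessor r, the right sides of [energy_step] contain each [c j (tcw r)] at
    most once, and [c_sum] bounds their sum over j by theta times the energy of r. *)
Lemma level_energy k L : uniq L -> (forall s, s \in L -> mi_deg s = k) ->
  \sum_(s <- L) energy s <= kappa ^+ k * energy mi0.
Proof.
have /andP[t0 t1] := theta01.
elim: k L => [|k IH] L uL degL.
  rewrite mul1r -[leRHS](big_seq1 +%R mi0 energy).
  apply: ler_sum_sub => // [s sL|s]; last exact: energy_ge0.
  by rewrite inE -mi_deg_eq0 degL.
have h1 : (1 - theta / 2) * \sum_(s <- L) energy s <=
    2^-1 * \sum_(p <- mi_pairs L) c p.1 (tcw p.2).
  rewrite -(sum_mi_pairs (fun j r => c j (tcw r))) !mulr_sumr big_seq [leRHS]big_seq.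
  apply: ler_sum => s sL; apply: energy_step.
  by rewrite -mi_deg_eq0 degL.
pose rs := undup [seq p.2 | p <- mi_pairs L].
pose J := (\max_(p <- mi_pairs L) p.1).+1.
have degr r : r \in rs -> mi_deg r = k.
  rewrite mem_undup => /mapP[p]; rewrite mem_mi_pairs => pL ->.
  by have := degL _ pL; rewrite mi_deg_inc => -[].
have h2 : \sum_(p <- mi_pairs L) c p.1 (tcw p.2) <=
    \sum_(r <- rs) \sum_(0 <= j < J) c j (tcw r).
  have -> : \sum_(r <- rs) \sum_(0 <= j < J) c j (tcw r) =
      \sum_(p <- [seq (j, r) | r <- rs, j <- index_iota 0 J]) c p.1 (tcw p.2).
    by rewrite big_allpairs_dep.
  apply: ler_sum_sub => [||p]; [exact: mi_pairs_uniq| |exact: c_ge0 (H_tcw _)].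
  move=> p pP; apply/allpairsP; exists (p.2, p.1); split=> /=.
  - by rewrite mem_undup; apply/mapP; exists p.
  - by rewrite mem_index_iota ltnS; apply: (leq_bigmax_seq p).
  - by case: p {pP}.
have h3 : \sum_(r <- rs) \sum_(0 <= j < J) c j (tcw r) <= theta * (kappa ^+ k * energy mi0).
  apply: (@le_trans _ _ (theta * \sum_(r <- rs) energy r)).
    by rewrite mulr_sumr; apply: ler_sum => r _; exact: c_sum (H_tcw r).
  by rewrite ler_wpM2l// IH// undup_uniq.
rewrite exprS -mulrA /kappa mulrAC ler_pdivlMr; last lra.
by move: h1 h2 h3; set X := \sum_(s <- L) _; lra.
Qed.

Lemma sum_by_level (w : multi_index -> R) L : exists K,
  \sum_(s <- L) w s = \sum_(0 <= k < K) \sum_(s <- [seq s <- L | mi_deg s == k]) w s.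
Proof.
exists (\max_(s <- L) mi_deg s).+1.
under [RHS]eq_bigr do rewrite big_filter big_mkcond.
rewrite exchange_big/=; apply: eq_big_seq => s sL.
rewrite (bigD1_seq (mi_deg s)) ?iota_uniq ?eqxx//=; last first.
  by rewrite mem_index_iota ltnS; apply: (leq_bigmax_seq s).
by rewrite big1 ?addr0// => k; rewrite eq_sym => /negPf ->.
Qed.

Lemma energy0_le : energy mi0 <= F ^+ 2.
Proof.
rewrite energyE sigma0 mul1r.
have n0 := nrm_ge0 (tc mi0).
have h := tc_eq mi0 (H_tc mi0); rewrite -nrm_sqr ?eqxx ?mul1r in h; last exact: H_tc.
have nu0 : nu mi0 = [::].
  by apply/eqP; rewrite -size_eq0 -leqn0 leqNgt -has_predT; apply/hasPn => j; rewrite mem_nu mi0E.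
rewrite nu0 big_nil subr0 in h.
have := le_trans (ler_norm _) (f_bound (H_tc mi0)); rewrite -h => h1.
have [n1|n1] := eqVneq (nrm (tc mi0)) 0; first by rewrite n1 expr0n sqr_ge0.
have : nrm (tc mi0) <= F.
  by rewrite expr2 ler_pM2r// ?lt_def ?n1// in h1.
by move=> nF; rewrite lerXn2r// nnegrE (le_trans n0).
Qed.

Definition energy_total : R := F ^+ 2 / (1 - kappa).

Lemma sum_energy L : uniq L -> \sum_(s <- L) energy s <= energy_total.
Proof.
move=> uL; have /andP[k0 k1] := kappa_itv; have [K ->] := sum_by_level energy L.
apply: (@le_trans _ _ (\sum_(0 <= k < K) kappa ^+ k * F ^+ 2)).
  apply: ler_sum => k _; apply: (@le_trans _ _ (kappa ^+ k * energy mi0)).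
    apply: level_energy; first exact: filter_uniq.
    by move=> s; rewrite mem_filter => /andP[/eqP].
  by rewrite ler_wpM2l ?exprn_ge0 ?energy0_le.
rewrite -mulr_suml mulrC ler_wpM2l ?sqr_ge0// -[leRHS]mul1r ler_pdivlMr; last by rewrite subr_gt0.
have -> : (\sum_(0 <= k < K) kappa ^+ k) * (1 - kappa) = 1 - kappa ^+ K.
  elim: K => [|K IH]; first by rewrite big_geq// mul0r subrr.
  by rewrite big_nat_recr//= mulrDl IH exprS; ring.
by rewrite gerBl exprn_ge0.
Qed.

(** The weighted inequality of arithmetic and geometric means, used in place of Cauchy-Schwarz. The
    parameter is 1 for the total sum, large for high levels, and [tau] for the tail outside
    Lambda. *)
Lemma nrm_tc_le (lambda : R) s : 0 < lambda ->
  nrm (tc s) <= 2^-1 * (lambda * energy s + lambda^-1 * (sigma rho s) ^- 2).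
Proof.
move=> l0; rewrite energyE; have s0 := sigma_rho_gt0 s.
move: (sigma rho s) (nrm _) s0 => t x t0.
have -> : 2^-1 * (lambda * (t * x) ^+ 2 + lambda^-1 * t ^- 2) =
   x + (2 * lambda)^-1 * (lambda * t * x - t^-1) ^+ 2.
  by field; rewrite !gt_eqF.
rewrite lerDl; apply: mulr_ge0; last exact: sqr_ge0.
by rewrite invr_ge0 mulr_ge0// ltW.
Qed.

Variable S2 : R.
Hypothesis S2_bound : forall L, uniq L -> \sum_(s <- L) (sigma rho s) ^- 2 <= S2.
Hypothesis rho_unbounded : forall x, exists J, x < rho J.

Lemma sum_nrm_tc (lambda : R) L : 0 < lambda ->
  \sum_(s <- L) nrm (tc s) <= 2^-1 * (lambda * \sum_(s <- L) energy s +
     lambda^-1 * \sum_(s <- L) (sigma rho s) ^- 2).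
Proof.
move=> l0; rewrite !mulr_sumr -big_split/= mulr_sumr.
by apply: ler_sum => s _; exact: nrm_tc_le.
Qed.

Definition nrm_total : R := 2^-1 * (energy_total + S2).

Lemma sum_nrm_le L : uniq L -> \sum_(s <- L) nrm (tc s) <= nrm_total.
Proof.
move=> uL; apply: le_trans (sum_nrm_tc L ltr01) _; rewrite invr1 !mul1r.
by rewrite ler_wpM2l// lerD ?sum_energy ?S2_bound.
Qed.

Lemma level_nrm_small e : 0 < e -> exists k0, forall k L, (k0 <= k)%N -> uniq L ->
  (forall s, s \in L -> mi_deg s = k) -> \sum_(s <- L) nrm (tc s) <= e.
Proof.
move=> e0; have /andP[kp0 kp1] := kappa_itv.
have S20 : 0 <= S2 by have := S2_bound (isT : uniq [::]); rewrite big_nil.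
have c0 : 0 < S2 + 1 by lra.
(* This parameter makes the sigma term at most e; a high level then makes the energy term at most
   e. *)
pose l := (S2 + 1) / e; have l0 : 0 < l by rewrite divr_gt0.
have E0 : 0 < l * (energy mi0 + 1).
  by rewrite mulr_gt0//; have := energy_ge0 mi0; lra.
have kn : `|kappa| < 1 by rewrite ger0_norm.
have [k0 _ k0P] : \forall k \near \oo, kappa ^+ k < e / (l * (energy mi0 + 1)).
  have e1 : 0 < e / (l * (energy mi0 + 1)) by rewrite divr_gt0.
  move/cvgrPdist_lt : (cvg_expr kn) => /(_ _ e1); apply: filterS => k.
  by rewrite sub0r normrN ger0_norm// exprn_ge0.
exists k0 => k L kk uL degL; apply: le_trans (sum_nrm_tc L l0) _.
have h1 := level_energy uL degL; have h2 := S2_bound uL.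
have h3 : l * \sum_(s <- L) energy s <= e.
  apply: (@le_trans _ _ (l * (kappa ^+ k * energy mi0))); first by rewrite ler_wpM2l// ltW.
  have := k0P k kk; rewrite /= ltr_pdivlMr// => h.
  have := exprn_ge0 k kp0; move: (kappa ^+ k) h => x; nra.
have h4 : l^-1 * \sum_(s <- L) (sigma rho s) ^- 2 <= e.
  rewrite /l invf_div -mulrAC ler_pdivrMr// ler_wpM2l ?(ltW e0)//.
  by rewrite (le_trans h2)// lerDl.
lra.
Qed.

(** * Convergence of the Taylor series to the solution *)

Definition mi_lower (J k : nat) : seq multi_index :=
  [seq s <- mi_box J k | (mi_deg s <= k)%N].

Lemma mem_mi_lower J k s : (s \in mi_lower J k) <->
  (forall j, (s j != 0)%N -> (j < J)%N) /\ (mi_deg s <= k)%N.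
Proof.
rewrite mem_filter; split=> [/andP[dk /mem_mi_box[sJ _]]|[sJ dk]] //.
rewrite dk; apply/mem_mi_box; split=> // j.
exact: leq_trans (mi_deg_ge s j) dk.
Qed.

Lemma mi_lower_uniq J k : uniq (mi_lower J k).
Proof. exact/filter_uniq/mi_box_uniq. Qed.

Definition taylor_sum (y : nat -> R) J k : V :=
  \sum_(s <- mi_lower J k) sigma y s *: tc s.

Lemma mi_pairs_lower J k : perm_eq (mi_pairs (mi_lower J k))
  [seq (j, r) | r <- [seq r <- mi_lower J k | (mi_deg r < k)%N], j <- index_iota 0 J].
Proof.
apply: uniq_perm.
- exact/mi_pairs_uniq/mi_lower_uniq.
- apply: allpairs_uniq; rewrite ?iota_uniq//; first exact/filter_uniq/mi_lower_uniq.
  by move=> [r j] [r' j'] _ _ /= [-> ->].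
- move=> [j r]; rewrite mem_mi_pairs/=; apply/idP/allpairsP => [|[[r' j']/= [+ + [-> ->]]]].
    move=> /mem_mi_lower[sJ]; rewrite mi_deg_inc => dk.
    exists (r, j); split=> //=.
      rewrite mem_filter dk; apply/mem_mi_lower; split; last exact: ltnW.
      by move=> i ri; apply: sJ; rewrite mi_incE; lia.
    by rewrite mem_index_iota/= sJ// mi_incE eqxx addn1.
  rewrite mem_filter mem_index_iota/= => /andP[dk /mem_mi_lower[rJ _]] jJ.
  apply/mem_mi_lower; split; last by rewrite mi_deg_inc.
  exact: mi_inc_lt.
Qed.

(** By [tc_eq] the b_j terms of every level below k cancel against the b_0 terms one level up. What
    is left is the top level, and for each r the part of the series in directions j >= J. *)
Lemma remainder_form y J k v : cube y -> H v ->
  Bform y (u y - taylor_sum y J k) v =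
  - (\sum_(r <- mi_lower J k | ~~ (mi_deg r < k)%N) sigma y r * bser y (tc r) v J)
  - \sum_(r <- mi_lower J k) sigma y r * (blim y (tc r) v - bser y (tc r) v J).
Proof.
move=> yc Hv.
have Bl a p q z : H p -> H q -> H z -> Bform y (a *: p + q) z = a * Bform y p z + Bform y q z.
  by move=> Hp Hq Hz; exact: Bform_linear.
have Hts s : H (sigma y s *: tc s) by exact: H_scale (H_tc s).
rewrite (form_sub_l Bl)//; [|exact: u_H|exact: H_sum].
rewrite u_eq// /taylor_sum (form_sum_l Bl)//.
under eq_bigr => s _ do rewrite (form_scale_l Bl (sigma y s) (H_tc s) Hv) /Bform mulrDr.
rewrite big_split/=.
have -> : \sum_(s <- mi_lower J k) sigma y s * b0 (tc s) v =
    f v - \sum_(r <- mi_lower J k | (mi_deg r < k)%N) sigma y r * bser y (tc r) v J.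
  under eq_bigr => s _ do rewrite tc_eq// mulrBr.
  rewrite sumrB; congr (_ - _).
    rewrite (bigD1_seq mi0) ?mi_lower_uniq//=; last first.
      by apply/mem_mi_lower; split=> [j|]; rewrite ?mi0E ?mi_deg0.
    by rewrite eqxx sigma0 !mul1r big1 ?addr0// => s /negPf ->; rewrite mul0r mulr0.
  under eq_bigr => s _ do rewrite mulr_sumr.
  transitivity (\sum_(s <- mi_lower J k) \sum_(j <- nu s)
      (fun j r => y j * sigma y r * b j (tc r) v) j (mi_dec s j)).
    apply: eq_bigr => s _; apply: eq_big_seq => j; rewrite mem_nu => sj.
    by rewrite (sigma_dec y sj).
  rewrite (sum_mi_pairs (fun j r => y j * sigma y r * b j (tc r) v)).
  rewrite (perm_big _ (mi_pairs_lower J k))/= big_allpairs_dep big_filter.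
  apply: eq_bigr => r _; rewrite /bser /series/= mulr_sumr.
  by apply: eq_bigr => j _; rewrite mulrCA mulrA.
under [X in _ = _ - X]eq_bigr => r _ do rewrite mulrBr.
rewrite sumrB [X in _ = _ - (_ - X)](bigID (fun r => mi_deg r < k)%N)/=; ring.
Qed.

Lemma remainder_le y J k : cube y ->
  (1 - theta) * nrm (u y - taylor_sum y J k) <=
  \sum_(r <- mi_lower J k | ~~ (mi_deg r < k)%N) nrm (tc r) +
  (rho J)^-1 * \sum_(r <- mi_lower J k) nrm (tc r).
Proof.
move=> yc; have /andP[t0 t1] := theta01.
have Hts s : H (sigma y s *: tc s) by exact: H_scale (H_tc s).
have He : H (u y - taylor_sum y J k) by apply: H_sub; [exact: u_H|exact: H_sum].
have sg0 r : `|sigma y r| <= 1 by exact: sigma_norm_le1.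
apply: (@Bform_coercive y) => //.
  rewrite addr_ge0 ?sumr_ge0// => [r _|]; first exact: nrm_ge0.
  rewrite mulr_ge0 ?invr_ge0 ?(ltW (rho_gt0 _))// sumr_ge0// => r _; exact: nrm_ge0.
move=> v Hv; rewrite remainder_form// (le_trans (ler_normB _ _))// normrN mulrDl.
rewrite lerD// (le_trans (ler_norm_sum _ _ _))// ?mulr_suml -?mulrA ?mulr_suml ?mulr_sumr;
    apply: ler_sum => r _; rewrite normrM.
  have h := le_trans (ler_norm_sum _ _ _) (bser_abs_le J yc (H_tc r) Hv).
  have n0 : 0 <= nrm (tc r) * nrm v by rewrite mulr_ge0 ?nrm_ge0.
  rewrite (le_trans (ler_wpM2r _ (sg0 r)))// mul1r (le_trans h)//.
  by rewrite ler_piMl// ltW.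
by rewrite (le_trans (ler_wpM2r _ (sg0 r)))// mul1r blim_tail//; exact: H_tc.
Qed.

(** First k makes the top level small, then J, depending on e, makes 1/rho_J small against
    [nrm_total], a bound independent of J and k. *)
Lemma taylor_sum_cvg y e : cube y -> 0 < e ->
  exists n0, forall k, (n0 <= k)%N ->
  exists J0, forall J, (J0 <= J)%N -> nrm (u y - taylor_sum y J k) <= e.
Proof.
move=> yc e0; have /andP[t0 t1] := theta01.
have c0 : 0 < 1 - theta by lra.
have e1 : 0 < (1 - theta) * e / 2 by rewrite !mulr_gt0.
have [k0 k0P] := level_nrm_small e1; exists k0 => k kk.
have N0 : 0 <= nrm_total by have := sum_nrm_le (isT : uniq [::]); rewrite big_nil.
have [J0 J0P] := rho_unbounded (nrm_total / ((1 - theta) * e / 2)).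
exists J0 => J JJ; rewrite -(ler_pM2l c0).
apply: le_trans (remainder_le J k yc) _.
have h1 : \sum_(r <- mi_lower J k | ~~ (mi_deg r < k)%N) nrm (tc r) <= (1 - theta) * e / 2.
  rewrite -big_filter; apply: (k0P k) => //; first exact/filter_uniq/mi_lower_uniq.
  by move=> s; rewrite mem_filter -leqNgt => /andP[ks /mem_mi_lower[_ sk]]; lia.
have h2 : (rho J)^-1 * \sum_(r <- mi_lower J k) nrm (tc r) <= (1 - theta) * e / 2.
  rewrite ler_pdivrMl ?rho_gt0// (le_trans (sum_nrm_le (mi_lower_uniq J k)))//.
  have := lt_le_trans J0P (rho_nd JJ); rewrite ltr_pdivrMr// => /ltW.
  by [].
lra.
Qed.

(** The error splits into an arbitrarily small Taylor remainder, the terms outside [L], and the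
    replacement of monomials by [a] inside [L]. *)
Lemma taylor_approx y L (a : multi_index -> R) A B : cube y -> uniq L ->
  (forall M, uniq M -> (forall s, s \in M -> s \notin L) ->
     \sum_(s <- M) nrm (tc s) <= A) ->
  \sum_(s <- L) `|sigma y s - a s| * nrm (tc s) <= B ->
  nrm (u y - \sum_(s <- L) a s *: tc s) <= A + B.
Proof.
move=> yc uL hA hB; apply/ler_addgt0Pr => e e0.
have [n0 n0P] := taylor_sum_cvg yc e0.
have [m mP] := sub_mi_box L.
pose k := maxn n0 (\max_(s <- L) mi_deg s).
have [J0 J0P] := n0P k (leq_maxl _ _).
pose J := maxn J0 m.
have LF : {subset L <= mi_lower J k}.
  move=> s sL; apply/mem_mi_lower; split.
    have := mP J (maxn m k) (leq_maxr _ _) (leq_maxl _ _) s sL.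
    by move=> /mem_mi_box[].
  by rewrite leq_max (leq_bigmax_seq s)// orbT.
have Hs (w : multi_index -> R) s : H (w s *: tc s) by exact: H_scale (H_tc s).
have HS w (M : seq multi_index) P : H (\sum_(s <- M | P s) w s *: tc s).
  by apply: H_sum => s _; exact: Hs.
have Hu := u_H yc.
have -> : u y - \sum_(s <- L) a s *: tc s =
  (u y - taylor_sum y J k) +
  (\sum_(s <- mi_lower J k | s \notin L) sigma y s *: tc s +
   \sum_(s <- L) (sigma y s - a s) *: tc s).
  have -> : \sum_(s <- L) (sigma y s - a s) *: tc s =
      \sum_(s <- L) sigma y s *: tc s - \sum_(s <- L) a s *: tc s.
    by rewrite -sumrB; apply: eq_bigr => s _; rewrite scalerBl.
  have -> : taylor_sum y J k = \sum_(s <- L) sigma y s *: tc s +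
      \sum_(s <- mi_lower J k | s \notin L) sigma y s *: tc s.
    rewrite /taylor_sum (bigID (fun s => s \in L))/=; congr (_ + _).
    rewrite -big_filter; apply: perm_big; apply: uniq_perm => //.
      exact/filter_uniq/mi_lower_uniq.
    by move=> s; rewrite mem_filter andb_idr//; exact: LF.
  set p := \sum_(s <- L) sigma y s *: tc s; set p' := \sum_(s <- L) a s *: tc s.
  set z := \sum_(s <- mi_lower J k | _) _.
  rewrite [RHS]addrA [X in _ = X + _](_ : _ = u y - p); first by rewrite addrA subrK.
  by rewrite opprD addrA subrK.
have Hd : H (u y - taylor_sum y J k) by apply: H_sub => //; exact: HS.
apply: le_trans (nrm_triangle Hd (H_add (HS _ _ _) (HS _ _ _))) _.
rewrite addrC lerD//; last by apply: J0P; exact: leq_maxl.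
apply: le_trans (nrm_triangle (HS _ _ _) (HS _ _ _)) _; apply: lerD.
  rewrite -big_filter; apply: le_trans (nrm_sum_le _ (Hs _)) _.
  apply: (@le_trans _ _ (\sum_(s <- [seq s <- mi_lower J k | s \notin L]) nrm (tc s))).
    apply: ler_sum => s _; rewrite nrm_scale; last exact: H_tc.
    by rewrite ler_piMl ?nrm_ge0// sigma_norm_le1.
  apply: hA; first exact/filter_uniq/mi_lower_uniq.
  by move=> s; rewrite mem_filter => /andP[].
apply: le_trans hB; apply: le_trans (nrm_sum_le _ (Hs _)) _.
by apply: ler_sum => s _; rewrite nrm_scale//; exact: H_tc.
Qed.

(** With parameter [tau] in [sum_nrm_tc] the energy and sigma terms of the tail are both of order
    [tau], so the tail is at most [nrm_total] times [tau]. *)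
Lemma taylor_error y L (a : multi_index -> R) (tau delta : R) :
  cube y -> uniq L -> 0 < tau -> 0 <= delta ->
  (forall M, uniq M -> (forall s, s \in M -> s \notin L) ->
     \sum_(s <- M) (sigma rho s) ^- 2 <= tau ^+ 2 * S2) ->
  (forall s, s \in L -> `|sigma y s - a s| <= delta) ->
  H (u y - \sum_(s <- L) a s *: tc s) /\
  nrm (u y - \sum_(s <- L) a s *: tc s) <= nrm_total * (tau + delta).
Proof.
move=> yc uL t0 d0 tail dL; split.
  by apply: H_sub; [exact: u_H|apply: H_sum => s _; exact: H_scale (H_tc s)].
rewrite mulrDr; apply: (taylor_approx yc uL).
  move=> M uM ML; apply: le_trans (sum_nrm_tc M t0) _.
  rewrite /nrm_total -mulrA ler_wpM2l// mulrDl lerD//.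
    by rewrite mulrC ler_wpM2r ?(ltW t0)// sum_energy.
  by rewrite ler_pdivrMl// mulrCA -expr2 mulrC tail.
apply: (@le_trans _ _ (\sum_(s <- L) delta * nrm (tc s))).
  by rewrite big_seq [leRHS]big_seq; apply: ler_sum => s sL; rewrite ler_wpM2r ?nrm_ge0 ?dL.
by rewrite -mulr_sumr mulrC ler_wpM2r// sum_nrm_le.
Qed.

End parametric_form.

(** * Weighted sums over multi-indices *)

Section rho_sums.
Context {R : realType}.
Variables (q : R) (rho : nat -> R).
Hypothesis q_range : 0 < q < 2.
Hypothesis rho_gt1 : forall j, 1 < rho j.
Hypothesis rho_nd : nondecreasing_seq rho.
Hypothesis rho_lq : (\sum_(0 <= j <oo) (((rho j)^-1) `^ q)%:E < +oo)%E.

Let q_gt0 : 0 < q. Proof. by case/andP: q_range. Qed.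
Let rho_ge1 j : 1 <= rho j. Proof. exact: ltW. Qed.
Let rhog0 j : 0 < rho j. Proof. exact: lt_trans (rho_gt1 j). Qed.

Lemma sigma_rho_ge1 s : 1 <= sigma rho s.
Proof. exact: sigma_ge1. Qed.

Lemma sigma_powR_ge1 s : 1 <= sigma rho s `^ q.
Proof. by rewrite -(powRr0 (sigma rho s)) ler_powR ?sigma_rho_ge1 ?ltW. Qed.

Let w j : R := (rho j) `^ (- q).

Let w0 j : 0 <= w j. Proof. exact: powR_ge0. Qed.

Let wE j : w j = ((rho j)^-1) `^ q.
Proof. by rewrite /w -powR_inv1 ?(ltW (rhog0 j))// -powRrM mulN1r. Qed.

Lemma rho_partial_sums : exists T, forall J, \sum_(0 <= j < J) rho j `^ (- q) <= T.
Proof.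
exists (fine (\sum_(0 <= j <oo) (((rho j)^-1) `^ q)%:E)) => J.
have s0 : (0 <= \sum_(0 <= j <oo) (((rho j)^-1) `^ q)%:E)%E.
  by apply: nneseries_ge0 => j _ _; rewrite lee_fin powR_ge0.
rewrite -lee_fin fineK; last by rewrite ge0_fin_numE.
rewrite -sumEFin; under eq_bigr => j _ do rewrite [rho j `^ _]wE.
by apply: nneseries_lim_ge => j _; rewrite lee_fin powR_ge0.
Qed.

Lemma rho_unbounded x : exists J, x < rho J.
Proof.
have [T TP] := rho_partial_sums.
apply: contrapT => /forallNP h.
have hx j : rho j <= x by rewrite leNgt; exact/negP/h.
have x0 : 0 < x by exact: lt_le_trans (rhog0 0%N) (hx 0%N).
pose e := x `^ (- q); have e0 : 0 < e by exact: powR_gt0.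
have hw j : e <= w j.
  rewrite /e /w !powRN lef_pV2 ?posrE ?powR_gt0//.
  by rewrite ge0_ler_powR ?nnegrE ?(ltW q_gt0) ?(ltW x0) ?(ltW (rhog0 _)).
have := TP (Num.truncn (T / e)).+1.
apply/negP; rewrite -ltNge.
apply: (@lt_le_trans _ _ (\sum_(0 <= j < (Num.truncn (T / e)).+1) e)); last first.
  by apply: ler_sum => j _; exact: hw.
rewrite sumr_const_nat subn0 -mulr_natl -ltr_pdivrMr//.
exact: truncnS_gt.
Qed.

(** The sum is bounded by the product of the series 1/(1 - w_j), and 1/(1 - w_j) <= exp(c w_j) with
    one constant c = 1/(1 - w_0), since w_0 is the largest weight. *)
Lemma sum_sigma_powR : exists2 S : R, 1 <= S &
  forall L, uniq L -> \sum_(s <- L) sigma rho s `^ (- q) <= S.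
Proof.
have [T TP] := rho_partial_sums.
have w01 : w 0 < 1.
  rewrite /w powRN invf_lt1 ?powR_gt0// [ltLHS](_ : 1 = 1 `^ q); last by rewrite powR1.
  by rewrite gt0_ltr_powR ?nnegrE ?ler01 ?(ltW (rhog0 _)).
have ww j : w j <= w 0.
  rewrite /w !powRN lef_pV2 ?posrE ?powR_gt0//.
  by rewrite ge0_ler_powR ?nnegrE ?(ltW q_gt0) ?(ltW (rhog0 _))// rho_nd.
pose c := (1 - w 0)^-1; have c0 : 0 < c by rewrite invr_gt0 subr_gt0.
have S_bound L : uniq L -> \sum_(s <- L) sigma rho s `^ (- q) <= expR (c * T).
  move=> uL; have [n nL] := sub_mi_box L.
  under eq_bigr => s _ do rewrite -sigma_powR//.
  apply: (@le_trans _ _ (\sum_(s <- mi_box n n) sigma w s)).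
    apply: (ler_sum_sub uL) => [|s]; first exact: nL.
    by rewrite /sigma; apply: prodr_ge0 => j _; exact/exprn_ge0/w0.
  rewrite sum_mi_box; apply: (@le_trans _ _ (\prod_(j < n) expR (c * w j))).
    apply: ler_prod => j _; apply/andP; split.
      by apply: sumr_ge0 => i _; exact/exprn_ge0/w0.
    have j1 : 0 < 1 - w j by rewrite subr_gt0 (le_lt_trans (ww j)).
    apply: (@le_trans _ _ (1 + w j / (1 - w j))).
      rewrite -(ler_pM2r j1) mulrDl divfK ?gt_eqF// mul1r subrK.
      have -> : (\sum_(i < n.+1) w j ^+ i) * (1 - w j) = 1 - w j ^+ n.+1.
        elim: n.+1 => [|k IH]; first by rewrite big_ord0 mul0r subrr.
        by rewrite big_ord_recr/= mulrDl IH exprS; ring.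
      by rewrite gerBl exprn_ge0.
    apply: le_trans (expR_ge1Dx _) _; rewrite ler_expR mulrC ler_wpM2r//.
    by rewrite lef_pV2 ?posrE// ?subr_gt0// lerD2l lerN2.
  rewrite -expR_sum ler_expR -mulr_sumr ler_wpM2l ?(ltW c0)//.
  by rewrite -(big_mkord xpredT w) TP.
exists (Num.max 1 (expR (c * T))); first by rewrite le_max lexx.
by move=> L uL; rewrite le_max S_bound ?orbT.
Qed.

Lemma sigma_sqr_le s : (sigma rho s) ^- 2 <= sigma rho s `^ (- q).
Proof.
have s1 := sigma_rho_ge1 s.
rewrite powRN lef_pV2 ?posrE ?exprn_gt0 ?powR_gt0 ?(lt_le_trans ltr01)//.
rewrite -powR_mulrn ?(le_trans ler01)// ler_powR//.
by case/andP: q_range => _ /ltW.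
Qed.

(** Write sigma^2 = (sigma^q)^(2/q - 1) sigma^q: the exponent is nonnegative as q < 2, and sigma^q >
    xi outside Lambda. This is the source of the rate 1/q - 1/2. *)
Lemma sigma_sqr_tail xi s : 0 < xi -> ~ Lambda rho q xi s ->
  (sigma rho s) ^- 2 <= xi `^ (- (2 / q - 1)) * sigma rho s `^ (- q).
Proof.
move=> xi0 /negP; rewrite -ltNge => sx.
have s1 := sigma_rho_ge1 s.
have s0 : 0 < sigma rho s by exact: lt_le_trans s1.
have a0 : 0 <= 2 / q - 1.
  by case/andP: q_range => _ /ltW q2; rewrite subr_ge0 ler_pdivlMr// mul1r.
rewrite !powRN -invfM lef_pV2 ?posrE ?mulr_gt0 ?exprn_gt0 ?powR_gt0//.
apply: (@le_trans _ _ ((sigma rho s `^ q) `^ (2 / q - 1) * sigma rho s `^ q)).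
  rewrite ler_wpM2r ?powR_ge0// ge0_ler_powR ?nnegrE ?powR_ge0 ?(ltW xi0) ?(ltW sx)//.
rewrite -powRrM -powRD; last by apply/implyP => _; rewrite gt_eqF.
rewrite -powR_mulrn ?(ltW s0)//; rewrite (_ : _ + _ = 2%:R)//.
by field; rewrite gt_eqF.
Qed.

Lemma Lambda_seq (xi : R) : exists2 L : seq multi_index,
  uniq L & [set` L] = Lambda rho q xi.
Proof.
have [x1|x1] := ltP xi 1.
  exists [::] => //; apply/seteqP; split=> // s; rewrite /Lambda/= => sx.
  by have := lt_le_trans x1 (sigma_powR_ge1 s); rewrite ltNge sx.
have x0 : 0 < xi by exact: lt_le_trans x1.
have sx s : Lambda rho q xi s -> sigma rho s <= xi `^ q^-1.
  rewrite /Lambda/= => h; have s1 := sigma_rho_ge1 s.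
  have -> : sigma rho s = (sigma rho s `^ q) `^ q^-1.
    by rewrite -powRrM divff ?gt_eqF// powRr1// (le_trans ler01).
  by rewrite ge0_ler_powR ?nnegrE ?powR_ge0 ?invr_ge0 ?(ltW q_gt0) ?(ltW x0).
have [J JP] := rho_unbounded (xi `^ q^-1).
have lr : 0 < ln (rho 0) by exact: ln_gt0.
(* All rho_j are at least rho_0, so sigma_s is at least rho_0 to the degree, which bounds the degree
   by this logarithm. *)
pose k := Num.truncn (ln (xi `^ q^-1) / ln (rho 0)).
exists (seq.filter (fun s => sigma rho s `^ q <= xi) (mi_box J k)).
  exact/filter_uniq/mi_box_uniq.
apply/seteqP; split=> s; rewrite /= mem_filter; first by case/andP.
move=> Ls; apply/andP; split; first exact: Ls.
apply/mem_mi_box; split=> j.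
  move=> sj; rewrite ltnNge; apply/negP => jJ.
  have := le_trans (sigma_ge_coord rho_ge1 sj) (sx s Ls).
  by apply/negP; rewrite -ltNge (lt_le_trans JP)// rho_nd.
apply: leq_trans (mi_deg_ge s j) _; rewrite /k truncn_ge_nat; last first.
  by rewrite divr_ge0 ?ln_ge0 ?(ltW lr)// -(powRr0 xi) ler_powR// invr_ge0 ltW.
rewrite ler_pdivlMr// mulr_natl -lnXn// ler_ln ?posrE ?exprn_gt0 ?powR_gt0//.
apply: le_trans (sx s Ls); apply: sigma_ge_deg => [|i]; first exact: ltW.
exact: rho_nd.
Qed.

Lemma Lambda_lower xi (s r : multi_index) : (forall j, (r j <= s j)%N) ->
  Lambda rho q xi s -> Lambda rho q xi r.
Proof.
move=> rs; rewrite /Lambda/=; apply: le_trans; rewrite ge0_ler_powR//.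
- exact: ltW.
- by rewrite nnegrE (le_trans ler01)// sigma_rho_ge1.
- by rewrite nnegrE (le_trans ler01)// sigma_rho_ge1.
- exact: sigma_mono.
Qed.

Lemma Lambda_deg xi s : Lambda rho q xi s -> (mi_deg s)%:R * (q * ln (rho 0)) <= ln xi.
Proof.
rewrite /Lambda/= => sx; have x0 : 0 < xi.
  exact: lt_le_trans (lt_le_trans ltr01 (sigma_powR_ge1 s)) sx.
apply: (@le_trans _ _ (ln (sigma rho s `^ q))); last first.
  by rewrite ler_ln// posrE powR_gt0// (lt_le_trans ltr01)// sigma_rho_ge1.
rewrite ln_powR mulrCA ler_pM2l// mulr_natl -lnXn//.
rewrite ler_ln ?posrE ?exprn_gt0// ?(lt_le_trans ltr01 (sigma_rho_ge1 s))//.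
by apply: sigma_ge_deg => [|i]; [exact: ltW|exact: rho_nd].
Qed.

(** Each member contributes at least 1/xi to a sum bounded by S. *)
Lemma Lambda_size S xi L :
  (forall L, uniq L -> \sum_(s <- L) sigma rho s `^ (- q) <= S) ->
  0 < xi -> uniq L -> (forall s, s \in L -> Lambda rho q xi s) ->
  (size L)%:R <= S * xi.
Proof.
move=> hS x0 uL hL; rewrite -ler_pdivrMr//; apply: le_trans (hS L uL).
rewrite -sum1_size natr_sum mulr_suml big_seq [leRHS]big_seq.
apply: ler_sum => s /hL sx; rewrite mul1r powRN lef_pV2 ?posrE//.
exact: lt_le_trans (sigma_powR_ge1 s).
Qed.

(** As rho is nondecreasing, Lambda then contains the j + 1 unit multi-indices e_0, ..., e_j. So the
    number of members also bounds the input dimension. *)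
Lemma Lambda_supp xi L s j : [set` L] = Lambda rho q xi -> s \in L -> (s j != 0)%N ->
  (j < size L)%N.
Proof.
move=> LE sL sj.
have sx : Lambda rho q xi s by rewrite -LE.
rewrite -[j.+1](size_iota 0) -(size_map (mi_inc mi0)).
apply: uniq_leq_size.
  rewrite map_inj_uniq ?iota_uniq// => i k /(congr1 (fun s : multi_index => s k)).
  by rewrite !mi_incE eqxx !mi0E; case: eqVneq => [->|].
move=> r /mapP[i]; rewrite mem_iota add0n => /= ij ->.
suff : Lambda rho q xi (mi_inc mi0 i) by rewrite -LE.
move: sx; rewrite /Lambda/=; apply: le_trans; rewrite sigma_inc sigma0 mulr1.
have ji := le_trans (rho_nd (ij : (i <= j)%N)) (sigma_ge_coord rho_ge1 sj).
apply: ge0_ler_powR ji; first exact: ltW.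
  by rewrite nnegrE ltW.
by rewrite nnegrE (le_trans ler01)// sigma_rho_ge1.
Qed.

End rho_sums.

(** * The elliptic problem *)

Section null_sets.
Context d (T : measurableType d) (R : realType).
Import HBNNSimple.
Variable mu : {measure set T -> \bar R}.

Lemma Lnorm_oo_ae (f : T -> \bar R) : \forall x \ae mu, (`|f x| <= 'N[mu]_+oo[f])%E.
Proof.
rewrite unlock; case: ifPn => [_|]; first exact: ess_sup_ge.
rewrite -leNgt => mT; exists setT; split=> //.
by apply/eqP; rewrite eq_le mT measure_ge0.
Qed.

Let nnint (f : T -> \bar R) := ereal_sup [set sintegral mu h |
  h in [set h : {nnsfun T >-> R} | forall x, ((h x)%:E <= f x)%E]].

(** Cutting a simple function below f off on [N] keeps its integral and puts it below g. *)
Let nnint_null (f g : T -> \bar R) N : measurable N -> mu N = 0%E ->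
  (forall x, 0 <= g x)%E -> (forall x, ~ N x -> f x = g x) -> (nnint f <= nnint g)%E.
Proof.
move=> mN N0 g0 fg; apply: ge_ereal_sup => _ [h hf <-].
have mCN : measurable (~` N) by exact: measurableC.
have hE x : mul_nnsfun h (indic_nnsfun R mCN) x = h x * \1_(~` N) x by [].
apply: ereal_sup_ubound; exists (mul_nnsfun h (indic_nnsfun R mCN)).
  move=> x; rewrite hE indicE; have [xN|xN] := pselect (N x).
    by rewrite memNset/= ?mulr0//; apply.
  by rewrite mem_set//= mulr1 -fg.
rewrite -!integralT_nnsfun; apply: ae_eq_integral => //.
- exact/measurable_EFinP.
- exact/measurable_EFinP.
exists N; split=> // x xP; apply: contrapT => xN; apply: xP => _.
by rewrite hE indicE mem_set//= mulr1.
Qed.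

(* No measurability is assumed: lower integrals ignore null sets. *)
Lemma integral_setD_null (D N : set T) (f : T -> \bar R) :
  measurable N -> mu N = 0%E ->
  (\int[mu]_(x in D) f x = \int[mu]_(x in D `\` N) f x)%E.
Proof.
move=> mN N0.
have e x : ~ N x -> (f \_ D) x = (f \_ (D `\` N)) x.
  move=> xN; rewrite !patchE; congr (if _ then _ else _).
  by apply/idP/idP => /set_mem h; apply/mem_set => //; case: h.
have nn (p q : T -> \bar R) : (forall x, 0 <= p x)%E -> (forall x, 0 <= q x)%E ->
    (forall x, ~ N x -> p x = q x) -> nnint p = nnint q.
  move=> p0 q0 pq; apply/eqP; rewrite eq_le (nnint_null mN N0 q0 pq)/=.
  by apply: (nnint_null mN N0 p0) => x /pq.
rewrite /integral; congr (_ - _)%E; apply: nn => x; rewrite ?funepos_ge0 ?funeneg_ge0//.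
  by move=> /e ex; rewrite !funeposE ex.
by move=> /e ex; rewrite !funenegE ex.
Qed.

End null_sets.

(** * Gradient forms with bounded weights *)

Section weighted_form.
Context {R : realType} {n : nat}.
Local Notation d := n.+1.
Local Notation E := 'rV[R]_d.
Local Notation leb := (lebesgue_rV R d).
Variable D : set E.
Hypothesis oD : open D.
Let mD : measurable D := domain_measurable oD.
Implicit Types (g h : E -> R) (u v w : @sobolev_fun R d).

Definition grad_prod v w (x : E) : R := \sum_i v.2 i x * w.2 i x.

Definition wform g v w : R := \int[leb]_(x in D) (g x * grad_prod v w x).

Definition weight g : Prop :=
  measurable_fun D g /\ exists M, forall x, D x -> `|g x| <= M.

Lemma grad_prod_integrable v w : gradL2 D v -> gradL2 D w ->
  leb.-integrable D (EFin \o grad_prod v w).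
Proof.
move=> Lv Lw; have := @integrable_sum _ _ _ leb D mD _ (index_enum 'I_d) xpredT
  (fun i x => (v.2 i x * w.2 i x)%:E).
move=> /(_ (fun i _ => L2_mul_integrable mD (Lv i) (Lw i))).
by apply: eq_integrable => // x _; rewrite sumEFin.
Qed.

Lemma wform_integrable g v w : weight g -> gradL2 D v -> gradL2 D w ->
  leb.-integrable D (EFin \o (fun x => g x * grad_prod v w x)).
Proof.
move=> [mg [M gM]] Lv Lw; have iP := grad_prod_integrable Lv Lw.
apply: (le_integrable mD _ _ (integrableZl mD M iP)).
  apply/measurable_EFinP; apply: measurable_funM => //.
  by apply/measurable_EFinP; exact: measurable_int iP.
move=> x Dx /=; rewrite lee_fin !normrM ler_wpM2r//.
by rewrite (le_trans (gM x Dx))// ler_norm.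
Qed.

Lemma grad_prod_linear a u v w x :
  grad_prod (a *: u + v) w x = a * grad_prod u w x + grad_prod v w x.
Proof.
rewrite /grad_prod mulr_sumr -big_split; apply: eq_bigr => i _.
change ((a * u.2 i x + v.2 i x) * w.2 i x =
  a * (u.2 i x * w.2 i x) + v.2 i x * w.2 i x).
by ring.
Qed.

Lemma grad_prodC v w x : grad_prod v w x = grad_prod w v x.
Proof. by apply: eq_bigr => i _; rewrite mulrC. Qed.

Lemma grad_prod_ge0 v x : 0 <= grad_prod v v x.
Proof. by apply: sumr_ge0 => i _; rewrite -expr2 sqr_ge0. Qed.

Lemma grad_prod_norm_le v w x :
  `|grad_prod v w x| <= 2^-1 * (grad_prod v v x + grad_prod w w x).
Proof.
rewrite /grad_prod (le_trans (ler_norm_sum _ _ _))// -big_split/= mulr_sumr.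
apply: ler_sum => i _; rewrite ler_norml.
have := sqr_ge0 (v.2 i x + w.2 i x); have := sqr_ge0 (v.2 i x - w.2 i x).
by rewrite !expr2 => *; apply/andP; split; nra.
Qed.

Lemma wform_linear g a u v w : weight g -> gradL2 D u -> gradL2 D v ->
  gradL2 D w -> wform g (a *: u + v) w = a * wform g u w + wform g v w.
Proof.
move=> wg Lu Lv Lw; have i1 := wform_integrable wg Lu Lw.
rewrite /wform -RintegralZl// -RintegralD//; last 2 first.
- exact: integrable_realZ.
- exact: wform_integrable wg Lv Lw.
by apply: eq_Rintegral => x _; rewrite grad_prod_linear; ring.
Qed.

Lemma wformC g v w : wform g v w = wform g w v.
Proof. by apply: eq_Rintegral => x _; rewrite grad_prodC. Qed.

Lemma wform_le g h v : weight g -> weight h -> gradL2 D v ->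
  (forall x, D x -> g x <= h x) -> wform g v v <= wform h v v.
Proof.
move=> wg wh Lv gh; apply: le_Rintegral => //.
- exact: wform_integrable.
- exact: wform_integrable.
- by move=> x Dx; rewrite ler_wpM2r ?grad_prod_ge0// gh.
Qed.

Lemma weightZ a g : weight g -> weight (fun x => a * g x).
Proof.
move=> [mg [M gM]]; split; first exact: measurable_funM.
by exists (`|a| * M) => x Dx; rewrite normrM ler_wpM2l// gM.
Qed.

Lemma weight_norm g : weight g -> weight (fun x => `|g x|).
Proof.
move=> [mg [M gM]]; split; first exact: measurableT_comp.
by exists M => x Dx; rewrite normr_id gM.
Qed.

Lemma weight_cst a : weight (cst a).
Proof. by split=> //; exists `|a|. Qed.

Lemma weight_sum (g : nat -> E -> R) J : (forall j, weight (g j)) ->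
  weight (fun x => \sum_(0 <= j < J) g j x).
Proof.
move=> wg; split; first by apply: measurable_sum => j; case: (wg j).
have /choice[M MP] : forall j, exists M, forall x, D x -> `|g j x| <= M.
  by move=> j; case: (wg j).
exists (\sum_(0 <= j < J) M j) => x Dx.
by rewrite (le_trans (ler_norm_sum _ _ _))//; apply: ler_sum => j _; exact: MP.
Qed.

Lemma wformZ a g v w : weight g -> gradL2 D v -> gradL2 D w ->
  wform (fun x => a * g x) v w = a * wform g v w.
Proof.
move=> wg Lv Lw; rewrite /wform -RintegralZl//; last exact: wform_integrable.
by apply: eq_Rintegral => x _; rewrite mulrA.
Qed.

Lemma wformD g h v w : weight g -> weight h -> gradL2 D v -> gradL2 D w ->
  wform (fun x => g x + h x) v w = wform g v w + wform h v w.
Proof.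
move=> wg wh Lv Lw; rewrite /wform -RintegralD//; [|exact: wform_integrable..].
by apply: eq_Rintegral => x _; rewrite mulrDl.
Qed.

Lemma wform0 v w : wform (cst 0) v w = 0.
Proof.
rewrite /wform -[RHS](_ : \int[leb]_(x in D) (0 : R) = 0).
  by apply: eq_Rintegral => x _; rewrite mul0r.
by rewrite Rintegral_cst// mul0r.
Qed.

Lemma wform_sum (g : nat -> E -> R) J v w : (forall j, weight (g j)) ->
  gradL2 D v -> gradL2 D w ->
  wform (fun x => \sum_(0 <= j < J) g j x) v w = \sum_(0 <= j < J) wform (g j) v w.
Proof.
move=> wg Lv Lw; elim: J => [|J IH].
  rewrite [RHS]big_geq// -[RHS](wform0 v w); apply: eq_Rintegral => x _.
  by rewrite big_geq.
rewrite big_nat_recr//= -IH -wformD//; last exact: weight_sum.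
by apply: eq_Rintegral => x _; rewrite big_nat_recr.
Qed.

Lemma wform_cst a v w : gradL2 D v -> gradL2 D w ->
  wform (cst a) v w = a * grad_dot D v w.
Proof.
move=> Lv Lw; have wa := weight_cst a.
rewrite /wform RintegralZl//; last exact: grad_prod_integrable.
congr (_ * _); apply: EFin_inj.
rewrite -Rintegral_EFin//; last exact: grad_prod_integrable.
rewrite /grad_dot -sumEFin.
under [RHS]eq_bigr do rewrite (L2dot_EFin mD (Lv _) (Lw _)).
rewrite -integral_sum//; last by move=> i; exact: L2_mul_integrable (Lv i) (Lw i).
by apply: eq_integral => x _; rewrite sumEFin.
Qed.

Lemma wform_norm_le g v w : weight g -> gradL2 D v -> gradL2 D w ->
  `|wform g v w| <= 2^-1 * (wform (fun x => `|g x|) v v + wform (fun x => `|g x|) w w).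
Proof.
move=> wg Lv Lw; have wag := weight_norm wg.
rewrite (le_trans (le_normr_Rintegral mD (wform_integrable wg Lv Lw)))//.
have i1 := wform_integrable wag Lv Lv; have i2 := wform_integrable wag Lw Lw.
rewrite /wform -RintegralD// -RintegralZl//; last exact: integrable_realD.
apply: le_Rintegral => //.
- by have := wform_integrable wg Lv Lw; exact: integrable_norm.
- by apply: integrable_realZ => //; exact: integrable_realD.
- move=> x _; rewrite normrM -mulrDr mulrCA ler_wpM2l//.
  exact: grad_prod_norm_le.
Qed.

Lemma wform_cvg (g_ : nat -> E -> R) g M v w :
  (forall k, measurable_fun D (g_ k)) -> (forall k x, D x -> `|g_ k x| <= M) ->
  (forall x, D x -> g_ ^~ x @ \oo --> g x) -> gradL2 D v -> gradL2 D w ->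
  weight g /\ wform (g_ k) v w @[k --> \oo] --> wform g v w.
Proof.
move=> mg gM gl Lv Lw.
have wg : weight g.
  split; first exact: measurable_fun_cvg mg gl.
  exists M => x Dx.
  have cn : `|g_ k x| @[k --> \oo] --> `|g x| by apply: cvg_norm; exact: gl.
  rewrite -(cvg_lim _ cn)//; apply: limr_le; first by apply/cvg_ex; eexists; exact: cn.
  by apply: nearW => k; exact: gM.
have wgk k : weight (g_ k) by split=> //; exists M => x; exact: gM.
split=> //.
have iP := grad_prod_integrable Lv Lw.
have mP : measurable_fun D (grad_prod v w).
  by apply/measurable_EFinP; exact: measurable_int iP.
have [|||||_ _] := @dominated_convergence _ _ _ leb D mD
  (fun k x => (g_ k x * grad_prod v w x)%:E)
  (fun x => (g x * grad_prod v w x)%:E)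
  (fun x => (M * `|grad_prod v w x|)%:E).
- by move=> k; apply/measurable_EFinP; exact: measurable_funM.
- apply/measurable_EFinP; apply: measurable_funM => //; exact: (proj1 wg).
- apply: aeW => x Dx; apply: cvg_EFin; first by apply: nearW.
  by apply: cvgM; [exact: gl|exact: cvg_cst].
- by apply: integrable_realZ => //; exact: integrable_norm.
- by apply: aeW => x k Dx /=; rewrite lee_fin normrM ler_wpM2r// gM.
rewrite (Rintegral_EFin mD (wform_integrable wg Lv Lw)) => h.
exact: (fine_cvg h).
Qed.

End weighted_form.

Section elliptic_problem.
Context {R : realType} {n : nat}.
Local Notation d := n.+1.
Local Notation E := 'rV[R]_d.
Local Notation leb := (lebesgue_rV R d).
Variables (D : set E) (abar : E -> R) (psi : nat -> E -> R) (rho : nat -> R).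
Hypothesis oD : open D.
Hypothesis bD : bounded_set D.
Let mD : measurable D := domain_measurable oD.
Hypothesis rho_gt1 : forall j, 1 < rho j.
Hypothesis abar_oo : in_Lp +oo%E D abar.
Hypothesis abar_inf :
  (0 < ess_inf leb (patch (cst +oo) D (EFin \o abar)))%E.
Hypothesis psi_oo : forall j, in_Lp +oo%E D (psi j).
Hypothesis psi_sum : ('N[leb]_+oo[(fun x =>
  (\sum_(0 <= j <oo) (rho j * `|psi j x|)%:E) * ((abar x)^-1)%:E) \_ D] < 1)%E.

(** Turns the three essential bounds of the problem into pointwise ones off a single null set. *)
Lemma coef_bounds : exists a0 a1 theta N,
  [/\ 0 < a0, 0 <= theta < 1, measurable N, leb N = 0%E &
   forall x, D x -> ~ N x -> [/\ a0 <= abar x, abar x <= a1 &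
     forall J, \sum_(0 <= j < J) rho j * `|psi j x| <= theta * abar x]].
Proof.
have [a0 a0_gt0 a0P] : exists2 a0 : R, 0 < a0 &
    (a0%:E <= ess_inf leb (patch (cst +oo) D (EFin \o abar)))%E.
  move: abar_inf; case: (ess_inf _ _) => [r||//] r0; first by exists r.
  by exists 1; rewrite ?leey.
have [a1 a1P] : exists a1 : R, ('N[leb]_+oo[EFin \o (abar \_ D)] <= a1%:E)%E.
  have := proj2 abar_oo; rewrite /Lp_norm; case: ('N[_]__[_])%E => [r||] //.
    by move=> _; exists r.
  by move=> _; exists 0; rewrite leNye.
have [th th01 thP] : exists2 th : R, 0 <= th < 1 & ('N[leb]_+oo[(fun x =>
    (\sum_(0 <= j <oo) (rho j * `|psi j x|)%:E) * ((abar x)^-1)%:E) \_ D] <= th%:E)%E.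
  move: psi_sum; case: ('N[_]__[_])%E => [r||] //.
    move=> r1; exists (Num.max 0 r); last by rewrite lee_fin le_max lexx orbT.
    by rewrite le_max lexx/= gt_max ltr01.
  by move=> _; exists 0; rewrite ?lexx ?ltr01 ?leNye.
have h1 := ess_inf_le leb (patch (cst +oo%E) D (EFin \o abar)).
have h2 := Lnorm_oo_ae leb (EFin \o (abar \_ D)).
have h3 := Lnorm_oo_ae leb ((fun x =>
    (\sum_(0 <= j <oo) (rho j * `|psi j x|)%:E) * ((abar x)^-1)%:E)%E \_ D).
have [N [mN N0 NP]] : \forall x \ae leb, D x -> [/\ a0 <= abar x, abar x <= a1 &
     forall J, \sum_(0 <= j < J) rho j * `|psi j x| <= th * abar x].
  apply: filterS3 h1 h2 h3 => x e1 + + Dx.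
  rewrite {2}/patch mem_set//= in e1; rewrite /= !patchE mem_set//= => e2 e3.
  have a0x : a0 <= abar x by rewrite -lee_fin (le_trans a0P).
  have ax0 : 0 < abar x by exact: lt_le_trans a0x.
  split=> //.
    by rewrite (le_trans (ler_norm _))// -lee_fin (le_trans e2).
  move=> J; rewrite -ler_pdivrMr// -lee_fin.
  apply: le_trans (le_trans e3 thP); rewrite EFinM.
  apply: le_trans (lee_abs _); rewrite lee_wpmul2r ?lee_fin ?invr_ge0 ?(ltW ax0)//.
  rewrite -sumEFin; apply: nneseries_lim_ge => j _.
  by rewrite lee_fin mulr_ge0// ltW// (lt_trans ltr01).
exists a0, a1, th, N; split=> // x Dx xN.
by apply: contrapT => h; apply: xN; apply: NP => /= /(_ Dx).
Qed.

Lemma dominated_cvg0 (T : Type) (F : set_system T) {FF : Filter F} (k : R)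
    (g h : T -> R) :
  (\forall x \near F, 0 <= g x <= k * h x) ->
  h x @[x --> F] --> (0 : R) -> g x @[x --> F] --> (0 : R).
Proof.
move=> gh h0; apply: (squeeze_cvgr gh); first exact: cvg_cst.
by rewrite -[X in _ --> X](mulr0 k); apply: cvgM => //; exact: cvg_cst.
Qed.

Variables (a0 a1 theta : R) (N : set E).
Hypothesis a0_gt0 : 0 < a0.
Hypothesis theta01 : 0 <= theta < 1.
Hypothesis mN : measurable N.
Hypothesis N0 : leb N = 0%E.
Hypothesis coefP : forall x, D x -> ~ N x -> [/\ a0 <= abar x, abar x <= a1 &
     forall J, \sum_(0 <= j < J) rho j * `|psi j x| <= theta * abar x].

Let rho_gt0 j : 0 < rho j. Proof. exact: lt_trans (rho_gt1 j). Qed.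

(* Coefficients corrected on the exceptional null set, where no bound holds. *)
Definition abar_corr (x : E) : R := \1_(~` N) x * abar x + \1_N x.
Definition psi_corr j (x : E) : R := \1_(~` N) x * psi j x.

Lemma coef_corrE x : ~ N x ->
  abar_corr x = abar x /\ forall j, psi_corr j x = psi j x.
Proof.
by move=> xN; split=> [|j]; rewrite /abar_corr /psi_corr !indicE mem_set// ?memNset//
  mul1r ?addr0.
Qed.

Lemma coef_corr_null x : N x -> abar_corr x = 1 /\ forall j, psi_corr j x = 0.
Proof.
by move=> xN; split=> [|j]; rewrite /abar_corr /psi_corr !indicE ?(mem_set xN) memNset//;
  rewrite mul0r ?add0r.
Qed.

(** The corrected coefficient equals 1 on the null set, so its bounds must enclose 1 too. *)
Let lo : R := Num.min a0 1.
Let hi : R := Num.max a1 1.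

Let lo_gt0 : 0 < lo. Proof. by rewrite lt_min a0_gt0 ltr01. Qed.
Let hi_gt0 : 0 < hi. Proof. by rewrite lt_max ltr01 orbT. Qed.

Lemma coef_corrP x : D x -> [/\ lo <= abar_corr x, abar_corr x <= hi &
  forall J, \sum_(0 <= j < J) rho j * `|psi_corr j x| <= theta * abar_corr x].
Proof.
move=> Dx; have /andP[t0 t1] := theta01; have [xN|xN] := pselect (N x).
  have [-> p0] := coef_corr_null xN; split; rewrite ?ge_min ?le_max ?lexx ?orbT//.
  by move=> J; rewrite big1 ?mulr1// => j _; rewrite p0 normr0 mulr0.
have [-> pE] := coef_corrE xN; have [h1 h2 h3] := coefP Dx xN.
split; rewrite ?ge_min ?le_max ?h1 ?h2//.
by move=> J; under eq_bigr do rewrite pE; exact: h3.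
Qed.

Let m_indic (A : set E) : measurable A -> measurable_fun D (\1_A : E -> R).
Proof. by move=> mA; apply: measurable_funTS; exact: measurable_indic. Qed.

Lemma weight_abar : weight D abar_corr.
Proof.
split.
  apply: measurable_funD; last exact: m_indic.
  apply: measurable_funM; last exact: (proj1 abar_oo).
  exact: m_indic (measurableC mN).
exists hi => x Dx; have [h1 h2 _] := coef_corrP Dx.
by rewrite ger0_norm// (le_trans (ltW lo_gt0)).
Qed.

Lemma sum_psi_le x J : D x -> \sum_(0 <= j < J) `|psi_corr j x| <= hi.
Proof.
move=> Dx; have [h1 h2 h3] := coef_corrP Dx; have /andP[t0 t1] := theta01.
apply: (@le_trans _ _ (theta * abar_corr x)).
  apply: le_trans (h3 J); apply: ler_sum => j _.
  by rewrite ler_peMl// ltW.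
apply: le_trans h2; apply: ler_piMl; last exact: ltW.
exact: le_trans (ltW lo_gt0) h1.
Qed.

Lemma weight_psi j : weight D (psi_corr j).
Proof.
split.
  apply: measurable_funM; last exact: (proj1 (psi_oo j)).
  exact: m_indic (measurableC mN).
exists hi => x Dx; apply: le_trans (sum_psi_le j.+1 Dx).
by rewrite big_nat_recr//= lerDr sumr_ge0.
Qed.

Definition ell_form := wform D abar_corr.
Definition ell_b j := wform D (psi_corr j).
Definition ell_c j v := wform D (fun x => rho j * `|psi_corr j x|) v v.

Let weight_c j : weight D (fun x => rho j * `|psi_corr j x|).
Proof. exact/weightZ/weight_norm/weight_psi. Qed.

Let gL v : H10 D v -> gradL2 D v. Proof. exact: H10_gradL2. Qed.

Lemma ell_form_lower v : gradL2 D v -> lo * grad_dot D v v <= ell_form v v.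
Proof.
move=> Lv; rewrite -(wform_cst oD lo Lv Lv).
apply: (wform_le oD (weight_cst D lo) weight_abar Lv) => x Dx.
by case: (coef_corrP Dx).
Qed.

Lemma ell_form_upper v : gradL2 D v -> ell_form v v <= hi * grad_dot D v v.
Proof.
move=> Lv; rewrite -(wform_cst oD hi Lv Lv).
apply: (wform_le oD weight_abar (weight_cst D hi) Lv) => x Dx.
by case: (coef_corrP Dx).
Qed.

Lemma ell_form_ge0 v : gradL2 D v -> 0 <= ell_form v v.
Proof.
move=> Lv; apply: le_trans (ell_form_lower Lv).
by rewrite mulr_ge0 ?grad_dot_ge0// ltW.
Qed.

Lemma ell_bc j v w : gradL2 D v -> gradL2 D w ->
  rho j * `|ell_b j v w| <= 2^-1 * (ell_c j v + ell_c j w).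
Proof.
move=> Lv Lw; have wn := weight_norm (weight_psi j).
rewrite /ell_c !(wformZ oD)// -mulrDr mulrCA ler_wpM2l ?(ltW (rho_gt0 j))//.
exact: wform_norm_le (weight_psi j) Lv Lw.
Qed.

Lemma ell_c_ge0 j v : gradL2 D v -> 0 <= ell_c j v.
Proof.
move=> Lv; rewrite -(wform0 oD v v).
apply: (wform_le oD (weight_cst D 0) (weight_c j) Lv) => x _.
by rewrite mulr_ge0// ltW.
Qed.

Lemma ell_c_sum J v : gradL2 D v ->
  \sum_(0 <= j < J) ell_c j v <= theta * ell_form v v.
Proof.
move=> Lv; rewrite -(wform_sum oD _ weight_c Lv Lv).
rewrite -(wformZ oD theta weight_abar Lv Lv).
apply: (wform_le oD _ _ Lv).
- exact: weight_sum weight_c.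
- exact: weightZ weight_abar.
- by move=> x Dx; case: (coef_corrP Dx).
Qed.

(** Dominated convergence, with the constant [hi + hi] bounding all partial sums of the corrected
    coefficient, identifies its integral with the series of forms. The given coefficient agrees with
    it off [N], hence has the same integral. *)
Lemma affine_form y v w : cube y -> gradL2 D v -> gradL2 D w ->
  (\int[leb]_(x in D) (affine_coef abar psi y x * grad_prod v w x)%:E =
   (Bform ell_form ell_b y v w)%:E)%E.
Proof.
move=> yc Lv Lw.
pose g_ k x := abar_corr x + \sum_(0 <= j < k) y j * psi_corr j x.
pose g x := affine_coef abar_corr psi_corr y x.
have wyp j : weight D (fun x => y j * psi_corr j x) by exact/weightZ/weight_psi.
have mg k : measurable_fun D (g_ k).
  by apply: measurable_funD; [case: weight_abar|case: (weight_sum k wyp)].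
have sle x k : D x -> \sum_(0 <= j < k) `|y j * psi_corr j x| <= hi.
  move=> Dx; apply: le_trans (sum_psi_le k Dx); apply: ler_sum => j _.
  by rewrite normrM ler_piMl.
have gM k x : D x -> `|g_ k x| <= hi + hi.
  move=> Dx; rewrite (le_trans (ler_normD _ _))// lerD//.
    by have [h1 h2 _] := coef_corrP Dx; rewrite ger0_norm// (le_trans (ltW lo_gt0)).
  by rewrite (le_trans (ler_norm_sum _ _ _))// sle.
have gl x : D x -> g_ ^~ x @ \oo --> g x.
  move=> Dx; apply: cvgD; first exact: cvg_cst.
  have := @is_cvg_series_bounded _ (fun j => y j * psi_corr j x) hi (sle x ^~ Dx).
  by [].
have [wg gcv] := wform_cvg oD mg gM gl Lv Lw.
have -> : Bform ell_form ell_b y v w = wform D g v w.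
  rewrite /Bform; suff -> : blim ell_b y v w = wform D g v w - ell_form v w by rewrite addrC subrK.
  apply: cvg_lim => //.
  have -> : bser ell_b y v w = (fun k => wform D (g_ k) v w - ell_form v w).
    apply/funext => k; rewrite /g_ (wformD oD weight_abar (weight_sum k wyp) Lv Lw).
    rewrite addrC addKr (wform_sum oD _ wyp Lv Lw); apply: eq_bigr => j _.
    by rewrite (wformZ oD _ (weight_psi j) Lv Lw).
  by apply: cvgB => //; exact: cvg_cst.
rewrite -(Rintegral_EFin mD (wform_integrable oD wg Lv Lw)).
apply: (etrans (integral_setD_null D _ mN N0)); apply/esym.
apply: (etrans (integral_setD_null D _ mN N0)); apply/esym.
apply: eq_integral => x /set_mem[Dx xN]; congr (_ * _)%:E.
have [aE pE] := coef_corrE xN; rewrite /g /affine_coef aE; congr (_ + _).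
by congr (limn _); apply/funext => k; apply: eq_bigr => j _; rewrite pE.
Qed.

Local Notation "''nrm' v" := (nrm ell_form v) (at level 8, v at level 2).

Lemma sqrt_grad_le v : gradL2 D v ->
  Num.sqrt (grad_dot D v v) <= (Num.sqrt lo)^-1 * 'nrm v.
Proof.
move=> Lv; rewrite ler_pdivlMl ?sqrtr_gt0// -sqrtrM ?(ltW lo_gt0)//.
by rewrite ler_sqrt ?ell_form_ge0// ell_form_lower.
Qed.

Lemma nrm_le_grad v : gradL2 D v ->
  'nrm v <= Num.sqrt hi * Num.sqrt (grad_dot D v v).
Proof.
move=> Lv; rewrite -sqrtrM ?(ltW hi_gt0)// ler_sqrt ?ell_form_upper//.
by rewrite mulr_ge0 ?grad_dot_ge0// ltW.
Qed.

Lemma ocube_near y j : ocube y -> \forall h \near (0 : R)^', ocube (y + h *: unit_seq j).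
Proof.
move=> yo; have e0 : 0 < 1 - `|y j| by rewrite subr_gt0.
near=> h => i; change (`|y i + h * (i == j)%:R| < 1).
have [->|_] := eqVneq i j; last by rewrite mulr0 addr0.
rewrite mulr1 (le_lt_trans (ler_normD _ _))// -ltrBrDl.
near: h; apply: dnbhs0_lt; exact: e0.
Unshelve. all: by end_near. Qed.

(** Energy and gradient norm are equivalent, so they define the same derivatives. Near h = 0 the
    quotients lie in [H10], where the gradient norm is a finite square root. *)
Lemma is_pderivP U y j z : ocube y -> (forall y', ocube y' -> H10 D (U y')) ->
  is_pd (H10 D) ell_form j U y z <-> is_pderiv D j U y z.
Proof.
move=> yo HU; rewrite /is_pd /is_pderiv.
have Lq : H10 D z -> \forall h \near (0 : R)^', gradL2 D (dquot U j y h - z).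
  move=> Hz; apply: filterS (ocube_near j yo) => h yh; apply: gL.
  apply: (H10B oD bD _ Hz); have Hd := H10B oD bD (HU _ yh) (HU _ yo).
  by have := H10_linear oD bD h^-1 Hd (H10_0 oD bD); rewrite addr0.
split=> -[Hz hz]; split=> //.
  apply: cvg_EFin; first by apply: filterS (Lq Hz) => h Lh; rewrite grad_normE.
  apply: (dominated_cvg0 (k := (Num.sqrt lo)^-1)) hz.
  apply: filterS (Lq Hz) => h Lh; rewrite /= grad_normE//= sqrtr_ge0/=.
  exact: sqrt_grad_le.
apply: (dominated_cvg0 (k := Num.sqrt hi)) (fine_cvg hz).
apply: filterS (Lq Hz) => h Lh; rewrite /= grad_normE//= nrm_ge0/=.
exact: nrm_le_grad.
Qed.

Lemma ell_complete (v_ : nat -> @sobolev_fun R d) : (forall k, H10 D (v_ k)) ->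
  (forall e, 0 < e -> exists N, forall k l, (N <= k)%N -> (N <= l)%N ->
     'nrm (v_ k - v_ l) <= e) ->
  exists2 v, H10 D v &
    forall e, 0 < e -> exists N, forall k, (N <= k)%N -> 'nrm (v_ k - v) <= e.
Proof.
move=> Hv cv; have slo : 0 < Num.sqrt lo by rewrite sqrtr_gt0.
have shi : 0 < Num.sqrt hi by rewrite sqrtr_gt0.
have [|v Hv' vP] := H10_complete oD bD Hv.
  move=> e e0; have [|M MP] := cv (Num.sqrt lo * Num.sqrt e).
    by rewrite mulr_gt0// sqrtr_gt0.
  exists M => k l Mk Ml; rewrite -(ler_sqrt _ (ltW e0)).
  apply: le_trans (sqrt_grad_le (gL (H10B oD bD (Hv k) (Hv l)))) _.
  by rewrite ler_pdivrMl// MP.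
exists v => // e e0; have [|M MP] := vP ((e / Num.sqrt hi) ^+ 2).
  by rewrite exprn_gt0// divr_gt0.
exists M => k Mk; apply: le_trans (nrm_le_grad (gL (H10B oD bD (Hv k) Hv'))) _.
rewrite mulrC -ler_pdivlMr//; move: (MP k Mk).
have q0 : 0 <= e / Num.sqrt hi by rewrite divr_ge0// ltW.
by move: (e / _) q0 => q q0 h; rewrite -(ger0_norm q0) -sqrtr_sqr ler_sqrt ?sqr_ge0.
Qed.

Lemma pderiv_word_cons u j w y : ocube y ->
  (forall y', ocube y' -> H10 D (foldr (pderiv D) u w y')) ->
  (exists z, is_pd (H10 D) ell_form j (foldr (pderiv D) u w) y z) ->
  is_pd (H10 D) ell_form j (foldr (pderiv D) u w) y (foldr (pderiv D) u (j :: w) y).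
Proof.
move=> yo HU [z /(is_pderivP _ _ yo HU) hz]; apply/(is_pderivP _ _ yo HU).
exact: (@xgetPex _ 0 [set w' | is_pderiv D j (foldr (pderiv D) u w) y w'] (ex_intro _ z hz)).
Qed.

Lemma infinite_cubeP (y : nat -> R) : infinite_cube y <-> cube y.
Proof. by split=> h j; have := h j; rewrite ler_norml. Qed.

Lemma elliptic_taylor_error_aux f (S2 : R) : nondecreasing_seq rho ->
  (forall L, uniq L -> \sum_(s <- L) (sigma rho s) ^- 2 <= S2) ->
  (forall x, exists J, x < rho J) -> dual_H10 D f ->
  exists C0 : R, forall u, parametric_solution D abar psi f u ->
  forall y L (a : multi_index -> R) (tau delta : R), infinite_cube y -> uniq L ->
  0 < tau -> 0 <= delta ->
  (forall M, uniq M -> (forall s, s \in M -> s \notin L) ->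
     \sum_(s <- M) (sigma rho s) ^- 2 <= tau ^+ 2 * S2) ->
  (forall s, s \in L -> `|sigma y s - a s| <= delta) ->
  (grad_norm D (u y - \sum_(s <- L) a s *: taylor_coef D u s)%R <=
   (C0 * (tau + delta))%:E)%E.
Proof.
move=> rho_nd S2P rho_unb [f_lin [B fB]].
have slo : 0 < Num.sqrt lo by rewrite sqrtr_gt0.
(* The absolute value is taken because the bound [B] comes without a sign. *)
pose F := `|B| * (Num.sqrt lo)^-1.
exists ((Num.sqrt lo)^-1 * nrm_total theta F S2) => u usol.
move=> y L a tau delta yc uL t0 d0 tail dL.
have f_bound w : H10 D w -> `|f w| <= F * 'nrm w.
  move=> Hw; rewrite -lee_fin; apply: le_trans (fB w Hw) _.
  rewrite (grad_normE oD (gL Hw)) -EFinM lee_fin -mulrA.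
  apply: (@le_trans _ _ (`|B| * Num.sqrt (grad_dot D w w))).
    by rewrite ler_wpM2r ?sqrtr_ge0// ler_norm.
  by rewrite ler_wpM2l// sqrt_grad_le//; exact: gL.
have u_H y' : cube y' -> H10 D (u y') by move=> /infinite_cubeP /usol[].
have u_eq y' w : cube y' -> H10 D w -> Bform ell_form ell_b y' (u y') w = f w.
  move=> yc' Hw; have [Hu /(_ w Hw)] := usol y' ((infinite_cubeP y').2 yc').
  by have := affine_form yc' (gL Hu) (gL Hw); rewrite /grad_prod => -> [].
have lin g a' u' v' w' : weight D g -> H10 D u' -> H10 D v' -> H10 D w' ->
    wform D g (a' *: u' + v') w' = a' * wform D g u' w' + wform D g v' w'.
  by move=> wg Hu Hv Hw; exact: (wform_linear oD a' wg (gL Hu) (gL Hv) (gL Hw)).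
have [Hr err] : H10 D (u y - \sum_(s <- L) a s *: tc (foldr (pderiv D) u) s) /\
    'nrm (u y - \sum_(s <- L) a s *: tc (foldr (pderiv D) u) s) <=
    nrm_total theta F S2 * (tau + delta).
  have h1 a' u' v' w' : H10 D u' -> H10 D v' -> H10 D w' ->
      ell_form (a' *: u' + v') w' = a' * ell_form u' w' + ell_form v' w'.
    exact: lin weight_abar.
  have h2 j a' u' v' w' : H10 D u' -> H10 D v' -> H10 D w' ->
      ell_b j (a' *: u' + v') w' = a' * ell_b j u' w' + ell_b j v' w'.
    exact: lin (weight_psi j).
  exact (taylor_error (H10_0 oD bD) (H10_linear oD bD) h1 (wformC D abar_corr)
    (fun v Hv => ell_form_ge0 (gL Hv)) h2 (fun j => wformC D (psi_corr j))
    rho_gt1 theta01 (fun j v w Hv Hw => ell_bc j (gL Hv) (gL Hw))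
    (fun j v Hv => ell_c_ge0 j (gL Hv)) (fun J v Hv => ell_c_sum J (gL Hv))
    rho_nd f_bound ell_complete u_H u_eq (erefl : foldr (pderiv D) u [::] = u)
    (@pderiv_word_cons u)
    S2P rho_unb ((infinite_cubeP y).1 yc) uL t0 d0 tail dL).
have tcE s : tc (foldr (pderiv D) u) s = taylor_coef D u s.
  by rewrite /tc /taylor_coef mixed_pderiv_word.
under eq_bigr => s _ do rewrite -tcE.
rewrite (grad_normE oD (gL Hr)) lee_fin -mulrA.
apply: le_trans (sqrt_grad_le (gL Hr)) _.
by rewrite ler_wpM2l// invr_ge0 ltW.
Qed.

End elliptic_problem.

Lemma elliptic_taylor_error (R : realType) n (D : set 'rV[R]_n.+1)
    (abar : 'rV[R]_n.+1 -> R) (psi : nat -> 'rV[R]_n.+1 -> R) (rho : nat -> R)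
    (f : @sobolev_fun R n.+1 -> R) (S2 : R) :
  open D -> bounded_set D -> (forall j, 1 < rho j) -> nondecreasing_seq rho ->
  (forall L, uniq L -> \sum_(s <- L) (sigma rho s) ^- 2 <= S2) ->
  (forall x, exists J, x < rho J) ->
  in_Lp +oo%E D abar ->
  (0 < ess_inf (lebesgue_rV R n.+1) (patch (cst +oo) D (EFin \o abar)))%E ->
  (forall j, in_Lp +oo%E D (psi j)) ->
  ('N[lebesgue_rV R n.+1]_+oo[(fun x =>
    (\sum_(0 <= j <oo) (rho j * `|psi j x|)%:E) * ((abar x)^-1)%:E) \_ D] < 1)%E ->
  dual_H10 D f ->
  exists C0 : R, forall u, parametric_solution D abar psi f u ->
  forall y L (a : multi_index -> R) (tau delta : R), infinite_cube y -> uniq L ->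
  0 < tau -> 0 <= delta ->
  (forall M, uniq M -> (forall s, s \in M -> s \notin L) ->
     \sum_(s <- M) (sigma rho s) ^- 2 <= tau ^+ 2 * S2) ->
  (forall s, s \in L -> `|sigma y s - a s| <= delta) ->
  (grad_norm D (u y - \sum_(s <- L) a s *: taylor_coef D u s)%R <=
   (C0 * (tau + delta))%:E)%E.
Proof.
move=> oD bD rho1 rho_nd S2P rho_unb aoo ainf poo psum df.
have [a0 [a1 [th [N [a00 th01 mN N0 cP]]]]] := coef_bounds rho1 aoo ainf psum.
exact: (elliptic_taylor_error_aux oD bD rho1 aoo poo a00 th01 mN N0 cP).
Qed.

(** * Networks for monomials *)

Section product_tree.
Context {R : realType}.
Variables (lft rgt : multi_index -> multi_index) (r : nat).
Implicit Types (s t : multi_index) (y : nat -> R).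
Hypothesis deg_lft : forall s, mi_deg (lft s) = (mi_deg s)./2.
Hypothesis deg_rgt : forall s, (mi_deg (lft s) + mi_deg (rgt s) = mi_deg s)%N.
Hypothesis lft_rgt : forall s j, s j = (lft s j + rgt s j)%N.
Hypothesis sigma_lft_rgt : forall s y,
  sigma y s = sigma y (lft s) * sigma y (rgt s).

(** The value the product tree really computes. The fuel [k] may be the degree, since both halves
    have smaller degree. *)
Fixpoint prod_rec (k : nat) y s : R :=
  if k is k'.+1 then
    if (mi_deg s <= 1)%N then sigma y s
    else mul_approx r (prod_rec k' y (lft s)) (prod_rec k' y (rgt s))
  else sigma y s.

Definition prod_val y s : R := prod_rec (mi_deg s) y s.

Lemma deg_lft_lt s : (1 < mi_deg s)%N -> (0 < mi_deg (lft s) < mi_deg s)%N.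
Proof. by move=> s1; rewrite deg_lft; lia. Qed.

Lemma deg_rgt_lt s : (1 < mi_deg s)%N -> (0 < mi_deg (rgt s) < mi_deg s)%N.
Proof. by move=> s1; have := deg_rgt s; rewrite deg_lft; lia. Qed.

Lemma prod_rec_small k y s : (mi_deg s <= 1)%N -> prod_rec k y s = sigma y s.
Proof. by case: k => //= k ->. Qed.

Lemma prod_rec_fuel k y s : (mi_deg s <= k)%N -> prod_rec k y s = prod_val y s.
Proof.
rewrite /prod_val; have [n] := ubnP (mi_deg s); elim: n s k => // n IH s k sn sk.
have [s1|s1] := leqP (mi_deg s) 1.
  by rewrite !prod_rec_small.
case: k sk => [|k] sk; first by lia.
have e : mi_deg s = (mi_deg s).-1.+1 by lia.
rewrite [in RHS]e /= !ifN -?ltnNge//.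
have l := deg_lft_lt s1; have g := deg_rgt_lt s1.
by congr mul_approx; rewrite IH ?[in RHS]IH//; lia.
Qed.

Lemma prod_val_small y s : (mi_deg s <= 1)%N -> prod_val y s = sigma y s.
Proof. exact: prod_rec_small. Qed.

Lemma prod_valE y s : (1 < mi_deg s)%N ->
  prod_val y s = mul_approx r (prod_val y (lft s)) (prod_val y (rgt s)).
Proof.
move=> s1; have l := deg_lft_lt s1; have g := deg_rgt_lt s1.
rewrite -(@prod_rec_fuel (mi_deg s).-1 y (lft s)); last lia.
rewrite -(@prod_rec_fuel (mi_deg s).-1 y (rgt s)); last lia.
have e : mi_deg s = (mi_deg s).-1.+1 by lia.
by rewrite /prod_val [in LHS]e/= ifN// -ltnNge.
Qed.

(** A tree of degree d contains d - 1 products, each adding one error 4^-(r+1); as all factors are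
    at most 1 in modulus, errors made earlier are not amplified. *)
Lemma prod_val_error y s : (forall j, `|y j| <= 1) ->
  `|prod_val y s - sigma y s| <= (mi_deg s).-1%:R * 4^-1 ^+ r.+1 /\
  `|prod_val y s| <= 1.
Proof.
move=> y1; set e : R := _ ^+ r.+1.
have [n] := ubnP (mi_deg s); elim: n s => // n IH s sn.
have [s1|s1] := leqP (mi_deg s) 1.
  rewrite prod_val_small// subrr normr0 sigma_norm_le1//.
  by rewrite mulr_ge0// exprn_ge0// invr_ge0.
have l := deg_lft_lt s1; have g := deg_rgt_lt s1.
have [|le l1] := IH (lft s); first by lia.
have [|ge g1] := IH (rgt s); first by lia.
have [m1 m2] := mul_approx_bound r l1 g1; rewrite prod_valE//; split=> //.
have -> : (mi_deg s).-1 = ((mi_deg (lft s)).-1 + (mi_deg (rgt s)).-1 + 1)%N.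
  by have := deg_rgt s; lia.
rewrite !natrD !mulrDl mul1r sigma_lft_rgt.
set x := prod_val y (lft s) in le l1 m1 m2 *.
set z := prod_val y (rgt s) in ge g1 m1 m2 *.
set a := sigma y (lft s) in le *; set b := sigma y (rgt s) in ge *.
have -> : mul_approx r x z - a * b = (mul_approx r x z - x * z) + ((x - a) * z + a * (z - b)).
  by ring.
rewrite (le_trans (ler_normD _ _))// addrC lerD// (le_trans (ler_normD _ _))// !normrM.
have a1 : `|a| <= 1 by exact: sigma_norm_le1.
by rewrite lerD//; [apply: le_trans le; rewrite ler_piMr|apply: le_trans ge; rewrite ler_piMl].
Qed.

Lemma prod_val_local y y' s : (forall j, (s j != 0)%N -> y j = y' j) ->
  prod_val y s = prod_val y' s.
Proof.
have [n] := ubnP (mi_deg s); elim: n s => // n IH s sn yy.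
have [s1|s1] := leqP (mi_deg s) 1.
  rewrite !prod_val_small// /sigma; apply: eq_big_seq => j.
  by rewrite mem_nu => /yy ->.
have l := deg_lft_lt s1; have g := deg_rgt_lt s1.
rewrite (prod_valE y s1) (prod_valE y' s1); congr mul_approx; apply: IH.
- by lia.
- by move=> j gj; apply: yy; rewrite lft_rgt; lia.
- by lia.
- by move=> j gj; apply: yy; rewrite lft_rgt; lia.
Qed.

Section network.
Variables (L : seq multi_index) (m T : nat).
Hypothesis L_lower : forall s t, s \in L -> (forall j, (t j <= s j)%N) -> t \in L.
Hypothesis L_supp : forall s j, s \in L -> (s j != 0)%N -> (j < m)%N.
Hypothesis L_deg : forall s, s \in L -> (mi_deg s <= 2 ^ T)%N.

Let G := [seq s <- L | (1 < mi_deg s)%N].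
Let gate (g : nat) : multi_index := nth mi0 G g.
(** Both halves of a gate have degree at most half its own, rounded up, so the rounded-up logarithm
    places them in earlier stages. Degree 2 belongs to stage 0. *)
Let stage (g : nat) : nat := (up_log 2 (mi_deg (gate g))).-1.
Let operand (t : multi_index) : nat + nat :=
  if (mi_deg t == 1)%N then inl (head 0%N (nu t)) else inr (index t G).
Let output (i : nat) : option (nat + nat) :=
  let t := nth mi0 L i in if mi_deg t == 0%N then None else Some (operand t).

Let lft_in s : s \in L -> lft s \in L.
Proof. by move=> sL; apply: (L_lower sL) => j; rewrite (lft_rgt s); lia. Qed.

Let rgt_in s : s \in L -> rgt s \in L.
Proof. by move=> sL; apply: (L_lower sL) => j; rewrite (lft_rgt s); lia. Qed.

Let gateP g : (g < size G)%N -> gate g \in L /\ (1 < mi_deg (gate g))%N.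
Proof. by move=> /(mem_nth mi0); rewrite mem_filter => /andP[-> ->]. Qed.

Lemma mi_deg1 (t : multi_index) : mi_deg t = 1%N ->
  (t (head 0 (nu t)) != 0)%N /\ forall y : nat -> R, sigma y t = y (head 0%N (nu t)).
Proof.
move=> t1; have [j tj] : exists j, (t j != 0)%N.
  apply: contrapT => /forallNP h; have : t = mi0.
    by apply: mi_eq => j; rewrite mi0E; apply/eqP; rewrite -[_ == _]negbK; apply/negP/h.
  by move=> t0; move: t1; rewrite t0 mi_deg0.
have e : mi_deg (mi_dec t j) = 0%N.
  by have := mi_deg_inc (mi_dec t j) j; rewrite mi_decK// t1 => -[].
have {}e : t = mi_inc mi0 j.
  by move/eqP: e; rewrite mi_deg_eq0 => /eqP <-; rewrite mi_decK.
have hd : head 0%N (nu t) = j.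
  have hs : head 0%N (nu t) \in nu t.
    by have : j \in nu t; [rewrite mem_nu|case: (nu t) => //= a l _; rewrite mem_head].
  move: hs; move: (head 0%N (nu t)) => h; rewrite mem_nu e mi_incE mi0E add0n.
  by rewrite eqb0 negbK => /eqP.

by rewrite hd; split=> // y; rewrite e sigma_inc sigma0 mulr1.
Qed.

Let operand_ok i t : t \in L -> (0 < mi_deg t)%N ->
  ((1 < mi_deg t)%N -> ((up_log 2 (mi_deg t)).-1 < i)%N) ->
  operand_wf m (size G) stage i (operand t).
Proof.
move=> tL t0 ti; rewrite /operand; case: eqP => [t1|t1] /=.
  by apply: (L_supp tL); case: (mi_deg1 t1).
have t2 : (1 < mi_deg t)%N by lia.
have tG : t \in G by rewrite mem_filter t2.
by rewrite index_mem tG /stage /gate nth_index//= ti.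
Qed.

Let operand_valE y t : t \in L -> (0 < mi_deg t)%N ->
  operand_val y (fun g => prod_val y (gate g)) (operand t) = prod_val y t.
Proof.
move=> tL t0; rewrite /operand; case: eqP => [t1|t1] /=.
  by rewrite prod_val_small ?t1//; case: (mi_deg1 t1) => _ ->.
by rewrite /gate nth_index// mem_filter tL andbT; lia.
Qed.

(** The last hypothesis says that k is at most d / 2 rounded up; if d is at most a power of 2 above
    1, then k is at most half of that power. *)
Lemma up_log_half d k : (1 < d)%N -> (1 < k)%N -> (k.*2 <= d.+1)%N ->
  ((up_log 2 k).-1 < (up_log 2 d).-1)%N.
Proof.
move=> d1 k1 kd; have := up_logP d (isT : 1 < 2)%N.
case E : (up_log 2 d) => [|[|u]] h; rewrite ?expn0 ?expn1 in h; [lia|lia|].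
suff : (up_log 2 k <= u.+1)%N by lia.
by apply: up_log_min => //; rewrite expnS in h; move: (2 ^ u.+1)%N h => p h; lia.
Qed.

Lemma product_network : exists Phi : @relu_net R (size L) m,
  [/\ net_depth Phi = (T * r.+2).+1,
      (net_size Phi <= 32 * r.+1 * size G + 2 * size L)%N &
      forall (y : nat -> R) (i : 'I_(size L)),
        net_eval Phi (\col_(j < m) y j) i 0 = prod_val y (nth mi0 L i)].
Proof.
have half g : (g < size G)%N ->
    operand_wf m (size G) stage (stage g) (operand (lft (gate g))) /\
    operand_wf m (size G) stage (stage g) (operand (rgt (gate g))).
  move=> /gateP[gL g1]; have l := deg_lft_lt g1; have h := deg_rgt_lt g1.
  have := deg_rgt (gate g); rewrite deg_lft => e.
  split; apply: operand_ok; rewrite ?lft_in ?rgt_in//; try lia.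
    by move=> d1; apply: up_log_half => //; rewrite deg_lft; lia.
  by move=> d1; apply: up_log_half => //; lia.
have [||i iL|Phi [Pd Ps Pe]] := @gate_network R m (size G) T r (size L) stage
    (fun g => operand (lft (gate g))) (fun g => operand (rgt (gate g))) output.
- by move=> g /half[].
- by move=> g /half[].
- rewrite /output; case: eqP => // t0 /=.
  have tL : nth mi0 L i \in L by exact: mem_nth.
  apply: operand_ok => //; first by lia.
  move=> t1; have := up_log_min (isT : 1 < 2)%N (L_deg tL).
  have : (0 < up_log 2 (mi_deg (nth mi0 L i)))%N by rewrite up_log_gt0.
  lia.
exists Phi; split=> // y i.
rewrite (Pe y (fun g => prod_val y (gate g))) => [|g /gateP[gL g1]].
  rewrite /output; case: eqP => [t0|t0] /=.
    by rewrite prod_val_small ?t0// (_ : nth mi0 L i = mi0) ?sigma0//;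
      apply/eqP; rewrite -mi_deg_eq0 t0.
  by rewrite operand_valE//; [exact: mem_nth|lia].
have l := deg_lft_lt g1; have h := deg_rgt_lt g1.
rewrite (operand_valE _ (lft_in gL)); last by case/andP: l.
rewrite (operand_valE _ (rgt_in gL)); last by case/andP: h.
exact: prod_valE.
Qed.

End network.
End product_tree.

Lemma monomial_networks (R : realType) (L : seq multi_index) (m T r : nat) :
  (forall s t : multi_index, s \in L -> (forall j, (t j <= s j)%N) -> t \in L) ->
  (forall (s : multi_index) j, s \in L -> (s j != 0)%N -> (j < m)%N) ->
  (forall s, s \in L -> (mi_deg s <= 2 ^ T)%N) -> (0 < T)%N ->
  exists (Phi : @relu_net R (size L) m)
    (phi : forall s, @relu_net R 1 (size (nu s))),
  [/\ net_depth Phi = (T * r.+2).+1,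
      (net_size Phi <= 32 * r.+1 * count (fun s => 1 < mi_deg s)%N L + 2 * size L)%N,
      deep Phi,
      forall i : 'I_(size L), let s := tnth (in_tuple L) i in
        deep (phi s) /\ forall y : nat -> R,
          eval_first Phi y i 0 = eval_at (phi s) y 0 0 &
      forall (s : multi_index) (y : nat -> R), s \in L -> (forall j, `|y j| <= 1) ->
        `|sigma y s - eval_at (phi s) y 0 0| <= (mi_deg s)%:R * 4^-1 ^+ r.+1].
Proof.
move=> L_lower L_supp L_deg T0.
have /choice[lr lrP] : forall s : multi_index, exists p : multi_index * multi_index,
    [/\ mi_deg p.1 = (mi_deg s)./2, (mi_deg p.1 + mi_deg p.2 = mi_deg s)%N,
     (forall j, s j = p.1 j + p.2 j)%N &
     forall y : nat -> R, sigma y s = sigma y p.1 * sigma y p.2].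
  move=> s; have hk : ((mi_deg s)./2 <= mi_deg s)%N by lia.
  by have [a [b [da db ab sab]]] := mi_split hk; exists (a, b); split.
have hl s : mi_deg (lr s).1 = (mi_deg s)./2 by case: (lrP s).
have hr s : (mi_deg (lr s).1 + mi_deg (lr s).2 = mi_deg s)%N by case: (lrP s).
have hj (s : multi_index) j : (s j = (lr s).1 j + (lr s).2 j)%N by case: (lrP s).
have hs s (y : nat -> R) : sigma y s = sigma y (lr s).1 * sigma y (lr s).2.
  by case: (lrP s).
have [Phi [Pd Ps Pe]] := @product_network R (fun s => (lr s).1) (fun s => (lr s).2) r
  hl hr hj L m T L_lower L_supp L_deg.
pose val (y : nat -> R) s := prod_val (fun s => (lr s).1) (fun s => (lr s).2) r y s.
have dPhi : deep Phi by rewrite /deep Pd; case: (T) T0 => // T' _; lia.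
have h s : exists phi : @relu_net R 1 (size (nu s)), s \in L ->
    deep phi /\ forall y, eval_at phi y 0 0 = val y s.
  have [sL|] := boolP (s \in L); last by exists (OutputLayer 0 0).
  have iL : (index s L < size L)%N by rewrite index_mem.
  (* The component network is the output at s of the full network with all coordinates outside the
     support set to 0. By [prod_val_local] this does not change the output. *)
  exists (net_component (Ordinal iL) (net_pullback Phi
    (\matrix_(j < m, k < size (nu s)) ((j : nat) == nth 0%N (nu s) k)%:R))) => _.
  split; first by rewrite /deep net_component_depth net_pullback_depth.
  move=> y; rewrite /eval_at net_component_eval net_pullback_eval.
  pose y' j := if s j == 0%N then 0 else y j.
  have -> : \matrix_(j < m, k < size (nu s)) ((j : nat) == nth 0%N (nu s) k)%:R *m
      \col_(i < size (nu s)) y (nth 0%N (nu s) i) = \col_(j < m) y' j.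
    apply/matrixP => j k0; rewrite !mxE.
    under eq_bigr => k _ do rewrite !mxE.
    rewrite /y'; case: (eqVneq (s j) 0%N) => sj.
      rewrite big1// => k _; case: eqP => [e|_]; last by rewrite mul0r.
      have : nth 0%N (nu s) k \in nu s by exact: mem_nth.
      by rewrite -e mem_nu sj.
    have js : (index (j : nat) (nu s) < size (nu s))%N by rewrite index_mem mem_nu.
    rewrite (bigD1 (Ordinal js))//= nth_index ?mem_nu// eqxx mul1r big1 ?addr0//.
    move=> k; rewrite -val_eqE/= => kj; case: eqP => [e|_]; last by rewrite mul0r.
    by move: kj; rewrite e index_uniq ?nu_uniq ?eqxx.
  rewrite Pe /= nth_index//; apply: (prod_val_local _ hl hr hj).
  by move=> j sj; rewrite /y' (negPf sj).
pose phi s := projT1 (cid (h s)).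
have phiP s : s \in L -> deep (phi s) /\ forall y, eval_at (phi s) y 0 0 = val y s.
  exact: projT2 (cid (h s)).
exists Phi, phi; split=> //.
- by rewrite -size_filter.
- move=> i s; have sE : s = nth mi0 L i by rewrite /s (tnth_nth mi0).
  have sL : s \in L by rewrite sE mem_nth.
  have [d e] := phiP s sL; split=> // y; rewrite e /eval_first Pe -sE.
  by [].
- move=> s y sL y1; have [_ ->] := phiP s sL; rewrite distrC.
  have [h1 _] := prod_val_error r hl hr hs s y1.
  apply: le_trans h1 _; rewrite ler_wpM2r ?exprn_ge0 ?invr_ge0//.
  by rewrite ler_nat leq_pred.
Qed.

Lemma uniform_ess_sup_le (R : realType) (g : (nat -> R) -> \bar R) (c : \bar R) :
  (forall y, infinite_cube y -> g y <= c)%E -> (uniform_ess_sup g <= c)%E.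
Proof.
move=> gc; apply: ereal_inf_lbound => /=.
have -> : infinite_cube `&` [set y | (c < g y)%E] = set0.
  by apply/seteqP; split=> // y [/gc h] /=; rewrite ltNge h.
apply/eqP; rewrite eq_le; apply/andP; split.
  (* The empty set is covered by cylinders degenerate in their first coordinate, all of measure
     0. *)
  apply: ereal_inf_lbound; exists (fun=> 1%N), (fun _ _ => 0), (fun _ _ => 0); split.
  - by move=> k j; rewrite lexx lerN10 ler01.
  - by [].
  - rewrite eseries0// => k _ _.
    by rewrite /cylinder_measure big_ord_recl big_ord0 subrr mul0r mul0r.
apply: le_ereal_inf_tmp => _ [N [a [b [hab _ ->]]]].
apply: nneseries_ge0 => k _ _; rewrite lee_fin; apply: prodr_ge0 => j _.
by have [_ [h _]] := hab k j; rewrite divr_ge0// subr_ge0.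
Qed.

(** * Logarithmic bounds for the depth, accuracy and dimension *)

Section logarithms.
Context {R : realType}.

(** That e < 4 follows from exp(-1/2) > 1/2. It makes log log n positive for n >= 4 and lets 4^-r
    beat e^-r. *)
Lemma ln4_gt1 : 1 < ln (4 : R).
Proof.
have h : 2^-1 < expR (- 2^-1 : R).
  by apply: le_lt_trans (expR_gt1Dx _); [lra|rewrite oppr_eq0 invr_eq0 pnatr_eq0].
rewrite -ltr_expR lnK ?posrE//.
have -> : expR 1 = (expR (- 2^-1 : R)) ^- 2.
  by rewrite -expRM_natl -expRN; congr expR; field.
by rewrite invf_plt ?posrE ?exprn_gt0 ?expR_gt0// expr2; move: (expR _) h => x; nra.
Qed.

Lemma log_bounds n : (4 <= n)%N -> [/\ 1 < ln (n%:R : R),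
  0 < ln (ln (4 : R)), ln (ln (4 : R)) <= ln (ln n%:R) & ln n%:R <= n%:R :> R].
Proof.
move=> n4; have l4 := ln4_gt1; have n4' : (4 : R) <= n%:R by rewrite ler_nat.
have n0 : 0 < n%:R :> R by lra.
have le4 : ln (4 : R) <= ln n%:R by rewrite ler_ln// posrE.
have l1 : 1 < ln n%:R :> R by exact: lt_le_trans le4.
split=> //; [exact: ln_gt0| |exact/ltW/ln_sublinear].
by rewrite ler_ln// posrE; lra.
Qed.

(** The factor 1 in the truncation is the value of K. As x >= 1, rounding down loses at most a
    factor 2. *)
Lemma dimension_bounds n : (4 <= n)%N -> let x : R := n%:R / ln n%:R in
  [/\ 1 <= x, x <= n%:R, (Num.truncn (1 * x))%:R <= x &
      x <= 2 * (Num.truncn (1 * x))%:R].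
Proof.
move=> n4 x; have [l1 _ _ ln_n] := log_bounds n4.
have l0 : 0 < ln n%:R :> R by lra.
have x1 : 1 <= x by rewrite ler_pdivlMr// mul1r.
split=> //.
- by rewrite ler_pdivrMr// ler_peMr// ltW.
- by rewrite mul1r truncn_le; lra.
- rewrite mul1r; have := truncnS_gt x; have : (0 < Num.truncn x)%N by rewrite truncn_gt0.
  by rewrite -(ler_nat R) -natr1; lra.
Qed.

(** Because log log n >= log log 4 > 0, the additive terms from [kappa] and from rounding are
    absorbed into a multiple of log log n. *)
Lemma stage_count (kappa : R) : 0 < kappa -> exists2 C : R, 0 < C &
  forall n, (4 <= n)%N -> exists T, [/\ (0 < T)%N, T%:R <= C * ln (ln n%:R) &
    kappa * ln n%:R <= 2 ^+ T].
Proof.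
move=> k0; set l4 := ln (ln (4 : R)).
have l40 : 0 < l4 by have [] := log_bounds (leqnn 4).
have l2 : 0 < ln (2 : R) by rewrite ln_gt0// ltr1n.
pose B := (1 + `|ln kappa| / l4) / ln 2.
have B0 : 0 < B by rewrite divr_gt0// ltr_wpDr// divr_ge0// ltW.
exists (B + l4^-1); first by rewrite addr_gt0// invr_gt0.
move=> n n4; have [l1 _ ll _] := log_bounds n4; rewrite -/l4 in ll.
set l := ln (ln n%:R) in ll *; have lp : 0 < l by lra.
exists (Num.truncn (B * l)).+1; split=> //.
  rewrite -natr1 mulrDl lerD//; first by rewrite truncn_le mulr_ge0// ltW.
  by rewrite mulrC ler_pdivlMr// mul1r.
have n0 : 0 < ln n%:R :> R by lra.
rewrite -ler_ln ?posrE ?mulr_gt0 ?exprn_gt0// lnM ?posrE// lnXn// -/l -[leRHS]mulr_natl.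
apply: (@le_trans _ _ (B * l * ln 2)); last first.
  by rewrite ler_wpM2r ?(ltW l2)// ltW// truncnS_gt.
have -> : B * l * ln 2 = l + `|ln kappa| * (l / l4) by rewrite /B; field; rewrite !gt_eqF.
rewrite addrC lerD2l (le_trans (ler_norm _))// ler_peMr//.
by rewrite ler_pdivlMr// mul1r.
Qed.

Lemma accuracy (A : R) n : 0 <= A -> (4 <= n)%N -> let r := Num.truncn (A * ln n%:R) in
  r%:R <= A * ln n%:R /\ (4^-1 : R) ^+ r.+1 <= n%:R `^ (- A).
Proof.
move=> A0 n4 r; have [l1 _ _ _] := log_bounds n4.
have Al : 0 <= A * ln n%:R by rewrite mulr_ge0//; lra.
split; first by rewrite truncn_le.
have n0 : 0 < n%:R :> R by rewrite ltr0n; lia.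
rewrite -ler_ln ?posrE ?exprn_gt0 ?powR_gt0// lnXn// ln_powR lnV ?posrE//.
rewrite mulNrn mulNr lerN2 -[leRHS]mulr_natl.
have h := ltW (truncnS_gt (A * ln n%:R)); have l4 := ln4_gt1.
apply: le_trans h _; rewrite ler_peMr// ?(ltW l4)//.
Qed.

End logarithms.

Section network_family.
Context {R : realType}.
Variables (q : R) (rho : nat -> R).
Hypothesis q_range : 0 < q < 2.
Hypothesis rho_gt1 : forall j, 1 < rho j.
Hypothesis rho_nd : nondecreasing_seq rho.
Hypothesis rho_lq : (\sum_(0 <= j <oo) (((rho j)^-1) `^ q)%:E < +oo)%E.

Let alpha : R := q^-1 - 2^-1.

Let alpha_gt0 : 0 < alpha.
Proof.
by have /andP[q0 q2] := q_range; rewrite subr_gt0 ltf_pV2 ?posrE.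
Qed.

Lemma powR_antitone (a x y : R) : 0 <= a -> 0 < x -> x <= y -> y `^ (- a) <= x `^ (- a).
Proof.
move=> a0 x0 xy; have y0 : 0 < y by exact: lt_le_trans xy.
by rewrite !powRN lef_pV2 ?posrE ?powR_gt0// ge0_ler_powR ?nnegrE ?(ltW x0) ?(ltW y0).
Qed.

Lemma network_step : exists C C3 S : R, [/\ 0 < C, 0 < C3,
  forall L, uniq L -> \sum_(s <- L) (sigma rho s) ^- 2 <= S &
  forall n, (4 <= n)%N -> let x := n%:R / ln n%:R in let m := Num.truncn (1 * x) in
  exists (xi : R) (L : seq multi_index) (Phi : @relu_net R (size L) m)
    (phi : forall s, @relu_net R 1 (size (nu s))),
  [/\ 0 < xi /\ (uniq L /\ [set` L] = Lambda rho q xi),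
      deep Phi, (0 < size L)%N /\ (size L <= m)%N,
      (net_size Phi <= n)%N /\
        (net_depth Phi)%:R <= C * ln n%:R * ln (ln n%:R) &
      forall i : 'I_(size L), let s := tnth (in_tuple L) i in
        deep (phi s) /\ forall y : nat -> R,
          eval_first Phi y i 0 = eval_at (phi s) y 0 0] /\
  exists tau delta : R, [/\ 0 < tau, 0 <= delta, tau + delta <= C3 * x `^ (- alpha),
      forall M, uniq M -> (forall s, s \in M -> s \notin L) ->
        \sum_(s <- M) (sigma rho s) ^- 2 <= tau ^+ 2 * S &
      forall (s : multi_index) (y : nat -> R), s \in L -> infinite_cube y ->
        `|sigma y s - eval_at (phi s) y 0 0| <= delta]].
Proof.
have /andP[q0 q2] := q_range.
have lr0 : 0 < ln (rho 0) by exact: ln_gt0.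
have [S S1 hS] := sum_sigma_powR q_range rho_gt1 rho_nd rho_lq.
have S0 : 0 < S by lra.
pose kappa := (q * ln (rho 0))^-1.
have kappa0 : 0 < kappa by rewrite invr_gt0 mulr_gt0.
have [Ct Ct0 stageP] := stage_count kappa0.
(* The extra power of n pays for the degree, of order log n, in the error of a monomial. *)
pose A := alpha + 1; have A0 : 0 < A by rewrite addr_gt0.
(* There will be at most S eta x members, each costing at most (32 (A + 1) + 2) log n weights; this
   [eta] makes the total n. *)
pose eta := ((32 * (A + 1) + 2) * S)^-1.
have c0 : 34 <= 32 * (A + 1) + 2 by lra.
have c1 : 0 < 32 * (A + 1) + 2 by lra.
have eta0 : 0 < eta by rewrite invr_gt0 mulr_gt0//; lra.
have eta1 : eta <= 1.
  by rewrite invf_le1 ?mulr_gt0//; nra.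
have Seta : S * eta <= 2^-1.
  rewrite /eta invfM mulrCA divff ?gt_eqF// mulr1 lef_pV2 ?posrE//; lra.
exists (2 * Ct * (A + 2)), (eta `^ (- alpha) + kappa), S; split.
- by rewrite !mulr_gt0//; lra.
- by rewrite addr_gt0// powR_gt0.
- move=> L uL; apply: le_trans (hS L uL); apply: ler_sum => s _.
  exact: sigma_sqr_le q_range rho_gt1 s.
move=> n n4 x m.
have [l1 l40 l4l ln_n] := @log_bounds R n n4; have l0 : 0 < ln n%:R :> R by lra.
have [x1 xn mx xm] := @dimension_bounds R n n4; rewrite -/x -/m in x1 xn mx xm.
have x0 : 0 < x by lra.
have n0 : 0 < n%:R :> R by lra.
(* With xi >= 1 the zero multi-index belongs to Lambda, so the network has an output. *)
pose xi := Num.max 1 (eta * x).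
have xi1 : 1 <= xi by rewrite le_max lexx.
have xi0 : 0 < xi by lra.
have xi_n : xi <= n%:R.
  rewrite ge_max; apply/andP; split; first by lra.
  by apply: le_trans xn; rewrite ler_piMl// ltW.
have [L uL LE] := Lambda_seq q_range rho_gt1 rho_nd rho_lq xi.
have LP s : s \in L -> Lambda rho q xi s by move=> sL; rewrite -LE.
have LN s : s \notin L -> ~ Lambda rho q xi s by move=> /negP sL; rewrite -LE.
have mi0L : mi0 \in L.
  have : Lambda rho q xi mi0 by rewrite /Lambda/= sigma0 powR1.
  by rewrite -LE.
have L_size : (size L)%:R <= S * xi by exact: Lambda_size hS xi0 uL LP.
have deg_le s : s \in L -> (mi_deg s)%:R <= kappa * ln n%:R.
  move=> /LP sx; rewrite /kappa ler_pdivlMl ?mulr_gt0// mulrC.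
  by apply: le_trans (Lambda_deg q_range rho_gt1 rho_nd sx) _; rewrite ler_ln// posrE.
have [T [T0 Tl kT]] := stageP n n4.
have L_deg s : s \in L -> (mi_deg s <= 2 ^ T)%N.
  by move=> /deg_le h; rewrite -(ler_nat R) natrX (le_trans h).
have [r_le acc] := accuracy (ltW A0) n4; set r := Num.truncn _ in r_le acc.
have size_cases : L = [:: mi0] \/ (size L)%:R <= S * eta * x.
  have [ex1|ex1] := leP (eta * x) 1; last first.
    have e : xi = eta * x by rewrite /xi max_r// ltW.
    by right; rewrite -mulrA -e.
  left; have xiE : xi = 1 by rewrite /xi max_l.
  have all0 s : s \in L -> s = mi0.
    move=> /LP sx; apply/eqP; rewrite -mi_deg_eq0 -(eqr_nat R) eq_le ler0n andbT.
    have := Lambda_deg q_range rho_gt1 rho_nd sx.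
    by rewrite xiE ln1 pmulr_lle0// mulr_gt0.
  case: (L) uL mi0L all0 => [|s [|t l]] //=.
    by move=> _ _ /(_ s (mem_head _ _)) ->.
  move=> /andP[+ _] _ a0; rewrite (a0 s) ?mem_head// (a0 t) ?inE ?eqxx ?orbT//.
have L_m : (size L <= m)%N.
  case: size_cases => [->|Lx] /=.
    by rewrite /m mul1r truncn_gt0.
  rewrite -(ler_nat R) (le_trans Lx)//.
  apply: (@le_trans _ _ (2^-1 * x)); first by rewrite ler_wpM2r// ltW.
  by rewrite ler_pdivrMl.
have [||||Phi [phi [Pd Ps dPhi iP eP]]] := @monomial_networks R L m T r.
- move=> s t /LP sx ts; have : Lambda rho q xi t by exact (Lambda_lower q_range rho_gt1 ts sx).
  by rewrite -LE.
- move=> s j sL sj; apply: leq_trans L_m.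
  exact: (Lambda_supp q_range rho_gt1 rho_nd LE sL sj).
- exact: L_deg.
- exact: T0.
exists xi, L, Phi, phi; split.
  split=> //.
  - by split=> //; case: (L) mi0L.
  - split.
      apply: leq_trans Ps _; case: size_cases => [->|Lx].
        rewrite (_ : count _ _ = 0%N) ?muln0; last by rewrite /= mi_deg0.
        exact: leq_trans n4.
      apply: (@leq_trans (32 * r.+1 * size L + 2 * size L)).
        by rewrite leq_add2r leq_mul2l count_size orbT.
      rewrite -(ler_nat R) natrD !natrM -mulrDl.
      apply: (@le_trans _ _ ((32 * (A + 1) + 2) * ln n%:R * (S * eta * x))).
        apply: ler_pM => //.
        have r1 : r.+1%:R <= (A + 1) * ln n%:R :> R.
          by rewrite -natr1 mulrDl mul1r lerD// ltW.
        rewrite [leRHS]mulrDl -[in leRHS]mulrA; apply: lerD; first by rewrite ler_pM2l.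
        by rewrite ler_peMr// ltW.
      rewrite /eta /x.
      have -> : (32 * (A + 1) + 2) * ln n%:R *
          (S * ((32 * (A + 1) + 2) * S)^-1 * (n%:R / ln n%:R)) = n%:R :> R.
        by field; rewrite !gt_eqF.
      by [].
  - rewrite Pd -natr1 natrM.
    have r2 : r.+2%:R <= (A + 2) * ln n%:R :> R by
      rewrite -addn2 natrD mulrDl lerD// ler_peMr// ltW.
    set ll := ln (ln n%:R) in l4l Tl *.
    have T1 : (1 : R) <= T%:R by rewrite ler1n.
    have r1 : (1 : R) <= r.+2%:R by rewrite ler1n.
    apply: (@le_trans _ _ (2 * (T%:R * r.+2%:R))).
      by rewrite [leRHS]mulr_natl mulr2n lerD2l mulr_ege1.
    have -> : 2 * Ct * (A + 2) * ln n%:R * ll = 2 * ((Ct * ll) * ((A + 2) * ln n%:R)) by ring.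
    by rewrite ler_pM2l// ler_pM.
(* The square of the first number is the factor in [sigma_sqr_tail]; the second is the largest
   degree times the accuracy of one product. *)
exists (xi `^ (- alpha)), (kappa * ln n%:R * n%:R `^ (- A)); split.
- exact: powR_gt0.
- by rewrite !mulr_ge0 ?powR_ge0// ltW.
- rewrite mulrDl lerD//.
    rewrite -powRM ?(ltW eta0) ?(ltW x0)//; apply: powR_antitone; rewrite ?(ltW alpha_gt0)//.
      by rewrite mulr_gt0.
    by rewrite le_max lexx orbT.
  rewrite -mulrA ler_wpM2l ?(ltW kappa0)//.
  apply: (@le_trans _ _ (n%:R `^ (- alpha))); last exact: powR_antitone (ltW alpha_gt0) x0 xn.
  rewrite /A opprD powRD; last by apply/implyP => _; rewrite gt_eqF.
  rewrite powR_inv1 ?(ltW n0)// mulrCA ler_piMr ?powR_ge0//.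
  by rewrite ler_pdivrMr// mul1r.
- move=> M uM ML; have -> : (xi `^ (- alpha)) ^+ 2 = xi `^ (- (2 / q - 1)).
    by rewrite -powR_mulrn ?powR_ge0// -powRrM; congr (_ `^ _); rewrite /alpha; field; rewrite gt_eqF.
  apply: (@le_trans _ _ (xi `^ (- (2 / q - 1)) * \sum_(s <- M) sigma rho s `^ (- q))).
    rewrite mulr_sumr big_seq [leRHS]big_seq; apply: ler_sum => s /ML /LN sx.
    exact: sigma_sqr_tail q_range rho_gt1 _ _ xi0 sx.
  by rewrite ler_wpM2l ?powR_ge0// hS.
- move=> s y sL yc; have y1 j : `|y j| <= 1 by rewrite ler_norml.
  apply: le_trans (eP s y sL y1) _.
  by rewrite ler_pM// ?exprn_ge0 ?invr_ge0// deg_le.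
Qed.

End network_family.

Theorem theorem4p7 (R : realType) (q : R) (rho : nat -> R)
  (q_range : 0 < q < 2)
  (rho_gt1 : forall j, 1 < rho j)
  (rho_incr : nondecreasing_seq rho)
  (rho_lq : (\sum_(0 <= j <oo) (((rho j)^-1) `^ q)%:E < +oo)%E) :
  exists (K C : R),
    let m (n : nat) := Num.truncn (K * (n%:R / ln n%:R)) in
  exists (xi : nat -> R) (L : nat -> seq multi_index)
    (Phi : forall n, @relu_net R (size (L n)) (m n))
    (phi : forall n (s : multi_index), @relu_net R 1 (size (nu s))),
    [/\ 0 < K, 0 < C,
      (forall n, (4 <= n)%N ->
        [/\ 0 < xi n /\ (uniq (L n) /\ [set` L n] = Lambda rho q (xi n)),
            deep (Phi n),
            (0 < output_dim (Phi n))%N /\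
              (input_dim (Phi n) <= m n)%N /\ (output_dim (Phi n) <= m n)%N,
            (net_size (Phi n) <= n)%N /\
              (net_depth (Phi n))%:R <= C * ln n%:R * ln (ln n%:R) &
            forall i : 'I_(size (L n)),
              let s := tnth (in_tuple (L n)) i in
              deep (phi n s) /\
              forall y : nat -> R,
                eval_first (Phi n) y i 0 = eval_at (phi n s) y 0 0]) &
      forall (d : nat) (D : set 'rV[R]_d) (abar : 'rV[R]_d -> R)
        (psi : nat -> 'rV[R]_d -> R) (f : @sobolev_fun R d -> R),
        (0 < d)%N -> bounded_lipschitz_domain D -> dual_H10 D f ->
        in_Lp +oo%E D abar ->
        (0 < ess_inf (lebesgue_rV R d)
               (patch (cst +oo) D (EFin \o abar)))%E ->
        (forall j, in_Lp +oo%E D (psi j)) ->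
        ('N[lebesgue_rV R d]_+oo[(fun x =>
            (\sum_(0 <= j <oo) (rho j * `|psi j x|)%:E) * ((abar x)^-1)%:E)
              \_ D] < 1)%E ->
        exists C1 C2 : R, [/\ 0 < C1, 0 < C2 &
          forall u, parametric_solution D abar psi f u ->
          forall n, (4 <= n)%N ->
            (uniform_ess_sup (fun y => grad_norm D
               (u y - \sum_(s <- L n)
                  eval_at (phi n s) y 0 0 *: taylor_coef D u s)%R)
             <= (C1 * (m n)%:R `^ (- (q^-1 - 2^-1)))%:E)%E /\
            C1 * (m n)%:R `^ (- (q^-1 - 2^-1)) <=
            C2 * (n%:R / ln n%:R) `^ (- (q^-1 - 2^-1))]].
Proof.
have [C [C3 [S [C_gt0 C3_gt0 hS step]]]] := network_step q_range rho_gt1 rho_incr rho_lq.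
have rho_unb := rho_unbounded q_range rho_gt1 rho_lq.
have /andP[q0 q2] := q_range.
have alpha0 : 0 <= q^-1 - 2^-1 by rewrite subr_ge0 lef_pV2 ?posrE// ltW.
exists 1, C => m.
(* The type of the network depends on the list, hence the dependent pair. Choosing it before the
   domain and the data appear makes the networks independent of u. *)
pose family n := {L : seq multi_index &
  (R * (@relu_net R (size L) (m n) * (forall s, @relu_net R 1 (size (nu s)))))%type}.
have /(_ _)/cid w n : exists w : family n, (4 <= n)%N ->
    let L := projT1 w in let xi := (projT2 w).1 in
    let Phi := (projT2 w).2.1 in let phi := (projT2 w).2.2 in
    let x := n%:R / ln n%:R in
  [/\ 0 < xi /\ (uniq L /\ [set` L] = Lambda rho q xi),
      deep Phi, (0 < size L)%N /\ (size L <= m n)%N,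
      (net_size Phi <= n)%N /\
        (net_depth Phi)%:R <= C * ln n%:R * ln (ln n%:R) &
      forall i : 'I_(size L), let s := tnth (in_tuple L) i in
        deep (phi s) /\ forall y : nat -> R,
          eval_first Phi y i 0 = eval_at (phi s) y 0 0] /\
  exists tau delta : R, [/\ 0 < tau, 0 <= delta,
      tau + delta <= C3 * x `^ (- (q^-1 - 2^-1)),
      forall M, uniq M -> (forall s, s \in M -> s \notin L) ->
        \sum_(s <- M) (sigma rho s) ^- 2 <= tau ^+ 2 * S &
      forall (s : multi_index) (y : nat -> R), s \in L -> infinite_cube y ->
        `|sigma y s - eval_at (phi s) y 0 0| <= delta].
  have [n4|n4] := leqP 4 n; last first.
    (* A dummy value for n < 4, where nothing is claimed. *)
    by exists (existT _ [::] (1, (OutputLayer 0 0, fun s => OutputLayer 0 0))).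
  have [xi [L [Phi [phi h]]]] := step n n4.
  by exists (existT _ L (xi, (Phi, phi))).
exists (fun n => (projT2 (projT1 (w n))).1), (fun n => projT1 (projT1 (w n))),
  (fun n => (projT2 (projT1 (w n))).2.1), (fun n => (projT2 (projT1 (w n))).2.2).
split=> //.
  move=> n n4; have [[h1 h2 [h3 h3'] h4 h5] _] := projT2 (w n) n4.
  by split.
move=> [//|d] D abar psi f _ [_ oD _ bD _] df aoo ainf poo psum.
have [C0 C0P] := elliptic_taylor_error oD bD rho_gt1 rho_incr hS rho_unb aoo ainf poo psum df.
(* The maximum ensures positivity, as [C0] comes without a sign. *)
pose C1 := Num.max C0 1 * C3.
have M0 : 0 < Num.max C0 1 by rewrite lt_max ltr01 orbT.
have C1_gt0 : 0 < C1 by rewrite mulr_gt0.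
(* The additional factor comes from m >= x / 2 with x = n / log n. *)
exists C1, (C1 * 2^-1 `^ (- (q^-1 - 2^-1))); split=> //.
  by rewrite mulr_gt0// powR_gt0.
move=> u usol n n4.
have [[[_ [uL _]] _ _ _ _] [tau [delta [t0 d0 td tail err]]]] := projT2 (w n) n4.
have [x1 xn mx xm] := @dimension_bounds R n n4.
have x0 : 0 < n%:R / ln n%:R :> R by exact: lt_le_trans x1.
have m0 : 0 < (m n)%:R :> R by rewrite -(pmulr_rgt0 _ (ltr0Sn R 1)) (lt_le_trans x0).
split.
  apply: uniform_ess_sup_le => y yc.
  apply: le_trans (C0P u usol y _ (fun s => eval_at ((projT2 (projT1 (w n))).2.2 s) y 0 0)
    tau delta yc uL t0 d0 tail _) _; first by move=> s sL; exact: err.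
  rewrite lee_fin; apply: (@le_trans _ _ (Num.max C0 1 * (tau + delta))).
    by rewrite ler_wpM2r ?addr_ge0 ?(ltW t0)// le_max lexx.
  rewrite /C1 -mulrA ler_wpM2l ?(ltW M0)//; apply: le_trans td _.
  by rewrite ler_wpM2l ?(ltW C3_gt0)//; exact: powR_antitone.
rewrite -[leRHS]mulrA ler_wpM2l ?(ltW C1_gt0)// -powRM ?invr_ge0 ?(ltW x0)//.
apply: powR_antitone => //; first by rewrite mulr_gt0// invr_gt0.
by rewrite ler_pdivrMl.
Qed.
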